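(* Let $A$ be the ring of integers in a global field, let $G$ be a finite subgroup of $GL_n(A)$, let $P$ be a maximal ideal of $A$, and set $(\mathcal{O},(\pi)) = (A_P, PA_P)$. Assume that the characteristic of $\mathcal{O}/\pi\mathcal{O}$ divides the order of $G$. Let $\widehat{\mathcal{O}}$ be the completion of $\mathcal{O}$ with respect to $(\pi)$. Suppose $G = \mathbb{Z}/2\mathbb{Z}$. Then: (1) If $\widehat{\mathcal{O}}$ is of mixed characteristic, then $\widehat{\mathcal{O}}[G] = \widehat{\mathcal{O}}[X]/(X^2-1)$ has finite representation type. Furthermore, if $M$ is an indecomposable maximal Cohen-Macaulay $\widehat{\mathcal{O}}[G]$-module, then $S(M)^G$ is Cohen-Macaulay. (2) If $\widehat{\mathcal{O}}$ is equicharacteristic, then $\widehat{\mathcal{O}}[G] = \widehat{\mathcal{O}}[X]/(X-1)^2$ has infinite representation type. Nevertheless, if $M$ is an indecomposable maximal Cohen-Macaulay $\widehat{\mathcal{O}}[G]$-module, then $S(M)^G$ is Cohen-Macaulay.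
   Context: ''$A$ is the ring of integers in a global field'' means that either $A$ is the ring of integers of a number field, or $A$ is the ring of integers (the integral closure of $\mathbb{F}_q[t]$) of a finite extension of $\mathbb{F}_q(t)$, with $\mathbb{F}_q$ a finite field. $\widehat{\mathcal{O}}[G]$ is the group ring; the displayed equalities identify a generator of $G$ with the class of $X$. A maximal Cohen-Macaulay (MCM) $\widehat{\mathcal{O}}[G]$-module $M$ is a finitely generated module that is maximal Cohen-Macaulay; such an $M$ is free of finite rank as an $\widehat{\mathcal{O}}$-module, so it gives a (not necessarily injective) representation $G\to GL(M)$. $S(M) = S_{\widehat{\mathcal{O}}}(M)$ denotes the symmetric algebra of $M$ as an $\widehat{\mathcal{O}}$-module, with $G$ acting by the $\widehat{\mathcal{O}}$-algebra automorphisms extending the action on $M$, and $S(M)^G$ is the ring of invariants. A ring has finite (resp. infinite) representation type if it has finitely (resp. infinitely) many isomorphism classes of indecomposable MCM modules. *)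

(* Defs.v *)
From HB Require Import structures.
From mathcomp Require Import all_boot all_order all_algebra all_fingroup.
From mathcomp Require Import all_solvable all_field mxrepresentation.
From mathcomp Require Import mathcomp_extra boolp classical_sets functions.
From mathcomp Require Import finmap monalg.

Set Implicit Arguments.
Unset Strict Implicit.
Unset Printing Implicit Defensive.

Import GRing.Theory.

Local Open Scope ring_scope.

Section IntegralClosure.
Context (B : comNzRingType) (K : fieldType) (f : {rmorphism B -> K}).

Definition integral_pred (x : K) : bool := `[< integralOver f x >].

Fact integral_subring_closed : subring_closed integral_pred.
Proof.
split=> [|x y /asboolP ix /asboolP iy|x y /asboolP ix /asboolP iy].
- by apply/asboolP; apply: integral1.
- by apply/asboolP; apply: integral_sub.
- by apply/asboolP; apply: integral_mul.
Qed.

HB.instance Definition _ :=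
  GRing.isSubringClosed.Build K integral_pred integral_subring_closed.

Record int_closure : Type :=
  IntClosure { int_val :> K; _ : int_val \in integral_pred }.

HB.instance Definition _ := [isSub for int_val].
HB.instance Definition _ := [Choice of int_closure by <:].
HB.instance Definition _ := [SubChoice_isSubComNzRing of int_closure by <:].

Definition int_unit : pred int_closure :=
  fun x => (val x != 0) && ((val x)^-1 \in integral_pred).
Definition int_inv (x : int_closure) : int_closure := insubd x (val x)^-1.

Fact int_mulVx : {in int_unit, left_inverse 1 int_inv *%R}.
Proof.
move=> x /andP[x0 xV]; apply: val_inj.
by rewrite rmorphM /= /int_inv insubdK // mulVf // rmorph1.
Qed.

Fact int_unitPl (x y : int_closure) : y * x = 1 -> int_unit x.
Proof.
move=> /(congr1 val); rewrite rmorphM rmorph1 /= => yx.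
have x0 : val x != 0 by apply: contra_eq_neq yx => ->; rewrite mulr0 eq_sym oner_eq0.
by rewrite /int_unit x0 -[_^-1]mul1r -yx mulfK //=; apply: valP.
Qed.

Fact int_invx_out : {in [predC int_unit], int_inv =1 id}.
Proof.
move=> x; rewrite inE /= negb_and negbK => /orP[/eqP x0|xV].
  by apply: val_inj; rewrite /int_inv x0 invr0 val_insubd x0; case: ifP.
by rewrite /int_inv /insubd insubN.
Qed.

HB.instance Definition _ := GRing.ComNzRing_hasMulInverse.Build int_closure
  int_mulVx int_unitPl int_invx_out.

Fact int_idomain (x y : int_closure) : x * y = 0 -> (x == 0) || (y == 0).
Proof.
move=> /(congr1 val); rewrite rmorphM rmorph0 => /eqP.
by rewrite mulf_eq0 -[x == 0]val_eqE -[y == 0]val_eqE.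
Qed.

HB.instance Definition _ :=
  GRing.ComUnitRing_isIntegral.Build int_closure int_idomain.
End IntegralClosure.

Variant global_field : Type :=
| NumberField of fieldExtType rat
| FunctionField (F : finFieldType) of fieldExtType {fraction {poly F}}.

Definition ring_of_integers (k : global_field) : idomainType :=
  match k with
  | NumberField K => int_closure (intr : {rmorphism int -> K})
  | FunctionField F K =>
      int_closure (in_alg K \o @tofrac {poly F} : {rmorphism {poly F} -> K})
  end.

(* In the library, idealr R is the type of proper (boolean) ideals of R, so the
   maximal elements among them are the maximal ideals. *)
Definition maximal_ideal (R : nzRingType) (I : idealr R) : Prop :=
  forall J : idealr R, {subset I <= J} -> J =i I.

(* A_P is the subring { a/s : s \notin P } of Frac(A); its ideal P A_P is
   { a/s : a \in P, s \notin P } (locI P below). *)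
Section Localization.
Context (A : idomainType) (P : prime_idealr A).

Local Notation "x %:F" := (@tofrac A x).

Definition loc_pred (x : {fraction A}) : bool :=
  `[< exists a s : A, s \notin P /\ x = a%:F / s%:F >].

Let notinP_neq0 (s : A) : s \notin P -> s%:F != 0.
Proof. by apply: contraNneq => /eqP; rewrite tofrac_eq0 => /eqP->; apply: rpred0. Qed.

Let notinPM (s t : A) : s \notin P -> t \notin P -> s * t \notin P.
Proof. by rewrite prime_idealrM negb_or => -> ->. Qed.

Fact loc_subring_closed : subring_closed loc_pred.
Proof.
split=> [|x y /asboolP[a [s [sP ->]]] /asboolP[b [t [tP ->]]]
         |x y /asboolP[a [s [sP ->]]] /asboolP[b [t [tP ->]]]]; apply/asboolP.
- exists 1, 1; rewrite idealr1; split=> //.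
  by rewrite rmorph1 divr1.
- exists (a * t - b * s), (s * t); split; first exact: notinPM.
  rewrite rmorphB !rmorphM /=.
  by rewrite -[- (_ / _)]mulNr addf_div ?notinP_neq0 // mulNr.
- exists (a * b), (s * t); split; first exact: notinPM.
  by rewrite !rmorphM /= mulf_div.
Qed.

HB.instance Definition _ :=
  GRing.isSubringClosed.Build {fraction A} loc_pred loc_subring_closed.

Record localization : Type :=
  Localization { loc_val :> {fraction A}; _ : loc_val \in loc_pred }.

HB.instance Definition _ := [isSub for loc_val].
HB.instance Definition _ := [Choice of localization by <:].
HB.instance Definition _ := [SubChoice_isSubComNzRing of localization by <:].

Definition loc_max (x : localization) : bool :=
  `[< exists a s : A, [/\ a \in P, s \notin P & val x = a%:F / s%:F] >].

Fact loc_max_idealr : idealr_closed loc_max.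
Proof.
split.
- apply/asboolP; exists 0, 1; rewrite rpred0 idealr1; split=> //.
  by rewrite !rmorph0 mul0r.
- apply/asboolP => -[a [s [aP sP]]] /(congr1 ( *%R^~ s%:F)).
  rewrite divfK ?notinP_neq0 // rmorph1 mul1r => /eqP.
  by rewrite tofrac_eq => /eqP sa; rewrite sa aP in sP.
- move=> x u v /asboolP[a [s [aP sP ua]]] /asboolP[b [t [bP tP vb]]].
  have /asboolP[c [r [rP xc]]] := valP x.
  apply/asboolP; exists (c * a * t + b * (r * s)), (r * s * t); split.
  + by apply: rpredD; [rewrite mulrC mulrA idealMr | rewrite mulrC idealMr].
  + by rewrite !notinPM.
  + rewrite rmorphD rmorphM /= ua vb [val x]xc mulf_div addf_div ?notinP_neq0 //.
      by rewrite !(rmorphD, rmorphM).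
    by rewrite -rmorphM notinP_neq0 ?notinPM.
Qed.

HB.instance Definition _ :=
  isIdealr.Build localization loc_max loc_max_idealr.
End Localization.

Definition locI (A : idomainType) (P : prime_idealr A) : idealr (localization P) :=
  @loc_max A P.

Section IdealPowers.
Context (R : comNzRingType).

Definition ideal_mul (I J : set R) : set R :=
  [set x | exists2 s : seq (R * R),
     (forall u, u \in s -> I u.1 /\ J u.2) & x = \sum_(u <- s) u.1 * u.2].

Fixpoint ideal_exp (I : set R) (n : nat) : set R :=
  if n is m.+1 then ideal_mul I (ideal_exp I m) else setT.

End IdealPowers.

(* The I-adic completion lim_n R/I^n: sequences a with a_(n+1) = a_n mod I^n
   for all n, modulo the sequences with a_n \in I^n for all n. *)
Section Completion.
Context (R : comNzRingType) (I : idealr R).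

Local Notation Ipow n := (ideal_exp [set` I] n).

Lemma ideal_exp0 n : Ipow n 0.
Proof. by case: n => //= n; exists [::] => //; rewrite big_nil. Qed.

Lemma ideal_expD n x y : Ipow n x -> Ipow n y -> Ipow n (x + y).
Proof.
case: n => //= n [s sI ->] [t tI ->]; exists (s ++ t); last by rewrite big_cat.
by move=> u; rewrite mem_cat => /orP[/sI|/tI].
Qed.

Lemma ideal_expM n a x : Ipow n x -> Ipow n (a * x).
Proof.
case: n => //= n [s sI ->].
exists [seq (a * u.1, u.2) | u <- s].
  by move=> _ /mapP[u /sI[u1 u2] ->]; split=> //=; apply: idealMr.
by rewrite big_map mulr_sumr; apply: eq_bigr => u _; rewrite mulrA.
Qed.

Lemma ideal_exp1 x : Ipow 1 x -> x \in I.
Proof.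
move=> [s sI ->]; rewrite big_seq rpred_sum // => u /sI[u1 _].
by rewrite mulrC idealMr.
Qed.

Definition coherent (a : nat -> R) : bool :=
  `[< forall n, Ipow n (a n.+1 - a n) >].

Fact coherent_subring_closed : subring_closed coherent.
Proof.
split=> [|a b /asboolP ca /asboolP cb|a b /asboolP ca /asboolP cb];
  apply/asboolP => n.
- by rewrite subrr; apply: ideal_exp0.
- rewrite (_ : _ - _ = (a n.+1 - a n) + (-1) * (b n.+1 - b n)).
    exact: ideal_expD (ca n) (ideal_expM _ (cb n)).
  by rewrite !(fctE, mulN1r) /= !opprB addrACA [in RHS]addrACA [- a n + _]addrC.
- rewrite (_ : _ - _ = a n.+1 * (b n.+1 - b n) + b n * (a n.+1 - a n)).
    by apply: ideal_expD; apply: ideal_expM.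
  rewrite !mulrBr [b n * a n]mulrC [b n * _]mulrC addrA subrK.
  by [].
Qed.

HB.instance Definition _ :=
  GRing.isSubringClosed.Build (nat -> R) coherent coherent_subring_closed.

Record coherent_seq : Type :=
  CoherentSeq { coh_val :> nat -> R; _ : coh_val \in coherent }.

HB.instance Definition _ := [isSub for coh_val].
HB.instance Definition _ := [Choice of coherent_seq by <:].
HB.instance Definition _ := [SubChoice_isSubComNzRing of coherent_seq by <:].

Definition null_seq (a : coherent_seq) : bool := `[< forall n, Ipow n (a n) >].

Fact null_seq_idealr : idealr_closed null_seq.
Proof.
split.
- by apply/asboolP => n; apply: ideal_exp0.
- by apply/asboolP => /(_ 1%N) /ideal_exp1; rewrite idealr1.
- move=> x a b /asboolP na /asboolP nb; apply/asboolP => n.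
  exact: ideal_expD (ideal_expM _ (na n)) (nb n).
Qed.

HB.instance Definition _ := isIdealr.Build coherent_seq null_seq null_seq_idealr.

Definition null_ideal : idealr coherent_seq := null_seq.

Definition completion : comNzRingType := {ideal_quot null_ideal}.
End Completion.

(* p generates the kernel of Z -> R; in particular p = 0 in characteristic 0. *)
Definition ring_char (R : nzRingType) (p : nat) : Prop :=
  forall m : nat, m%:R = 0 :> R <-> (p %| m)%N.

(* These two are meant for a local ring R: then m ranges over a single ideal
   and {ideal_quot m} is the residue field. *)
Definition mixed_characteristic (R : comNzRingType) : Prop :=
  ring_char R 0 /\
  exists2 p : nat, (0 < p)%N &
    forall m : idealr R, maximal_ideal m -> ring_char {ideal_quot m} p.

Definition equicharacteristic (R : comNzRingType) : Prop :=
  exists p : nat, ring_char R p /\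
    forall m : idealr R, maximal_ideal m -> ring_char {ideal_quot m} p.

(* The notions of these two sections are meant for commutative R. They are
   typed over nzRingType because grp_ring R gT, defined for an arbitrary
   finite group, carries no commutative structure even when gT is abelian. *)
Section Modules.
Context (R : nzRingType) (M : lmodType R).

Definition in_span (s : seq M) (x : M) : Prop :=
  exists c : nat -> R, x = \sum_(i < size s) c i *: s`_i.

Definition finitely_generated : Prop :=
  exists s : seq M, forall x : M, in_span s x.

(* x \in (s_0, ..., s_(k-1)) M *)
Definition in_seqM (s : seq R) (x : M) : Prop :=
  exists y : nat -> M, x = \sum_(i < size s) s`_i *: y i.

(* s is an M-regular sequence, including the requirement (s) M <> M; hence a
   module having any regular sequence (even the empty one) is nonzero. *)
Definition regular_seq (s : seq R) : Prop :=
  (forall i : nat, (i < size s)%N -> forall x : M,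
     in_seqM (take i s) (s`_i *: x) -> in_seqM (take i s) x) /\
  exists x : M, ~ in_seqM s x.

(* depth(I, M) = d: the maximal length of an M-regular sequence in I. *)
Definition depth_eq (I : idealr R) (d : nat) : Prop :=
  (exists s : seq R,
     [/\ {subset s <= I}, regular_seq s & size s = d]) /\
  (forall s : seq R, {subset s <= I} -> regular_seq s -> (size s <= d)%N).

Definition submodule (U : set M) : Prop :=
  U 0 /\ forall (a : R) (x y : M), U x -> U y -> U (a *: x + y).

Definition indecomposable : Prop :=
  (exists x : M, x != 0) /\
  forall U V : set M, submodule U -> submodule V ->
    (forall x, U x -> V x -> x = 0) ->
    (forall x, exists u v, [/\ U u, V v & x = u + v]) ->
    (forall x, U x -> x = 0) \/ (forall x, V x -> x = 0).

End Modules.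

Section CohenMacaulay.
Context (R : nzRingType).

(* A strictly increasing chain c_0 < c_1 < ... < c_d = I of prime ideals. *)
Definition prime_chain (I : idealr R) (d : nat) : Prop :=
  exists c : nat -> prime_idealr R,
    [/\ forall i, (i < d)%N -> {subset c i <= c i.+1},
        forall i, (i < d)%N -> exists2 x, x \in c i.+1 & x \notin c i
      & c d =i I].

Definition height_eq (I : idealr R) (d : nat) : Prop :=
  prime_chain I d /\ forall n, prime_chain I n -> (n <= d)%N.

(* depth(m, M) = height m for all maximal ideals m of R. When R is local, as
   are the group rings considered here, this is depth M = dim R. *)
Definition mcm_module (M : lmodType R) : Prop :=
  finitely_generated M /\
  forall m : idealr R, maximal_ideal m ->
    exists d : nat, depth_eq M m d /\ height_eq m d.

Definition noetherian : Prop :=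
  forall I : idealr R, exists s : seq R^o,
    {subset s <= I} /\ forall x, x \in I -> in_span s x.

Definition isomorphic_modules (M N : lmodType R) : Prop :=
  exists f : {linear M -> N}, bijective f.

Definition finite_representation_type : Prop :=
  exists (n : nat) (L : 'I_n -> lmodType R),
    forall M : lmodType R, mcm_module M -> indecomposable M ->
      exists i : 'I_n, isomorphic_modules M (L i).

Definition infinite_representation_type : Prop := ~ finite_representation_type.

End CohenMacaulay.

(* For R Noetherian and m maximal, depth(m, R) = depth R_m and
   height m = dim R_m (cf. Eisenbud, Commutative Algebra, Section 18.2). *)
Definition cohen_macaulay_ring (R : comNzRingType) : Prop :=
  noetherian R /\
  forall m : idealr R, maximal_ideal m ->
    exists d : nat, depth_eq R^o m d /\ height_eq m d.

Definition grp_ring (R : comNzRingType) (gT : finGroupType) : Type :=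
  {ffun gT -> R}.

Section GroupRing.
Context (R : comNzRingType) (gT : finGroupType).

HB.instance Definition _ := GRing.Lmodule.copy (grp_ring R gT) {ffun gT -> R^o}.

Definition gr_elt (g : gT) : grp_ring R gT := [ffun h => (h == g)%:R].

Definition gr_mul (x y : grp_ring R gT) : grp_ring R gT :=
  [ffun g => \sum_(h : gT) x h * y (h^-1 * g)%g].

Fact gr_mulA : associative gr_mul.
Proof.
move=> x y z; apply/ffunP => g; rewrite !ffunE.
under eq_bigr do rewrite ffunE mulr_sumr.
under [RHS]eq_bigr do rewrite ffunE mulr_suml.
rewrite [RHS]exchange_big /=; apply: eq_bigr => h _.
rewrite [RHS](reindex_inj (mulgI h)) /=; apply: eq_bigr => k _.
by rewrite mulKg invMg mulgA mulrA.
Qed.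

Fact gr_mul1x : left_id (gr_elt 1%g) gr_mul.
Proof.
move=> x; apply/ffunP => g; rewrite ffunE (bigD1 1%g) //= ffunE eqxx mul1r.
rewrite big1 ?addr0 ?invg1 ?mul1g // => h /negPf h1.
by rewrite ffunE h1 mul0r.
Qed.

Fact gr_mulx1 : right_id (gr_elt 1%g) gr_mul.
Proof.
move=> x; apply/ffunP => g; rewrite ffunE (bigD1 g) //= ffunE mulVg eqxx mulr1.
rewrite big1 ?addr0 // => h hg; rewrite ffunE -eq_mulVg1.
by rewrite (negPf hg) mulr0.
Qed.

Fact gr_mulDl : left_distributive gr_mul +%R.
Proof.
move=> x y z; apply/ffunP => g; rewrite !ffunE -big_split /=.
by apply: eq_bigr => h _; rewrite ffunE mulrDl.
Qed.

Fact gr_mulDr : right_distributive gr_mul +%R.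
Proof.
move=> x y z; apply/ffunP => g; rewrite !ffunE -big_split /=.
by apply: eq_bigr => h _; rewrite ffunE mulrDr.
Qed.

Fact gr_one_neq0 : gr_elt 1%g != 0.
Proof.
by apply/eqP => /ffunP/(_ 1%g)/eqP; rewrite !ffunE eqxx oner_eq0.
Qed.

HB.instance Definition _ := GRing.Zmodule_isNzRing.Build (grp_ring R gT)
  gr_mulA gr_mul1x gr_mulx1 gr_mulDl gr_mulDr gr_one_neq0.

Fact gr_scaleAl (a : R) (x y : grp_ring R gT) : a *: (x * y) = (a *: x) * y.
Proof.
apply/ffunP => g; rewrite !ffunE [LHS]mulr_sumr.
by apply: eq_bigr => h _; rewrite ffunE; apply: mulrA.
Qed.

HB.instance Definition _ :=
  GRing.Lmodule_isLalgebra.Build R (grp_ring R gT) gr_scaleAl.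

Fact gr_scaleAr (a : R) (x y : grp_ring R gT) : a *: (x * y) = x * (a *: y).
Proof.
apply/ffunP => g; rewrite !ffunE [LHS]mulr_sumr.
by apply: eq_bigr => h _; rewrite ffunE; apply: mulrCA.
Qed.

HB.instance Definition _ :=
  GRing.Lalgebra_isAlgebra.Build R (grp_ring R gT) gr_scaleAr.

Lemma gr_eltM (g h : gT) : gr_elt g * gr_elt h = gr_elt (g * h)%g.
Proof.
apply/ffunP => k; rewrite ffunE (bigD1 g) //= big1 => [|l /negPf lg].
  by rewrite !ffunE eqxx mul1r addr0 (canF_eq (mulKVg g)).
by rewrite ffunE lg mul0r.
Qed.

(* R[G] = R[X]/(h) as R-algebras, with g corresponding to the class of X.
   The library's {poly %/ h} is R[X]/(h) for h monic of positive degree. *)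
Definition grp_ring_quotient (h : {poly R}) (g : gT) : Prop :=
  exists f : {rmorphism {poly %/ h} -> grp_ring R gT},
    [/\ bijective f, forall a : R, f (qpolyC h a) = a%:A & f 'qX = gr_elt g].
End GroupRing.

Definition restr (R S : nzRingType) (f : R -> S) (M : lmodType S) : Type := M.

Section Restriction.
Context (R S : nzRingType) (f : {rmorphism R -> S}) (M : lmodType S).

HB.instance Definition _ := GRing.Zmodule.on (restr f M).

Let sc (a : R) (x : restr f M) : restr f M := f a *: (x : M).

Fact restr_scA a b x : sc a (sc b x) = sc (a * b) x.
Proof. by rewrite /sc scalerA rmorphM. Qed.
Fact restr_sc1 : left_id 1 sc.
Proof. by move=> x; rewrite /sc rmorph1 scale1r. Qed.
Fact restr_scDr : right_distributive sc +%R.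
Proof. by move=> a x y; rewrite /sc scalerDr. Qed.
Fact restr_scDl x : {morph sc^~ x : a b / a + b}.
Proof. by move=> a b; rewrite /sc rmorphD scalerDl. Qed.

HB.instance Definition _ := GRing.Zmodule_isLmodule.Build R (restr f M)
  restr_scA restr_sc1 restr_scDr restr_scDl.
End Restriction.

Definition ideal_gen (R : comNzRingType) (G : set R) : set R :=
  [set x | exists2 s : seq (R * R),
     (forall u, u \in s -> G u.2) & x = \sum_(u <- s) u.1 * u.2].

Lemma ideal_gen0 (R : comNzRingType) (G : set R) : ideal_gen G 0.
Proof. by exists [::]; rewrite ?big_nil. Qed.

Lemma ideal_genMD (R : comNzRingType) (G : set R) a x y :
  ideal_gen G x -> ideal_gen G y -> ideal_gen G (a * x + y).
Proof.
move=> [s sr ->] [t tr ->]; exists ([seq (a * u.1, u.2) | u <- s] ++ t).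
  by move=> u; rewrite mem_cat => /orP[/mapP[w /sr ? ->]|/tr].
rewrite big_cat big_map mulr_sumr; congr (_ + _).
by apply: eq_bigr => u _; rewrite mulrA.
Qed.

Lemma ideal_gen_ker (R S : comNzRingType) (f : {rmorphism R -> S}) (G : set R) :
  (forall x, G x -> f x = 0) -> forall x, ideal_gen G x -> f x = 0.
Proof.
move=> fG x [s sG ->]; rewrite raddf_sum big_seq big1 // => u /sG/fG fu.
by rewrite /= rmorphM fu mulr0.
Qed.

Lemma ideal_gen_mem (R : comNzRingType) (G : set R) x : G x -> ideal_gen G x.
Proof.
move=> Gx; exists [:: (1, x)]; last by rewrite big_seq1 mul1r.
by move=> u; rewrite inE => /eqP->.
Qed.

Section QuotAlgebra.
Context (R : comNzRingType) (A : comAlgType R) (I : idealr A).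

Definition quot_alg : Type := {ideal_quot I}.
HB.instance Definition _ := GRing.ComNzRing.on quot_alg.

Definition quot_proj : A -> quot_alg := \pi_({ideal_quot I})%qT.

Fact quot_proj_zmod : zmod_morphism quot_proj.
Proof. exact: raddfB. Qed.
Fact quot_proj_monoid : monoid_morphism quot_proj.
Proof. by split; [exact: rmorph1 | exact: rmorphM]. Qed.
HB.instance Definition _ :=
  GRing.isZmodMorphism.Build A quot_alg quot_proj quot_proj_zmod.
HB.instance Definition _ :=
  GRing.isMonoidMorphism.Build A quot_alg quot_proj quot_proj_monoid.

Lemma quot_projP (x : quot_alg) : exists p, x = quot_proj p.
Proof.
by exists (generic_quotient.repr x); rewrite /quot_proj generic_quotient.reprK.
Qed.

Lemma quot_proj_eq0 (p : A) : (quot_proj p == 0) = (p \in I).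
Proof. by rewrite -[p in RHS]subr0 Quotient.idealrBE -[0](rmorph0 quot_proj). Qed.

Let sc (a : R) (x : quot_alg) : quot_alg := quot_proj a%:A * x.

Fact quot_scA a b x : sc a (sc b x) = sc (a * b) x.
Proof. by rewrite /sc mulrA -rmorphM -scalerAl mul1r scalerA. Qed.
Fact quot_sc1 : left_id 1 sc.
Proof. by move=> x; rewrite /sc scale1r rmorph1 mul1r. Qed.
Fact quot_scDr : right_distributive sc +%R.
Proof. by move=> a x y; rewrite /sc mulrDr. Qed.
Fact quot_scDl x : {morph sc^~ x : a b / a + b}.
Proof. by move=> a b; rewrite /sc scalerDl rmorphD mulrDl. Qed.
HB.instance Definition _ := GRing.Zmodule_isLmodule.Build R quot_alg
  quot_scA quot_sc1 quot_scDr quot_scDl.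

Fact quot_scAl (a : R) (x y : quot_alg) : a *: (x * y) = (a *: x) * y.
Proof. exact: mulrA. Qed.
HB.instance Definition _ := GRing.Lmodule_isLalgebra.Build R quot_alg quot_scAl.
HB.instance Definition _ := GRing.Lalgebra_isComAlgebra.Build R quot_alg.

Fact quot_proj_scalable : scalable quot_proj.
Proof.
move=> a x; rewrite -[x in LHS]mul1r scalerAl rmorphM.
by [].
Qed.
HB.instance Definition _ :=
  GRing.isScalable.Build R A quot_alg *:%R quot_proj quot_proj_scalable.

Section Lift.
Context (S : comAlgType R) (f : {lrmorphism A -> S}).

Definition quot_lift (x : quot_alg) : S := f (generic_quotient.repr x).

Hypothesis fI : forall p, p \in I -> f p = 0.

Lemma quot_lift_proj p : quot_lift (quot_proj p) = f p.
Proof.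
apply/eqP; rewrite -subr_eq0 /quot_lift -rmorphB /= fI //.
rewrite -quot_proj_eq0 rmorphB subr_eq0.
by apply/eqP; apply: generic_quotient.reprK.
Qed.

Lemma quot_lift_lrmorphism :
  [/\ zmod_morphism quot_lift, monoid_morphism quot_lift & scalable quot_lift].
Proof.
split; last 2 first.
- split; first by rewrite -(rmorph1 quot_proj) quot_lift_proj rmorph1.
  move=> x y; have [[p ->] [q ->]] := (quot_projP x, quot_projP y).
  by rewrite -rmorphM !quot_lift_proj rmorphM.
- move=> a x; have [p ->] := quot_projP x.
  by rewrite -linearZ !quot_lift_proj linearZ.
- move=> x y; have [[p ->] [q ->]] := (quot_projP x, quot_projP y).
  by rewrite -rmorphB !quot_lift_proj rmorphB.
Qed.
End Lift.
End QuotAlgebra.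

(* Sym_R(V) as the polynomial ring R[X_v : v in V] modulo the relations
   X_(u+v) = X_u + X_v and X_(a v) = a X_v. *)
Section SymmetricAlgebra.
Context (R : comNzRingType) (V : lmodType R).

Local Notation free := {malg R[cmonom V]}.

(* sym_var v is the variable X_v; it is locked since unifying terms of
   {malg R[cmonom V]} by unfolding is very slow. *)
Fact sym_var_key : unit. Proof. exact: tt. Qed.
Definition sym_var : V -> free :=
  locked_with sym_var_key (fun v => mkmalgU (ucm v) 1).

Definition sym_rel : set free :=
  [set p | (exists u v : V, p = sym_var (u + v) - sym_var u - sym_var v) \/
           (exists (a : R) (v : V), p = sym_var (a *: v) - a *: sym_var v)].

Definition sym_rels (p : free) : bool := `[< ideal_gen sym_rel p >].

(* The augmentation shows that the relations generate a proper ideal. *)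
Definition sym_aug : {rmorphism free -> R} :=
  GRing.RMorphism.clone _ _ (mcoeff (@monalg.one (cmonom V))) _.

Lemma sym_aug_var v : sym_aug (sym_var v) = 0.
Proof. by rewrite /sym_aug /= /sym_var unlock mcoeffU cm1_eq1. Qed.

Lemma sym_augZ a p : sym_aug (a *: p) = a * sym_aug p.
Proof. exact: mcoeffZ. Qed.

Lemma sym_aug_rel p : sym_rel p -> sym_aug p = 0.
Proof.
case=> [[v [w ->]]|[a [v ->]]].
  by rewrite !rmorphB /= !sym_aug_var !subr0.
by rewrite rmorphB /= sym_augZ !sym_aug_var mulr0 subr0.
Qed.

Fact sym_rels_idealr : idealr_closed sym_rels.
Proof.
split.
- by apply/asboolP; apply: ideal_gen0.
- apply/asboolP => /(ideal_gen_ker sym_aug_rel)/eqP.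
  by rewrite rmorph1 oner_eq0.
- move=> a p q /asboolP rp /asboolP rq; apply/asboolP.
  exact: ideal_genMD.
Qed.

HB.instance Definition _ := isIdealr.Build free sym_rels sym_rels_idealr.

Definition sym_ideal : idealr free := sym_rels.

Definition sym_alg : comAlgType R := quot_alg sym_ideal.

Definition sym_in (v : V) : sym_alg := quot_proj sym_ideal (sym_var v).

Fact sym_in_linear : linear sym_in.
Proof.
have inE0 p : sym_rel p -> quot_proj sym_ideal p = 0.
  by move=> rp; apply/eqP; rewrite quot_proj_eq0; apply/asboolP/ideal_gen_mem.
move=> a u v; rewrite /sym_in.
have /eqP := inE0 _ (or_introl (ex_intro _ (a *: u) (ex_intro _ v erefl))).
rewrite !rmorphB /= subr_eq0 subr_eq => /eqP->.
have /eqP := inE0 _ (or_intror (ex_intro _ a (ex_intro _ u erefl))).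
by rewrite rmorphB /= subr_eq0 linearZ /= => /eqP->; rewrite addrC.
Qed.

HB.instance Definition _ :=
  GRing.isLinear.Build R V sym_alg _ sym_in sym_in_linear.

Section Lift.
Context (S : comAlgType R) (f : {linear V -> S}).

Definition cm_eval (m : cmonom V) : S := \prod_(v <- finsupp m) f v ^+ m v.

Let cm_evalE (m : cmonom V) (d : {fset V}) : (finsupp m `<=` d)%fset ->
  cm_eval m = \prod_(v <- d) f v ^+ m v.
Proof.
move=> md; apply: (big_fset_incl _ md) => v _; rewrite -cmE_eq0 => /eqP->.
exact: expr0.
Qed.

Fact cm_eval_is_mmorphism : mmorphism cm_eval.
Proof.
split=> [m n|]; last by rewrite /cm_eval mdom1 big_seq_fset0.
rewrite (cm_evalE (fsubsetUl (finsupp m) (finsupp n))).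
rewrite (cm_evalE (fsubsetUr (finsupp m) (finsupp n))).
rewrite {1}/cm_eval mdomD -big_split /=; apply: eq_bigr => v _.
by rewrite cmM exprD.
Qed.

HB.instance Definition _ :=
  isMultiplicative.Build (cmonom V) S cm_eval cm_eval_is_mmorphism.

Definition free_eval (p : free) : S := mmap (in_alg S) cm_eval p.

Fact free_eval_zmod : zmod_morphism free_eval.
Proof. exact: raddfB. Qed.
Fact free_eval_monoid : monoid_morphism free_eval.
Proof. by split; [exact: rmorph1 | exact: rmorphM]. Qed.
Fact free_eval_scalable : scalable free_eval.
Proof. by move=> a p; rewrite /free_eval mmapZ mulr_algl. Qed.
HB.instance Definition _ :=
  GRing.isZmodMorphism.Build free S free_eval free_eval_zmod.
HB.instance Definition _ :=
  GRing.isMonoidMorphism.Build free S free_eval free_eval_monoid.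
HB.instance Definition _ :=
  GRing.isScalable.Build R free S *:%R free_eval free_eval_scalable.

Lemma free_eval_var v : free_eval (sym_var v) = f v.
Proof.
rewrite /free_eval /sym_var unlock mmapU /= scale1r mul1r /cm_eval mdomU.
by rewrite big_seq_fset1 cmUU expr1.
Qed.

Let free_eval_rel p : p \in sym_ideal -> free_eval p = 0.
Proof.
move=> /asboolP; apply: ideal_gen_ker => {}p [[u [v ->]]|[a [v ->]]].
  by rewrite !rmorphB /= !free_eval_var linearD -addrA -opprD subrr.
by rewrite rmorphB /= linearZ /= !free_eval_var linearZ subrr.
Qed.

(* The algebra morphism Sym(V) -> S extending f. *)
Definition sym_lift (x : sym_alg) : S := quot_lift free_eval x.

Fact sym_lift_zmod : zmod_morphism sym_lift.
Proof. by have [] := quot_lift_lrmorphism free_eval_rel. Qed.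
Fact sym_lift_monoid : monoid_morphism sym_lift.
Proof. by have [] := quot_lift_lrmorphism free_eval_rel. Qed.
Fact sym_lift_scalable : scalable sym_lift.
Proof. by have [] := quot_lift_lrmorphism free_eval_rel. Qed.
HB.instance Definition _ :=
  GRing.isZmodMorphism.Build sym_alg S sym_lift sym_lift_zmod.
HB.instance Definition _ :=
  GRing.isMonoidMorphism.Build sym_alg S sym_lift sym_lift_monoid.
HB.instance Definition _ :=
  GRing.isScalable.Build R sym_alg S *:%R sym_lift sym_lift_scalable.

Lemma sym_lift_in v : sym_lift (sym_in v) = f v.
Proof. by rewrite /sym_lift (quot_lift_proj free_eval_rel) /= free_eval_var. Qed.
End Lift.

End SymmetricAlgebra.

Section Invariants.
Context (R : comNzRingType) (gT : finGroupType).
Context (M : lmodType (grp_ring R gT)).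

Definition base_mod : lmodType R := restr (in_alg (grp_ring R gT)) M.

(* sym_act g is the R-algebra endomorphism of Sym_R(M) extending m |-> g m. *)
Definition sym_gen (g : gT) (x : base_mod) : sym_alg base_mod :=
  sym_in ((gr_elt R g *: (x : M)) : base_mod).

Fact sym_gen_linear g : linear (sym_gen g).
Proof.
move=> a x y; rewrite /sym_gen -linearP; congr sym_in.
rewrite [LHS]scalerDr; congr (_ + _).
change (gr_elt R g *: (a%:A *: (x : M)) = a%:A *: (gr_elt R g *: (x : M))).
by rewrite !scalerA -scalerAr mulr1 -scalerAl mul1r.
Qed.

HB.instance Definition _ g := GRing.isLinear.Build R base_mod
  (sym_alg base_mod) _ (sym_gen g) (sym_gen_linear g).

Definition sym_act (g : gT) (x : sym_alg base_mod) : sym_alg base_mod :=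
  sym_lift (sym_gen g) x.

HB.instance Definition _ g :=
  GRing.LRMorphism.copy (sym_act g) (sym_lift (sym_gen g)).

Lemma sym_act_in (g : gT) (x : base_mod) :
  sym_act g (sym_in x) = sym_in ((gr_elt R g *: (x : M)) : base_mod).
Proof. exact: sym_lift_in. Qed.

Definition invariant_pred (x : sym_alg base_mod) : bool :=
  [forall g : gT, sym_act g x == x].

Fact invariant_subring_closed : subring_closed invariant_pred.
Proof.
split=> [|x y /forallP xi /forallP yi|x y /forallP xi /forallP yi];
  apply/forallP => g.
- by rewrite rmorph1.
- by rewrite rmorphB /= (eqP (xi g)) (eqP (yi g)).
- by rewrite rmorphM /= (eqP (xi g)) (eqP (yi g)).
Qed.

HB.instance Definition _ := GRing.isSubringClosed.Build
  (sym_alg base_mod) invariant_pred invariant_subring_closed.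

Record invariant_ring : Type := InvariantRing
  { inv_val :> sym_alg base_mod; _ : inv_val \in invariant_pred }.

HB.instance Definition _ := [isSub for inv_val].
HB.instance Definition _ := [Choice of invariant_ring by <:].
HB.instance Definition _ := [SubChoice_isSubComNzRing of invariant_ring by <:].

End Invariants.

(* Main.v *)
Require Import Defs.
From mathcomp Require Import all_boot all_order all_algebra all_fingroup.
From mathcomp Require Import all_solvable all_field mxrepresentation.
From mathcomp Require Import ring.
From HB Require Import structures.
From mathcomp Require Import boolp classical_sets.
From mathcomp Require Import finmap monalg.

(* The completion V is a discrete valuation ring with uniformizer t, and t
   divides 2.  A maximal Cohen-Macaulay V[G]-module M is V-torsion free, hence
   free.  The generator g is 1 on M^g and -1 on M / M^g, so it is given by a
   block matrix (1, B; 0, -1); splitting off an entry of B of least valuation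
   shows that an indecomposable M has rank one with g = 1 or g = -1, or has a
   basis x, y with g x = x and g y = t^j x - y where t^(j+1) divides 2.  If 2 is
   nonzero this leaves finitely many j.  If 2 = 0 all j occur, and these modules
   are distinguished by the powers of t dividing g - 1.

   In each case g is trivial or a reflection on S(M): S(M) = C[y] with
   g y = c - y and c fixed, so that S(M)^G = C[y (c - y)] is again a polynomial
   ring, in at most two variables over V.

   For R = V[x_1, .., x_N] and a maximal ideal m, both depth and height equal
   N + 1 if t is in m, and N otherwise.  A regular sequence of that length is
   read off from the contractions of m.  A chain of primes cannot be longer,
   because more than N elements of R satisfy a polynomial relation over V: look
   at its lowest monomial for the lexicographic order.  Regular sequences in m
   are no longer than chains of primes below m. *)


Set Implicit Arguments.
Unset Strict Implicit.
Unset Printing Implicit Defensive.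

Import GRing.Theory.
Local Open Scope classical_set_scope.
Local Open Scope ring_scope.

(** * Ideals *)

(** The invariant rings are not local, and a maximal ideal may or may not contain t, so depth and
    height are compared one maximal ideal at a time. A chain of primes is bounded by counting
    monomials; the bound grows by one when t lies in the top prime, because one step of the chain
    can be spent on t entering it. In two variables the lower bound rests on the fact that a maximal
    ideal of V[x][y] never contracts to a prime of V[x] extended from V.

    The residue characteristic is 2, so 2 is not a unit and M need not split into eigenspaces of g.
    In the block form 1 + g is (2, B; 0, 0). The classification works with this operator on an
    arbitrary basis: its image is fixed by g, and its coefficient of least valuation t^j yields the
    fixed vector x. The condition that t^(j+1) divides 2 says that x does not split off alone.

    The theorem speaks of a completion, which is only a commutative ring, while the algebra needs a
    domain. A domain structure is therefore put on the same ring, and the statement is rewritten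
    along the resulting equality. *)

Section PropIdeals.
Context (R : nzRingType).
Implicit Types (S : set R).

(** Ideals as propositional subsets, the whole ring included. An [idealr] is boolean and proper,
    whereas sums, contractions and preimages are formed first and shown proper only afterwards. *)
Definition is_ideal S := S 0 /\ forall a x y, S x -> S y -> S (a * x + y).

Lemma is_ideal_idealr_closed S :
  is_ideal S -> ~ S 1 -> idealr_closed (fun x => `[< S x >]).
Proof.
move=> [S0 SMD] S1; split; first exact/asboolP.
  by apply/asboolP.
by move=> a x y /asboolP Sx /asboolP Sy; apply/asboolP/SMD.
Qed.

Lemma idealr_of S : is_ideal S -> ~ S 1 ->
  exists I : idealr R, forall x, (x \in I) = `[< S x >].
Proof.
move=> idS S1; pose p x := `[< S x >].
have cl : idealr_closed p by apply: is_ideal_idealr_closed.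
pose I : idealr R := HB.pack p (isIdealr.Build R p cl).
by exists I.
Qed.

Lemma prime_idealr_of S : is_ideal S -> ~ S 1 ->
    (forall x y, S (x * y) -> S x \/ S y) ->
  exists I : prime_idealr R, forall x, (x \in I) = `[< S x >].
Proof.
move=> idS S1 prS; pose p x := `[< S x >].
have cl : idealr_closed p by apply: is_ideal_idealr_closed.
have pr : prime_idealr_closed p.
  move=> x y /asboolP/prS[Sx|Sy]; apply/orP; [left|right]; exact/asboolP.
pose I : prime_idealr R :=
  HB.pack p (isIdealr.Build R p cl) (isPrimeIdealrClosed.Build R p pr).
by exists I.
Qed.
End PropIdeals.

Section CommIdeals.
Context (R : comNzRingType).
Implicit Types (S T : set R) (I m : idealr R) (x y : R).

Lemma is_idealD S x y : is_ideal S -> S x -> S y -> S (x + y).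
Proof. by move=> [S0 SMD] Sx Sy; rewrite -[x]mul1r; apply: SMD. Qed.

Lemma is_idealM S a x : is_ideal S -> S x -> S (a * x).
Proof. by move=> [S0 SMD] Sx; rewrite -[_ * _]addr0; apply: SMD. Qed.

Lemma is_idealN S x : is_ideal S -> S x -> S (- x).
Proof. by move=> idS Sx; rewrite -mulN1r; apply: is_idealM. Qed.

Lemma is_idealB S x y : is_ideal S -> S x -> S y -> S (x - y).
Proof. by move=> idS Sx Sy; apply: is_idealD => //; apply: is_idealN. Qed.

Lemma is_ideal_sum S (J : Type) (r : seq J) (P : pred J) (F : J -> R) :
  is_ideal S -> (forall i, P i -> S (F i)) -> S (\sum_(i <- r | P i) F i).
Proof.
by move=> idS SF; elim/big_ind: _ => //; [case: idS | move=> *; apply: is_idealD].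
Qed.

Lemma idealr_is_ideal I : is_ideal [set` I].
Proof.
split=> [|a x y /= xI yI] /=; first exact: rpred0.
by rewrite rpredD ?idealMr.
Qed.

Lemma add_principal_is_ideal S x : is_ideal S ->
  is_ideal [set z | exists a b, S a /\ z = a + b * x].
Proof.
move=> idS; split; first by exists 0, 0; split; [case: idS | rewrite mul0r addr0].
move=> c _ _ [a [b [Sa ->]]] [a' [b' [Sa' ->]]].
exists (c * a + a'), (c * b + b'); split; first by case: idS => _; apply.
by rewrite mulrDr addrACA mulrA -mulrDl.
Qed.

(** Otherwise m + (x) would be a proper ideal strictly above m. Most uses of maximality go through
    this form: R / m is a field. *)
Lemma maximal_ideal_inv m x : maximal_ideal m -> x \notin m ->
  exists y, x * y - 1 \in m.
Proof.
move=> mm xm; pose S : set R := [set z | exists a b, a \in m /\ z = a + b * x].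
have idS : is_ideal S := add_principal_is_ideal x (idealr_is_ideal m).
have [S1|S1] := pselect (S 1).
  have [a [b [am e]]] := S1; exists b.
  by rewrite -rpredN opprB e mulrC addrK.
have [J JE] := idealr_of idS S1.
have /mm/(_ x) : {subset m <= J}.
  by move=> z zm; rewrite JE; apply/asboolP; exists z, 0; rewrite mul0r addr0.
rewrite (negPf xm) JE => /asboolP; case.
by exists 0, 1; rewrite rpred0 add0r mul1r.
Qed.

Lemma maximal_ideal_prime m : maximal_ideal m ->
  forall x y, x * y \in m -> (x \in m) || (y \in m).
Proof.
move=> mm x y xym; have [//|/(maximal_ideal_inv mm)[z xzm]] := boolP (x \in m).
have -> : y = z * (x * y) - y * (x * z - 1) by ring.
by apply: rpredB; apply: idealMr.
Qed.

Lemma maximal_idealW m : (forall x, x \notin m -> exists y, x * y - 1 \in m) ->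
  maximal_ideal m.
Proof.
move=> inv J mJ x; apply/idP/idP => [xJ|/mJ//].
apply: contraT => /inv[y /mJ]; rewrite -rpredN opprB => xy.
by have := rpredD xy (idealMr y xJ); rewrite mulrC subrK idealr1.
Qed.

(** The ideal generated by [s], taken as the intersection of the ideals containing it, so that
    proofs handle no coefficient families. *)
Definition gen_by (s : seq R) x :=
  forall T, is_ideal T -> (forall y, y \in s -> T y) -> T x.

Definition fin_gen S :=
  exists s : seq R, (forall y, y \in s -> S y) /\ forall x, S x -> gen_by s x.

Lemma gen_by_in_span (s : seq R) x : gen_by s x -> @in_span R R^o s x.
Proof.
apply; first split.
- exists (fun=> 0); rewrite big1 // => i _; exact: scale0r.
- move=> a _ _ [c ->] [d ->]; exists (fun i => a * c i + d i).
  rewrite mulr_sumr -big_split; apply: eq_bigr => i _ /=.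
  by rewrite scalerDl -scalerA.
move=> y ys; exists (fun i => (i == index y s)%:R).
have yi : (index y s < size s)%N by rewrite index_mem.
rewrite (bigD1 (Ordinal yi)) //= eqxx scale1r nth_index // big1 ?addr0 //.
move=> i /eqP ni; case: eqP => [e|_]; last exact: scale0r.
by case: ni; apply: val_inj.
Qed.

Lemma in_span_gen_by (s : seq R) x : @in_span R R^o s x -> gen_by s x.
Proof.
move=> [c ->] T idT sT; apply: is_ideal_sum => // i _; apply: is_idealM => //.
by apply: sT; rewrite mem_nth.
Qed.

Lemma noetherianP : noetherian R <-> forall S, is_ideal S -> fin_gen S.
Proof.
split=> [noeR S idS|fgR I]; last first.
  have [s [sI gI]] := fgR _ (idealr_is_ideal I).
  by exists s; split=> // x /gI/gen_by_in_span.
have [S1|S1] := pselect (S 1).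
  exists [:: 1]; split=> [y|x _ T idT T1]; first by rewrite inE => /eqP->.
  by rewrite -[x]mulr1; apply: is_idealM => //; apply: T1; rewrite inE.
have [I IE] := idealr_of idS S1; have [s [sI gI]] := noeR I.
exists s; split=> [y /sI|x Sx]; first by rewrite IE => /asboolP.
have xI : x \in I by rewrite IE; apply/asboolP.
exact: in_span_gen_by (gI x xI).
Qed.

(* An ideal maximal among those disjoint from a multiplicative set is prime. *)
Lemma prime_avoiding S (E : set R) : is_ideal S ->
    E 1 -> (forall x y, E x -> E y -> E (x * y)) -> (forall x, S x -> ~ E x) ->
  exists Q : prime_idealr R,
    (forall x, S x -> x \in Q) /\ (forall x, E x -> x \notin Q).
Proof.
move=> idS E1 EM SE.
(* Zorn is applied to sets [A] through the union of [A] and [S]: the empty chain has empty union,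
   and this still yields the admissible ideal [S]. *)
pose P : set (set R) := [set A | is_ideal (A `|` S)%classic /\
  forall x, (A `|` S)%classic x -> ~ E x].
have chain F : (F `<=` P)%classic -> total_on F subset ->
    P (\bigcup_(X in F) X)%classic.
  move=> FP tot; split; last first.
    by move=> x [[X FX Xx]|Sx]; [have [_ dX] := FP _ FX; apply: dX; left | apply: SE].
  split; first by right; case: idS.
  have key X Y a x y : F X -> F Y -> (X `<=` Y)%classic ->
      (X `|` S)%classic x -> (Y `|` S)%classic y ->
      (\bigcup_(X in F) X `|` S)%classic (a * x + y).
    move=> FX FY XY Xx Yy; have [[_ idY] _] := FP _ FY.
    have [||Yz|Sz] := idY a x y => //; last by right.
      by case: Xx => [/XY|]; [left|right].
    by left; exists Y.
  have key' X Y a x y : F X -> F Y -> (Y `<=` X)%classic ->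
      (X `|` S)%classic x -> (Y `|` S)%classic y ->
      (\bigcup_(X in F) X `|` S)%classic (a * x + y).
    move=> FX FY YX Xx Yy; have [[_ idX] _] := FP _ FX.
    have [||Xz|Sz] := idX a x y => //; last by right.
      by case: Yy => [/YX|]; [left|right].
    by left; exists X.
  move=> a x y [[X FX Xx]|Sx] [[Y FY Yy]|Sy].
  - by have [XY|YX] := tot X Y FX FY;
      [apply: (key X Y)|apply: (key' X Y)] => //; left.
  - by apply: (key X X) => //; [left|right].
  - by apply: (key Y Y) => //; [right|left].
  - by right; case: idS => _; apply.
have [A [[idA AE] Amax]] := Zorn_bigcup chain.
set B := (A `|` S)%classic in idA AE.
have maxB x : ~ B x -> exists b, exists2 a, B a & E (a + b * x).
  move=> Bx; apply: contrapT => noE.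
  pose C : set R := [set z | exists a b, B a /\ z = a + b * x].
  have idC : is_ideal C := add_principal_is_ideal x idA.
  have BC z : B z -> C z by exists z, 0; rewrite mul0r addr0.
  have CS : (C `|` S)%classic = C.
    by apply/funext => z; apply/propext; split=> [[//|Sz]|]; [apply: BC; right|left].
  apply: (Amax C).
    split=> [z Az|/(_ x) CA]; first by apply: BC; left.
    apply: Bx; left; apply: CA; exists 0, 1.
    by split; [case: idA | rewrite add0r mul1r].
  by split; rewrite CS // => z [a [b [Ba ->]]] Ez; apply: noE; exists b, a.
have [|x y Bxy|Q QE] := prime_idealr_of idA.
- by move=> /AE.
- apply: contrapT => /not_orP[/maxB[b [a Ba Ea]] /maxB[d [c Bc Ec]]].
  apply: AE (EM _ _ Ea Ec); rewrite mulrDl mulrDr -addrA.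
  apply: is_idealD => //; first by rewrite mulrC; apply: is_idealM.
  apply: is_idealD => //; first by rewrite mulrC; apply: is_idealM.
  rewrite mulrDr; apply: is_idealD => //; first exact: is_idealM.
  by rewrite mulrACA; apply: is_idealM.
exists Q; split=> x; rewrite QE; first by move=> Sx; apply/asboolP; right.
by move=> Ex; apply/asboolP => /AE.
Qed.
End CommIdeals.

(** * Hilbert's basis theorem *)

Section Hilbert.
Context (R : comNzRingType).

Lemma hilbert_basis : noetherian R -> noetherian {poly R}.
Proof.
move=> /noetherianP noeR; apply/noetherianP => S idS.
(* For an ideal [T] containing a suitable finite part of [S], the aim is that [J S d] lies in
   [J T d] for every d. Leading terms of elements of [S] can then be cancelled by elements of
   [T]. *)
pose J (T : set {poly R}) d : set R :=
  [set a | exists h, [/\ T h, S h, (size h <= d.+1)%N & h`_d = a]].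
have idJ T d : is_ideal T -> is_ideal (J T d).
  move=> idT; split; first by exists 0; split; rewrite ?size_poly0 ?coef0 //;
    [case: idT | case: idS].
  move=> a _ _ [h [Th Sh sh <-]] [k [Tk Sk sk <-]].
  exists (a%:P * h + k); split; rewrite ?coefD ?coefCM //.
  - by case: idT => _; apply.
  - by case: idS => _; apply.
  - apply: leq_trans (size_polyD _ _) _; rewrite geq_max sk andbT mul_polyC.
    exact: leq_trans (size_scale_leq _ _) sh.
have up T d e a : is_ideal T -> (d <= e)%N -> J T d a -> J T e a.
  move=> idT /subnK <- [h [Th Sh sh <-]]; exists ('X^(e - d) * h).
  split; try exact: is_idealM.
    have [->|h0] := eqVneq h 0; first by rewrite mulr0 size_poly0.
    by rewrite mulrC size_mulXn // -addnS leq_add2l.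
  by rewrite coefXnM ltnNge leq_addr /= addKn.
have wit (s : seq R) d : (forall a, a \in s -> J S d a) -> exists2 G : seq {poly R},
    (forall h, h \in G -> S h) &
    forall T, is_ideal T -> (forall h, h \in G -> T h) ->
      forall a, a \in s -> J T d a.
  elim: s => [|a s IHs] sJ; first by exists [::].
  have [|G GS GT] := IHs; first by move=> b bs; apply: sJ; rewrite inE bs orbT.
  have [h [Sh _ sh ha]] := sJ a (mem_head _ _).
  exists (h :: G) => [k|T idT hT b]; rewrite inE => /orP[/eqP->//|].
  - exact: GS.
  - by exists h; split=> //; apply: hT; rewrite inE eqxx.
  - by apply: GT => // k kG; apply: hT; rewrite inE kG orbT.
have level d : exists2 G : seq {poly R}, (forall h, h \in G -> S h) &
    forall T, is_ideal T -> (forall h, h \in G -> T h) ->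
      forall a, J S d a -> J T d a.
  have [s [sJ gJ]] := noeR _ (idJ S d idS); have [G GS GT] := wit s d sJ.
  by exists G => // T idT hT a /gJ; apply; [exact: idJ | exact: GT].
have levels D : exists2 G : seq {poly R}, (forall h, h \in G -> S h) &
    forall T, is_ideal T -> (forall h, h \in G -> T h) ->
      forall d a, (d < D)%N -> J S d a -> J T d a.
  elim: D => [|D [G GS GT]]; first by exists [::].
  have [H HS HT] := level D; exists (H ++ G) => [h|T idT hT d a].
    by rewrite mem_cat => /orP[/HS|/GS].
  rewrite ltnS leq_eqVlt => /orP[/eqP->|dD].
    by apply: HT => // h hH; apply: hT; rewrite mem_cat hH.
  by apply: GT => // h hG; apply: hT; rewrite mem_cat hG orbT.
(* The ideals [J S d] increase with d and their union is finitely generated, so one of them contains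
   all the others. *)
have [D leadD] : exists D, forall d a, J S d a -> J S D a.
  pose L : set R := [set a | exists d, J S d a].
  have idL : is_ideal L.
    split; first by exists 0%N; case: (idJ S 0%N idS).
    move=> a x y [d dx] [e ey]; exists (maxn d e); have [_ IM] := idJ S (maxn d e) idS.
    by apply: IM; [apply: up dx|apply: up ey] => //; rewrite ?leq_maxl ?leq_maxr.
  have [s [sL gL]] := noeR _ idL.
  have [D sD] : exists D, forall a, a \in s -> J S D a.
    elim: s sL {gL} => [|a s IHs] sL; first by exists 0%N.
    have [|D sD] := IHs; first by move=> b bs; apply: sL; rewrite inE bs orbT.
    have [d da] := sL a (mem_head _ _); exists (maxn d D) => b.
    rewrite inE => /orP[/eqP->|/sD]; first exact: up idS (leq_maxl _ _) da.
    exact: up idS (leq_maxr _ _).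
  by exists D => d a da; apply: (gL a) => //; [exists d | exact: idJ].
have [G GS GT] := levels D.+1; exists G; split=> // f Sf T idT GsubT.
have {GT} JT d a : J S d a -> J T d a.
  move=> da; have [dD|Dd] := leqP d D; first exact: (GT T idT GsubT).
  by apply: up (ltnW Dd) _ => //; apply: (GT T idT GsubT) => //; apply: leadD da.
have [n] := ubnP (size f); elim: n f Sf => // n IHn f Sf; rewrite ltnS => sf.
have [->|f0] := eqVneq f 0; first by case: idT.
have [h [Th Sh sh hf]] : J T (size f).-1 (lead_coef f).
  by apply: JT; exists f; split=> //; rewrite prednK ?size_poly_gt0.
rewrite -[f](subrK h); apply: is_idealD => //; apply: IHn.
  exact: is_idealB.
move: sh; rewrite prednK ?size_poly_gt0 // => sh.
apply: leq_trans sf; rewrite -[X in (_ < X)%N](prednK (n := size f)) ?size_poly_gt0 // ltnS.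
apply/leq_sizeP => j; rewrite coefB leq_eqVlt => /orP[/eqP<-|lj].
  by rewrite hf subrr.
have fj : (size f <= j)%N by apply: leq_trans lj; apply: leqSpred.
by rewrite !nth_default ?subrr // (leq_trans sh).
Qed.
End Hilbert.

(** * Regular sequences and linear relations *)

Section RegularChain.
Context (R : comNzRingType).

Lemma in_seqM_gen_by (s : seq R) (x : R) : @in_seqM R R^o s x <-> gen_by s x.
Proof.
split=> [[y ->]|].
  move=> T idT sT; apply: is_ideal_sum => // i _.
  rewrite [_ *: _]mulrC; apply: is_idealM => //.
  by apply: sT; rewrite mem_nth.
move/gen_by_in_span => [c ->]; exists c; apply: eq_bigr => i _.
by rewrite [LHS]mulrC.
Qed.

Lemma gen_by_is_ideal (s : seq R) : is_ideal (gen_by s).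
Proof.
split=> [T [] //|a x y sx sy T idT sT].
by case: (idT) => _; apply; [apply: sx|apply: sy].
Qed.

Lemma gen_by_mem (s : seq R) x : x \in s -> gen_by s x.
Proof. by move=> xs T _; apply. Qed.

Lemma gen_by_idealr (s : seq R) (I : idealr R) x :
  {subset s <= I} -> gen_by s x -> x \in I.
Proof. by move=> sI /(_ _ (idealr_is_ideal I)); apply=> y /sI. Qed.

(** Regularity without the requirement that (s) be proper, which is automatic for a sequence inside
    a proper ideal. This part is the one carried through prefixes and polynomial extensions. *)
Definition weakly_regular (s : seq R) :=
  forall i, (i < size s)%N -> forall x,
    gen_by (take i s) (s`_i * x) -> gen_by (take i s) x.

Lemma regular_seqP (s : seq R) :
  regular_seq R^o s <-> weakly_regular s /\ ~ gen_by s 1.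
Proof.
split=> [[reg [x nx]]|[reg n1]]; split.
- by move=> i si y /in_seqM_gen_by/(reg i si)/in_seqM_gen_by.
- move=> g1; apply: nx; apply/in_seqM_gen_by.
  by rewrite -[x](mulr1 (x : R)); apply: is_idealM g1; apply: gen_by_is_ideal.
- by move=> i si y /in_seqM_gen_by/(reg i si)/in_seqM_gen_by.
- by exists 1 => /in_seqM_gen_by.
Qed.

Lemma weakly_regular_rcons s a : weakly_regular (rcons s a) <->
  weakly_regular s /\ forall x, gen_by s (a * x) -> gen_by s x.
Proof.
split=> [reg|[reg ra] i].
  split=> [i si x|x].
    have := reg i; rewrite size_rcons ltnS nth_rcons si => /(_ (ltnW si) x).
    by rewrite -cats1 takel_cat // ltnW.
  have := reg (size s); rewrite size_rcons ltnS leqnn nth_rcons ltnn eqxx.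
  by move=> /(_ isT x); rewrite -cats1 takel_cat // take_size.
rewrite size_rcons ltnS nth_rcons -cats1 => si; rewrite takel_cat //.
case: ltngtP si => // [si _|-> _]; first exact: reg.
by rewrite take_size.
Qed.

(* The chain is built from the top: a prime inside Q, minimal over the ideal of
   all terms but the last, cannot contain the last one. *)
Lemma regular_prime_chain (s : seq R) (Q : prime_idealr R) :
  weakly_regular s -> {subset s <= Q} -> prime_chain Q (size s).
Proof.
elim/last_ind: s Q => [|s a IHs] Q; first by move=> _ _; exists (fun=> Q).
move=> /weakly_regular_rcons[reg ra] sQ.
have sQ' : {subset s <= Q} by move=> x xs; apply: sQ; rewrite mem_rcons inE xs orbT.
have aQ : a \in Q by apply: sQ; rewrite mem_rcons inE eqxx.
(* A prime avoiding [E] lies inside [Q] (take n = 0) and misses [a] (take u = 1). [E] is disjoint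
   from (s): powers of [a] cancel modulo (s), which would leave u in (s) and hence in [Q]. *)
pose E : set R := [set x | exists u n, u \notin Q /\ x = u * a ^+ n].
have [|x y|x Sx|P [sP EP]] :=
    @prime_avoiding R (gen_by s) E (gen_by_is_ideal s).
- by exists 1, 0%N; rewrite mulr1 idealr1.
- move=> [u [n [uQ ->]]] [v [m [vQ ->]]]; exists (u * v), (n + m)%N.
  by rewrite prime_idealrM negb_or uQ vQ exprD mulrACA.
- move=> [u [n [/negP uQ ex]]]; apply: uQ; move: Sx; rewrite {x}ex.
  elim: n => [|n IHn]; first by rewrite mulr1; apply: gen_by_idealr.
  by rewrite exprS mulrCA => /ra/IHn.
have PQ : {subset P <= Q}.
  move=> x xP; apply: contraT => xQ; suff /EP : E x by rewrite xP.
  by exists x, 0%N; rewrite mulr1.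
have aP : a \notin P by apply: EP; exists 1, 1%N; rewrite mul1r idealr1.
have [|c [c1 c2 c3]] := IHs P reg; first by move=> x /gen_by_mem/sP.
rewrite size_rcons; exists (fun i => if (i <= size s)%N then c i else Q).
split=> [i|i|]; last by rewrite ltnn.
- rewrite ltnS => si x; rewrite si; case: ltngtP si => // [si _|-> _ xc].
    exact: c1.
  by apply: PQ; rewrite -c3.
- rewrite ltnS => si; rewrite si; case: ltngtP si => // [si _|-> _].
    exact: c2.
  by exists a; rewrite ?c3.
Qed.
End RegularChain.

Section LinearRelation.
Context (V : idomainType) (R : comNzRingType) (phi : {rmorphism V -> R}).

Definition lin_span (es : seq R) (x : R) :=
  exists c : nat -> V, x = \sum_(i < size es) phi (c i) * es`_i.

Lemma lin_span0 es : lin_span es 0.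
Proof. by exists (fun=> 0); rewrite big1 // => i _; rewrite rmorph0 mul0r. Qed.

Lemma lin_spanD es x y : lin_span es x -> lin_span es y -> lin_span es (x + y).
Proof.
move=> [c ->] [d ->]; exists (fun i => c i + d i); rewrite -big_split.
by apply: eq_bigr => i _; rewrite rmorphD mulrDl.
Qed.

Lemma lin_span_mem es a x : x \in es -> lin_span es (phi a * x).
Proof.
move=> xes; exists (fun i => if i == index x es then a else 0).
have xi : (index x es < size es)%N by rewrite index_mem.
rewrite (bigD1 (Ordinal xi)) //= eqxx nth_index // big1 ?addr0 //.
move=> i /eqP ni; case: eqP => [e|_]; last by rewrite rmorph0 mul0r.
by case: ni; apply: val_inj.
Qed.

(** The coordinates of [xs] in terms of [es], padded with zero columns, form a square matrix of
    determinant 0. Over a domain such a matrix has a nonzero kernel vector with entries in the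
    domain itself. *)
Lemma linear_relation (xs es : seq R) : (size es < size xs)%N ->
    (forall x, x \in xs -> lin_span es x) ->
  exists2 c : nat -> V, (exists2 i, (i < size xs)%N & c i != 0) &
    \sum_(i < size xs) phi (c i) * xs`_i = 0.
Proof.
move=> lt_es span; set n := size xs in lt_es *.
have /choice[a aE] : forall i : 'I_n, exists c : nat -> V,
    xs`_i = \sum_(j < size es) phi (c j) * es`_j.
  by move=> i; apply: (span); rewrite mem_nth.
pose A := \matrix_(i < n, j < n) (if (j < size es)%N then a i j else 0).
have /det0P[v v0 vA] : \det A == 0.
  rewrite -det_tr; apply/det0P; exists (delta_mx 0 (Ordinal lt_es)).
    apply/eqP => /matrixP/(_ 0 (Ordinal lt_es))/eqP.
    by rewrite !mxE !eqxx oner_eq0.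
  apply/matrixP => i j; rewrite !mxE big1 // => k _; rewrite !mxE !ord1 eqxx /=.
  by have [->|_] := eqVneq k; rewrite ?ltnn ?mulr0 // mul0r.
pose c i := if insub i is Some k then v 0 k else 0.
have cE (k : 'I_n) : c k = v 0 k by rewrite /c valK.
exists c.
  apply: contrapT => nc; case/eqP: v0; apply/rowP => k; rewrite mxE.
  by apply/eqP; apply: contra_notT nc => vk; exists k => //; rewrite cE.
transitivity (\sum_(k < n) \sum_(j < size es) phi (v 0 k * a k j) * es`_j).
  apply: eq_bigr => k _; rewrite cE aE mulr_sumr; apply: eq_bigr => j _.
  by rewrite rmorphM mulrA.
rewrite exchange_big big1 // => j _; rewrite -mulr_suml -rmorph_sum /=.
have jn : (j < n)%N by apply: ltn_trans lt_es.
have /matrixP/(_ 0 (Ordinal jn)) := vA; rewrite !mxE => vA0.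
rewrite (_ : \sum_(i < n) _ = 0) ?rmorph0 ?mul0r // -[RHS]vA0.
by apply: eq_bigr => i _; rewrite !mxE /= ltn_ord.
Qed.
End LinearRelation.

(** * Polynomial relations obtained by counting monomials *)

Section Relations.
Context (V : idomainType) (R : comNzRingType) (phi : {rmorphism V -> R}).
Implicit Types (fs : seq R) (D : nat) (c : seq nat -> V).

(** The value at [fs] of the polynomial with coefficients [c] and all exponents below [D]. Nesting
    by the first variable prepares the lexicographic search for a lowest monomial in
    [chain_slice]. *)
Fixpoint relval fs D c : R :=
  if fs is f :: fs' then
    \sum_(j <- seq.iota 0 D) f ^+ j * relval fs' D (fun al => c (j :: al))
  else phi (c [::]).

Fixpoint monval fs (al : seq nat) : R :=
  if fs is f :: fs' then f ^+ head 0%N al * monval fs' (behead al) else 1.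

Fixpoint exponents (n D : nat) : seq (seq nat) :=
  if n is n'.+1 then
    [seq j :: al | j <- seq.iota 0 D, al <- exponents n' D]
  else [:: [::]].

Lemma size_exponents n D : size (exponents n D) = (D ^ n)%N.
Proof. by elim: n => //= n IHn; rewrite size_allpairs size_iota IHn expnS. Qed.

Lemma uniq_exponents n D : uniq (exponents n D).
Proof.
elim: n => //= n IHn; apply: allpairs_uniq => //; first exact: iota_uniq.
by move=> [i a] [j b] _ _ [-> ->].
Qed.

Lemma relvalE fs D c : relval fs D c =
  \sum_(al <- exponents (size fs) D) phi (c al) * monval fs al.
Proof.
elim: fs c => [|f fs IHfs] c /=; first by rewrite big_seq1 mulr1.
rewrite big_allpairs_dep; apply: eq_bigr => j _; rewrite IHfs mulr_sumr.
by apply: eq_bigr => al _; rewrite mulrCA.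
Qed.

(* Sets [W d] playing the role of polynomials of degree at most [d] in [N]
   variables: only their multiplicativity and growth matter. *)
Definition growth (N : nat) := exists W : nat -> set R,
  [/\ forall d, W d 0 /\ forall x y, W d x -> W d y -> W d (x + y),
      forall d e x, (d <= e)%N -> W d x -> W e x,
      W 0%N 1 /\ forall d e x y, W d x -> W e y -> W (d + e)%N (x * y),
      forall x, exists d, W d x &
      forall d, exists2 es : seq R, (size es <= d.+1 ^ N)%N &
        forall x, W d x -> lin_span phi es x].

(** If d bounds the degrees of [fs], the D^n monomials lie in the span of at most (n (D - 1) d +
    1)^N elements. As n > N, the monomials outnumber these generators for large D and satisfy a
    linear relation. *)
Lemma growth_relation N fs : growth N -> (N < size fs)%N ->
  exists D, exists2 c, (exists2 al, al \in exponents (size fs) D & c al != 0) &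
    relval fs D c = 0.
Proof.
move=> [W [_ Wmono [W1 WM] Wex Wgr]] ltN; set n := size fs in ltN *.
have [d dfs] : exists d, forall f, f \in fs -> W d f.
  elim: fs {ltN n} => [|f fs [d IH]]; first by exists 0%N.
  have [e ef] := Wex f; exists (maxn d e) => g.
  rewrite inE => /orP[/eqP->|/IH]; first exact: Wmono (leq_maxr _ _) ef.
  exact: Wmono (leq_maxl _ _).
(* Chosen so that D^(N+1) = D^N (n d + 1)^N + D^N exceeds (D (n d + 1))^N, which bounds (n (D - 1) d
   + 1)^N. *)
pose D := ((n * d).+1 ^ N + 1)%N.
have WX f j : W d f -> W (j * d)%N (f ^+ j).
  move=> df; elim: j => [|j IHj]; first by rewrite mul0n.
  by rewrite mulSn exprS; apply: WM.
have Wmon al : al \in exponents n D -> W (n * (D.-1 * d))%N (monval fs al).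
  rewrite /n; elim: fs dfs al {ltN n D WX} (D) WX => [|f fs IH] dfs al D WX.
    by move=> _; rewrite mul0n.
  move=> /allpairsP[[j be] /= [jD beD ->]] /=; rewrite mulSn; apply: WM.
    apply: (Wmono (j * d)%N); last by apply: WX; apply: dfs; rewrite inE eqxx.
    move: jD; rewrite mem_iota leq_mul2r /= add0n.
    by case: (D) => // D'; rewrite ltnS /= => ->; rewrite orbT.
  by apply: IH => // g gfs; apply: dfs; rewrite inE gfs orbT.
have [es ses spanes] := Wgr (n * (D.-1 * d))%N.
pose xs := [seq monval fs al | al <- exponents n D].
have sxs : size xs = (D ^ n)%N by rewrite size_map size_exponents.
have [||c [i lti ci] cE] := @linear_relation V R phi xs es.
- apply: leq_ltn_trans ses _; rewrite sxs.
  apply: (@leq_trans (D ^ N.+1)%N); last by rewrite leq_pexp2l // /D addn1.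
  have -> : (D ^ N.+1 = D ^ N * (n * d).+1 ^ N + D ^ N)%N.
    by rewrite expnSr {2}/D mulnDr muln1.
  rewrite -expnMn -[X in (X < _)%N]addn0; apply: (@leq_ltn_trans ((D * (n * d).+1) ^ N)%N).
    have le : ((n * (D.-1 * d)).+1 <= D * (n * d).+1)%N.
      rewrite mulnCA mulnS addnC -addn1 leq_add //; last by rewrite /D addn1.
      by rewrite leq_mul2r leq_pred orbT.
    by rewrite addn0; case: (N) => // N'; rewrite leq_exp2r.
  by rewrite -[X in (X < _)%N]addn0 ltn_add2l expn_gt0 /D addn1.
- by move=> x /mapP[al alD ->]; apply: spanes; apply: Wmon.
exists D, (fun al => c (index al (exponents n D))).
  exists (nth [::] (exponents n D) i); first by rewrite mem_nth // size_exponents -sxs.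
  by rewrite index_uniq ?uniq_exponents // size_exponents -sxs.
rewrite relvalE (big_nth [::]) big_mkord -[RHS]cE size_map; apply: eq_bigr => k _.
by rewrite index_uniq ?uniq_exponents // (nth_map [::]).
Qed.
End Relations.

Lemma growth_id (V : idomainType) : growth (idfun : {rmorphism V -> V}) 0.
Proof.
exists (fun _ => setT); split=> // [x|d]; first by exists 0%N.
exists [:: 1] => // x _; exists (fun=> x); rewrite big_ord1 mulr1.
by [].
Qed.

Lemma growth_poly (V : idomainType) (R : comNzRingType)
    (phi : {rmorphism V -> R}) N :
  growth phi N -> growth (polyC \o phi : {rmorphism V -> {poly R}}) N.+1.
Proof.
move=> [W [Wadd Wmono [W1 WM] Wex Wgr]].
have Wsum d (I : Type) (r : seq I) (F : I -> R) :
    (forall i, W d (F i)) -> W d (\sum_(i <- r) F i).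
  by move=> WF; elim/big_ind: _ => // *; case: (Wadd d) => // _; apply.
(* Degree at most d separately in the new variable and in the coefficients; this gives d + 1 times
   as many spanning elements. *)
exists (fun d => [set p : {poly R} | (size p <= d.+1)%N /\ forall i, W d p`_i]).
split=> [d|d e p de [sp Wp]||p|d].
- have [W0 WD] := Wadd d; split.
    by split=> [|i]; rewrite ?size_poly0 ?coef0.
  move=> p q [sp Wp] [sq Wq]; split=> [|i].
    by apply: leq_trans (size_polyD _ _) _; rewrite geq_max sp.
  by rewrite coefD; apply: WD.
- by split=> [|i]; [apply: leq_trans sp _ | apply: Wmono (Wp i)].
- split.
    split=> [|i]; first by rewrite size_poly1.
    by rewrite coef1; case: (i == 0%N) => //; case: (Wadd 0%N).
  move=> d e p q [sp Wp] [sq Wq]; split=> [|i].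
    apply: leq_trans (size_polyMleq _ _) _.
    by have := leq_add sp sq; rewrite addSn addnS; case: (_ + _)%N.
  by rewrite coefM; apply: Wsum => j; apply: WM.
- have /choice[d dp] : forall i : 'I_(size p), exists d, W d p`_i.
    by move=> i; apply: Wex.
  exists (maxn (size p) (\max_i d i)); split.
    by rewrite leqW // leq_maxl.
  move=> i; have [ip|pi] := ltnP i (size p); last first.
    by rewrite nth_default //; case: (Wadd (maxn (size p) (\max_i d i))).
  apply: Wmono (dp (Ordinal ip)); rewrite leq_max; apply/orP; right.
  exact: leq_bigmax.
have [es ses span] := Wgr d.
pose es' := [seq e%:P * 'X^j | j <- seq.iota 0 d.+1, e <- es]; exists es'.
  by rewrite size_allpairs size_iota expnS leq_mul2l ses orbT.
move=> p [sp Wp].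
have -> : p = \sum_(j < d.+1) p`_j *: 'X^j.
  rewrite -poly_def; apply/polyP => j; rewrite coef_poly ltnS; case: leqP => // dj.
  by rewrite nth_default // (leq_trans sp).
apply: (big_ind (lin_span (polyC \o phi : {rmorphism V -> {poly R}}) es')).
- exact: lin_span0.
- exact: lin_spanD.
move=> j _; have [c ->] := span _ (Wp j); rewrite scaler_suml.
apply: (big_ind (lin_span (polyC \o phi : {rmorphism V -> {poly R}}) es')).
- exact: lin_span0.
- exact: lin_spanD.
move=> i _; rewrite -mul_polyC polyCM -mulrA.
apply: (@lin_span_mem V _ (polyC \o phi : {rmorphism V -> {poly R}})).
by apply: allpairs_f; rewrite ?mem_iota ?mem_nth //= add0n.
Qed.

(** * Heights in polynomial rings over a discrete valuation ring *)

Section Uniformizer.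
Context (V : idomainType) (t : V).

Definition uniformizer := [/\ t != 0, t \isn't a GRing.unit &
  forall a, a != 0 -> exists n, exists2 u, u \is a GRing.unit & a = u * t ^+ n].

Hypothesis unif_t : uniformizer.

Lemma uniformizer_dvd_total (a b : V) : (exists c, b = c * a) \/ (exists c, a = c * b).
Proof.
have [_ _ val] := unif_t.
have [->|a0] := eqVneq a 0; first by right; exists 0; rewrite mul0r.
have [->|b0] := eqVneq b 0; first by left; exists 0; rewrite mul0r.
have [n [u uu ->]] := val a a0; have [m [v vu ->]] := val b b0.
have key i j x y : x \is a GRing.unit -> (i <= j)%N ->
    exists c, y * t ^+ j = c * (x * t ^+ i).
  move=> xu /subnK<-; exists (y * t ^+ (j - i) / x).
  by rewrite exprD mulrA [_ * (x * _)]mulrA divrK // mulrA.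
by have [nm|/ltnW mn] := leqP n m; [left|right]; apply: key.
Qed.

Lemma uniformizer_factor (J : eqType) (E : seq J) (c : J -> V) :
    (exists2 j, j \in E & c j != 0) ->
  exists a, exists2 d : J -> V, a != 0 /\ (forall j, j \in E -> c j = a * d j) &
    exists2 j, j \in E & d j = 1.
Proof.
move=> [j0 j0E cj0].
have [j jE dvdj] : exists2 j, j \in E &
    forall i, i \in E -> exists d, c i = c j * d.
  suff [E0|//] : E = [::] \/ exists2 j, j \in E &
      forall i, i \in E -> exists d, c i = c j * d by rewrite E0 in j0E.
  elim: E {cj0 j0E} => [|j E IHE]; [by left | right].
  case: IHE => [->|[l lE dvdl]].
    by exists j; rewrite ?inE // => i; rewrite inE => /eqP->; exists 1; rewrite mulr1.
  have [[d dE]|[d dE]] := uniformizer_dvd_total (c j) (c l).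
    exists j; rewrite ?inE ?eqxx // => i; rewrite inE => /orP[/eqP->|/dvdl[e ->]].
      by exists 1; rewrite mulr1.
    by exists (d * e); rewrite dE [d * _]mulrC mulrA.
  exists l; rewrite ?inE ?lE ?orbT // => i; rewrite inE => /orP[/eqP->|/dvdl//].
  by exists d; rewrite mulrC.
have cj : c j != 0.
  by apply: contra_neq cj0 => cj; have [d ->] := dvdj j0 j0E; rewrite cj mul0r.
have /choice[d dE] : forall i, exists d, i \in E -> c i = c j * d.
  by move=> i; have [/dvdj[d ->]|] := boolP (i \in E); [exists d | exists 0].
exists (c j), d; first by split.
by exists j => //; apply: (mulfI cj); rewrite -dE // mulr1.
Qed.
End Uniformizer.

Section Slices.
Context (V : idomainType) (R : comNzRingType) (phi : {rmorphism V -> R}).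

Lemma relval_prime (P : prime_idealr R) fs D (c : seq nat -> V) :
    (forall al, al \in exponents (size fs) D -> phi (c al) \in P) ->
  relval phi fs D c \in P.
Proof.
move=> cP; rewrite relvalE big_seq; apply: rpred_sum => al alD.
by rewrite mulrC; apply: idealMr; apply: cP.
Qed.

Lemma relvalZ a fs D (c d : seq nat -> V) :
    (forall al, al \in exponents (size fs) D -> c al = a * d al) ->
  relval phi fs D c = phi a * relval phi fs D d.
Proof.
move=> cE; rewrite !relvalE mulr_sumr; apply: eq_big_seq => al alD.
by rewrite cE // rmorphM mulrA.
Qed.

(** Let m be the least power of f_0 whose coefficient e_m is nontrivial. Modulo Q_0 the relation is
    f_0^m (e_m + f_0 w); as f_0 is not in Q_0, the second factor is in Q_0, and f_0 in Q_1 gives e_m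
    in Q_1. A coefficient outside Q_0 stays outside Q_1, as no new scalars enter. Iterating removes
    f_0, .., f_(r-1). *)
Lemma chain_slice (Q : nat -> prime_idealr R) (f : nat -> R) r gs D c :
    (forall i, (i < r)%N -> {subset Q i <= Q i.+1}) ->
    (forall i, (i < r)%N -> f i \in Q i.+1 /\ f i \notin Q i) ->
    (forall i v, (i < r)%N -> phi v \in Q i.+1 -> phi v \in Q i) ->
    relval phi (mkseq f r ++ gs) D c \in Q 0%N ->
    (exists2 al, al \in exponents (r + size gs) D & phi (c al) \notin Q 0%N) ->
  exists2 d, relval phi gs D d \in Q r &
    exists2 al, al \in exponents (size gs) D & phi (d al) \notin Q r.
Proof.
elim: r Q f c => [|r IHr] Q f c QS fQ Qphi cQ cnt; first by exists c.
have mkE : mkseq f r.+1 = f 0%N :: mkseq (fun i => f i.+1) r.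
  by rewrite /mkseq /= (iotaDl 1 0) -map_comp.
have [f0 nf0] := fQ 0%N isT.
move: cQ; rewrite mkE /=; set fs := mkseq _ r ++ gs.
have sfs : size fs = (r + size gs)%N by rewrite size_cat size_mkseq.
suff key k m : \sum_(j <- seq.iota m k)
      f 0%N ^+ j * relval phi fs D (fun al => c (j :: al)) \in Q 0%N ->
    (forall j al, j \in seq.iota m k -> al \in exponents (r + size gs) D ->
       phi (c (j :: al)) \in Q 0%N) \/
    exists2 j, relval phi fs D (fun al => c (j :: al)) \in Q 1%N &
      exists2 al, al \in exponents (r + size gs) D & phi (c (j :: al)) \notin Q 0%N.
  move/key => [triv|[j ejQ [al alD cal]]].
    have [be /allpairsP[[j al] /= [jD alD ->]]] := cnt.
    by rewrite triv.
  apply: (IHr (fun i => Q i.+1) (fun i => f i.+1) _ _ _ _ ejQ) => [i ir|i ir|i v ir|].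
  - exact: QS.
  - exact: fQ.
  - exact: Qphi.
  - by exists al => //; apply: contra cal; apply: Qphi.
elim: k m => [|k IHk] m; first by left.
rewrite /=; set e := relval phi fs D.
have [triv|nt] := pselect (forall al, al \in exponents (r + size gs) D ->
    phi (c (m :: al)) \in Q 0%N).
  rewrite big_cons rpredDl; last first.
    by apply/idealMr/relval_prime => al; rewrite sfs; apply: triv.
  move/IHk => [triv'|]; [left | by right].
  by move=> j al; rewrite inE => /orP[/eqP->|]; [apply: triv | apply: triv'].
have [w wE] : exists w, \sum_(j <- seq.iota m.+1 k)
    f 0%N ^+ j * e (fun al => c (j :: al)) = f 0%N ^+ m.+1 * w.
  rewrite big_seq; elim/big_ind: _ => [|x y [a ->] [b ->]|j].
  - by exists 0; rewrite mulr0.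
  - by exists (a + b); rewrite mulrDr.
  - rewrite mem_iota => /andP[mj _]; exists (f 0%N ^+ (j - m.+1) * e (fun al => c (j :: al))).
    by rewrite mulrA -exprD subnKC.
rewrite big_cons wE exprS -mulrA mulrCA -mulrDr prime_idealrM => /orP[fm|ew].
  have : f 0%N ^+ m \notin Q 0%N.
    by elim: (m) => [|n IHn]; rewrite ?idealr1 // exprS prime_idealrM negb_or nf0.
  by rewrite fm.
right; exists m.
  move: (QS 0%N isT _ ew); rewrite rpredDr //.
  by rewrite mulrC; apply: idealMr.
by apply: contrapT => nex; apply: nt => al alD; apply: contra_notT nex => ?; exists al.
Qed.
End Slices.

Section HeightBound.
Context (V : idomainType) (t : V) (unif_t : uniformizer t).
Context (R : idomainType) (phi : {rmorphism V -> R}).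
Hypothesis phi_inj : injective phi.

Let phi_notin (P : prime_idealr R) v : phi t \notin P -> v != 0 -> phi v \notin P.
Proof.
move=> tP v0; have [_ _ /(_ v v0)[n [u uu ->]]] := unif_t.
rewrite rmorphM rmorphXn prime_idealrM negb_or; apply/andP; split.
  by apply: contraFN (idealr1 P) => /(idealMr (phi u^-1)); rewrite -rmorphM mulVr // rmorph1.
by elim: n => [|n IHn]; rewrite ?idealr1 // exprS prime_idealrM negb_or tP.
Qed.

Let phi_contract (P P' : prime_idealr R) v :
  phi t \notin P -> phi v \in P -> phi v \in P'.
Proof.
move=> tP; have [->|v0] := eqVneq v 0; first by rewrite rmorph0 !rpred0.
by rewrite (negPf (phi_notin tP v0)).
Qed.

Let phi_in (P : prime_idealr R) v : phi t \in P -> v \isn't a GRing.unit -> phi v \in P.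
Proof.
move=> tP nv; have [->|v0] := eqVneq v 0; first by rewrite rmorph0 rpred0.
have [_ _ /(_ v v0)[[|n] [u uu vE]]] := unif_t.
  by rewrite vE mulr1 uu in nv.
by rewrite vE exprSr mulrA rmorphM; apply: idealMr.
Qed.

Let phi_unit (P : prime_idealr R) v : v \is a GRing.unit -> phi v \notin P.
Proof.
move=> uv; apply: contraFN (idealr1 P) => /(idealMr (phi v^-1)).
by rewrite -rmorphM mulVr // rmorph1.
Qed.

(** All the Q_i contain t, so their scalars are the nonunits of V and slicing applies to a relation
    with a unit coefficient. Such a relation is found by dividing by the content, which is outside P
    because t is; slicing then leaves a scalar both inside and outside the last prime. *)
Let primitive_chain_absurd (P : prime_idealr R) (Q : nat -> prime_idealr R) (f : nat -> R) r D c :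
    (forall i, (i < r)%N -> {subset Q i <= Q i.+1}) ->
    (forall i, (i < r)%N -> f i \in Q i.+1 /\ f i \notin Q i) ->
    phi t \notin P -> {subset P <= Q 0%N} -> phi t \in Q 0%N ->
    relval phi (mkseq f r) D c \in P ->
    (exists2 al, al \in exponents r D & c al != 0) -> False.
Proof.
move=> QS fQ tP PQ tQ cP cnt.
have [a [d [a0 cE] [al alD dal]]] := uniformizer_factor unif_t cnt.
have tQi i : (i <= r)%N -> phi t \in Q i.
  by elim: i => // i IHi ir; apply: QS => //; apply/IHi/ltnW.
have := @chain_slice V R phi Q f r [::] D d QS fQ; rewrite cats0 addn0.
case=> [i v ir vQ|||e eQ [be]].
- apply: phi_in; first exact/tQi/ltnW.
  by apply: contraL vQ; apply: phi_unit.
- apply: PQ; move: cP; rewrite (relvalZ phi (d := d) (a := a)) ?size_mkseq //.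
  by rewrite prime_idealrM (negPf (phi_notin tP a0)).
- by exists al => //; rewrite dal rmorph1 idealr1.
- by rewrite /= inE => /eqP->; rewrite eQ.
Qed.

(** Elements f_i separating consecutive primes satisfy a relation once there are more than N of
    them. If t never enters the chain, slicing reaches a contradiction directly. Otherwise the chain
    is cut where t enters, and the relation is made primitive there. *)
Lemma prime_chain_bound N (Q : prime_idealr R) d :
  growth phi N -> prime_chain Q d -> (d <= N + (phi t \in Q))%N.
Proof.
move=> grN [c [c1 c2 c3]]; rewrite leqNgt; apply/negP => ltd.
have /choice[f fc] : forall i, exists x, (i < d)%N -> x \in c i.+1 /\ x \notin c i.
  move=> i; have [/c2[x xS xn]|] := boolP (i < d)%N; first by exists x.
  by exists 0.
have cmono i j : (i <= j)%N -> (j <= d)%N -> {subset c i <= c j}.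
  move=> ij jd; elim: j ij jd => [|j IHj]; first by rewrite leqn0 => /eqP-> _ x.
  rewrite leq_eqVlt ltnS => /orP[/eqP->|ij] jd x xi //.
  by apply: c1 => //; apply: (IHj ij (ltnW jd)).
have [tQ|tQ] := boolP (phi t \in Q); rewrite ?tQ ?(negPf tQ) ?addn0 ?addn1 in ltd; last first.
  have [|D [a [al alD al0] aE]] := @growth_relation V R phi N (mkseq f d) grN.
    by rewrite size_mkseq.
  rewrite size_mkseq in alD.
  have tc i : (i <= d)%N -> phi t \notin c i.
    by move=> id; apply: contra tQ => /(cmono i d id (leqnn d)); rewrite c3.
  have := @chain_slice V R phi c f d [::] D a c1 fc; rewrite cats0 addn0.
  case=> [i v ir|||e eQ [be]].
  - exact/phi_contract/tc.
  - by rewrite aE rpred0.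
  - by exists al => //; apply: phi_notin => //; apply: tc.
  - by rewrite /= inE => /eqP->; rewrite eQ.
have exs : exists s, (phi t \in c s) by exists d; rewrite c3.
case: (@ex_minnP (fun s => phi t \in c s) exs) => s tcs smin.
have sd : (s <= d)%N by apply: smin; rewrite c3.
have [s0|s0] := posnP s.
  have [|D [a [al alD al0] aE]] := @growth_relation V R phi N (mkseq f d) grN.
    by rewrite size_mkseq ltnW.
  rewrite size_mkseq in alD.
  (* When t already lies in the lowest prime, the zero ideal serves as the prime without t in which
     the content can be cancelled. *)
  have [||x y /=|Z ZE] := @prime_idealr_of R (fun x => x == 0).
  - by split=> // b x y /eqP-> /eqP->; rewrite mulr0 addr0.
  - by move/eqP => /eqP; rewrite oner_eq0.
  - by rewrite mulf_eq0; move=> /orP[]; [left|right].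
  apply: (@primitive_chain_absurd Z c f d D a) => //.
  - rewrite ZE; apply/asboolP; have [t0 _ _] := unif_t.
    by rewrite -(rmorph0 phi) => /eqP/phi_inj/eqP; apply/negP.
  - by move=> x; rewrite ZE => /asboolP/eqP->; rewrite rpred0.
  - by rewrite s0 in tcs.
  - by rewrite aE rpred0.
  - by exists al.
have [r sE] : exists r, s = r.+1 by exists s.-1; rewrite prednK.
(* The element f_r, belonging to the step where t enters, is left out: neither the slicing before t
   nor the one after it can treat that step. The remaining d - 1 elements are still more than N. *)
pose gs := mkseq (fun i => f (s + i)%N) (d - s).
have [|D [a [al alD al0] aE]] := @growth_relation V R phi N (mkseq f r ++ gs) grN.
  rewrite size_cat !size_mkseq; move: ltd sd; rewrite sE => ltd sd.
  by rewrite -ltnS -addSn subnKC.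
have rd : (r < d)%N by rewrite -sE.
have tc i : (i <= r)%N -> phi t \notin c i.
  by move=> ir; apply: contraL ir => /smin; rewrite sE -ltnNge.
have [|||||e eQ [be beD nbe]] := @chain_slice V R phi c f r gs D a.
- by move=> i ir; apply: c1; apply: ltn_trans rd.
- by move=> i ir; apply: fc; apply: ltn_trans rd.
- by move=> i v ir; apply/phi_contract/tc.
- by rewrite aE rpred0.
- exists al; first by move: alD; rewrite size_cat size_mkseq.
  by apply: phi_notin => //; apply: tc.
apply: (@primitive_chain_absurd (c r) (fun i => c (s + i)%N) (fun i => f (s + i)%N) (d - s) D e).
- by move=> i; rewrite ltn_subRL addnS => /c1.
- by move=> i; rewrite ltn_subRL addnS => /fc.
- exact: tc.
- by rewrite addn0 sE; apply: c1.
- by rewrite addn0.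
- exact: eQ.
- exists be; first by rewrite size_mkseq in beD.
  by apply: contraNneq nbe => ->; rewrite rmorph0 rpred0.
Qed.
End HeightBound.

(** * Cohen-Macaulay polynomial rings *)

Section CoefIdeals.
Context (C : comNzRingType) (S : set C).
Hypothesis idS : is_ideal S.
Implicit Types p q : {poly C}.

Definition coefs_in p := forall i, S p`_i.

Lemma coefs_in_is_ideal : is_ideal coefs_in.
Proof.
split=> [i|a p q Sp Sq i]; first by rewrite coef0; case: idS.
rewrite coefD coefM; apply: is_idealD => //; apply: is_ideal_sum => // j _.
exact: is_idealM.
Qed.

(* Dropping the leading terms whose coefficients lie in S. *)
Lemma coefs_in_truncate p : ~ coefs_in p ->
  exists p', [/\ coefs_in (p - p'), ~ S (lead_coef p') & (size p' <= size p)%N].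
Proof.
have [n] := ubnP (size p); elim: n p => // n IHn p; rewrite ltnS => sp np.
have [lS|lS] := pselect (S (lead_coef p)); last first.
  by exists p; split=> // i; rewrite subrr coef0; case: idS.
have p0 : p != 0.
  apply/eqP => p0; apply: np => i; rewrite p0 coef0; by case: idS.
pose r := p - (lead_coef p)%:P * 'X^((size p).-1).
have Spr : coefs_in (p - r).
  move=> i; rewrite /r opprB addrC subrK coefCM coefXn.
  by rewrite mulrC; apply: is_idealM.
have sr : (size r < size p)%N.
  rewrite -[X in (_ < X)%N](prednK (n := size p)) ?size_poly_gt0 // ltnS.
  apply/leq_sizeP => j; rewrite coefB coefCM coefXn leq_eqVlt => /orP[/eqP<-|pj].
    by rewrite eqxx mulr1 subrr.
  rewrite gtn_eqF // mulr0 subr0 nth_default //.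
  by apply: leq_trans pj; apply: leqSpred.
have [|//|r' [rr' lr' sr']] := IHn r.
- by apply: leq_trans sr _.
- by move=> Sr; apply: np; rewrite -[p](subrK r); apply: is_idealD coefs_in_is_ideal _ _.
- exists r'; split=> //; last by apply: leq_trans sr' (ltnW sr).
  rewrite -[p](subrK r) -addrA; exact: is_idealD coefs_in_is_ideal _ _.
Qed.

Hypothesis prS : forall a b, S (a * b) -> S a \/ S b.

(** After dropping leading terms in S, both leading coefficients are outside S, and so is their
    product, which is a coefficient of the product. *)
Lemma coefs_in_prime p q : coefs_in (p * q) -> coefs_in p \/ coefs_in q.
Proof.
move=> Spq; apply: contrapT => /not_orP[/coefs_in_truncate[p' [pp' lp _]]].
move=> /coefs_in_truncate[q' [qq' lq _]].
have Spq' : coefs_in (p' * q').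
  have -> : p' * q' = p * q - (p - p') * q - p' * (q - q') by ring.
  have idc := coefs_in_is_ideal.
  apply: (is_idealB idc); last exact: (is_idealM _ idc).
  by apply: (is_idealB idc) => //; rewrite mulrC; apply: (is_idealM _ idc).
have := Spq' (size p' + size q').-2; rewrite -mul_lead_coef.
by case/prS.
Qed.
End CoefIdeals.

Section PolyRegular.
Context (C : comNzRingType).
Implicit Types (s : seq C) (p : {poly C}).

Lemma gen_by_polyC s p :
  gen_by [seq c%:P | c <- s] p <-> coefs_in (gen_by s) p.
Proof.
split=> [gp|Sp T idT sT].
  apply: gp; first exact/coefs_in_is_ideal/gen_by_is_ideal.
  move=> _ /mapP[c cs ->] i; rewrite coefC.
  by case: (i == 0%N); [exact: gen_by_mem | case: (gen_by_is_ideal s)].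
rewrite -[p]coefK poly_def; apply: is_ideal_sum => // i _.
rewrite -mul_polyC mulrC; apply: is_idealM => //.
apply: (Sp i (fun c => T c%:P)) => [|c cs]; last by apply: sT; apply: map_f.
split=> [|a c d Tc Td]; first by rewrite polyC0; case: idT.
by rewrite polyCD polyCM; case: idT => _; apply.
Qed.

Lemma weakly_regular_polyC s :
  weakly_regular s -> weakly_regular [seq c%:P | c <- s].
Proof.
move=> reg i; rewrite size_map => si p; rewrite -map_take (nth_map 0) //.
move=> /gen_by_polyC gp; apply/gen_by_polyC => j; apply: reg => //.
by rewrite -coefCM.
Qed.
End PolyRegular.

(** * Contractions of maximal ideals of polynomial rings *)

Section MaximalPoly.
Context (C : comNzRingType) (m : idealr {poly C}) (mm : maximal_ideal m).

Definition contraction : set C := [set c | c%:P \in m].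

Lemma contraction_is_ideal : is_ideal contraction.
Proof.
split=> [|a x y Sx Sy]; first by rewrite /contraction /= polyC0 rpred0.
by rewrite /contraction /= polyCD polyCM rpredD // idealMr.
Qed.

Lemma contraction_prime a b :
  contraction (a * b) -> contraction a \/ contraction b.
Proof.
rewrite /contraction /= polyCM => /(maximal_ideal_prime mm)/orP[].
  by left.
by right.
Qed.

Lemma contraction1 : ~ contraction 1.
Proof. by rewrite /contraction /= idealr1. Qed.

Lemma coefs_in_contraction p : coefs_in contraction p -> p \in m.
Proof.
move=> Sp; rewrite -[p]coefK poly_def; apply: rpred_sum => i _.
by rewrite -mul_polyC mulrC; apply: idealMr; apply: Sp.
Qed.

(* Over a field the polynomial ring is not a field. *)
Lemma maximal_not_extended : exists2 g, g \in m & ~ coefs_in contraction g.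
Proof.
apply: contrapT => nex.
have H g : g \in m -> coefs_in contraction g.
  by move=> gm; apply: contrapT => ng; apply: nex; exists g.
have Xm : 'X \notin m.
  by apply/negP => /H/(_ 1%N); rewrite coefX; apply: contraction1.
have [u /H/(_ 0%N)] := maximal_ideal_inv mm Xm.
rewrite coefB coefXM coef1 sub0r => /(is_idealN contraction_is_ideal).
by rewrite opprK; apply: contraction1.
Qed.

(** If [s] generates the contraction p, the constants generate the prime p[X], and m is never equal
    to p[X]. Any element of m outside p[X] is regular modulo p[X] and lengthens the sequence. *)
Lemma weakly_regular_extend s : weakly_regular s ->
    (forall c, gen_by s c <-> contraction c) ->
  exists s' : seq {poly C},
    [/\ size s' = (size s).+1, weakly_regular s' & {subset s' <= m}].
Proof.
move=> reg gs; have [g gm ng] := maximal_not_extended.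
have gsE p : gen_by [seq c%:P | c <- s] p <-> coefs_in contraction p.
  rewrite gen_by_polyC; split=> Sp i; apply/gs; exact: Sp.
exists (rcons [seq c%:P | c <- s] g); split.
- by rewrite size_rcons size_map.
- apply/weakly_regular_rcons; split; first exact: weakly_regular_polyC.
  move=> x /gsE gx; apply/gsE.
  by case: (coefs_in_prime contraction_is_ideal contraction_prime gx).
- move=> p; rewrite mem_rcons inE => /orP[/eqP->//|/mapP[c cs ->]].
  by apply/gs; apply: gen_by_mem.
Qed.

(* The quotient by m is a field integral over C[1/h]. *)
Lemma contraction_localization g c : g \in m ->
    ~ contraction (lead_coef g) -> ~ contraction c ->
  exists j r, contraction (lead_coef g ^+ j - c * r).
Proof.
move=> gm; set h := lead_coef g => nh nc.
pose pi : {rmorphism {poly C} -> {ideal_quot m}} := \pi_({ideal_quot m})%qT.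
have [psi psiE] : exists psi : {rmorphism C -> {ideal_quot m}},
    forall a, psi a = pi a%:P by exists (pi \o polyC).
have pi0 p : pi p = 0 <-> p \in m.
  have -> : (p \in m) = (p - 0 \in m) by rewrite subr0.
  have pi00 : pi 0 = 0 := rmorph0 pi.
  rewrite Quotient.idealrBE; split=> [e|/eqP e]; last exact: etrans e pi00.
  by apply/eqP; apply: etrans e (esym pi00).
have [u cu] : exists u, c%:P * u - 1 \in m.
  by apply: maximal_ideal_inv => //; apply/negP.
have psiK k p : pi (k *: p) = psi k * pi p by rewrite -mul_polyC rmorphM psiE.
have g1 : (1 < size g)%N.
  rewrite ltnNge; apply/negP => /size1_polyC gC; apply: nh.
  by rewrite /contraction /= /h gC lead_coefC -gC.
pose n := (size g).-1; have sg : size g = n.+1 by rewrite prednK // ltnW.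
have n0 : (0 < n)%N by rewrite /n -ltnS -sg.
have int_hX : integralOver psi (psi h * pi 'X).
  (* The equation h^(n-1) g(X) = 0 rewritten as a monic equation for h X. *)
  pose G := \poly_(i < n.+1) (if i == n then 1 else g`_i * h ^+ (n.-1 - i)).
  have GE i : (i < n.+1)%N -> G`_i = if i == n then 1 else g`_i * h ^+ (n.-1 - i).
    by move=> lti; rewrite coef_poly lti.
  have sG : size G = n.+1.
    apply/eqP; rewrite eqn_leq size_poly ltnNge; apply/negP => /leq_sizeP/(_ n (leqnn n)).
    by rewrite GE // eqxx => /eqP; rewrite oner_eq0.
  exists G; first by rewrite monicE lead_coefE sG GE //= eqxx.
  apply/rootP; rewrite (@horner_coef_wide _ n.+1); last first.
    exact: leq_trans (size_poly _ _) (size_poly _ _).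
  have /pi0 g0 := gm; have piG : pi g = \sum_(i < n.+1) psi g`_i * pi 'X ^+ i.
    rewrite -{1}[g]coefK poly_def rmorph_sum sg; apply: eq_bigr => i _.
    by rewrite psiK rmorphXn.
  transitivity (psi h ^+ n.-1 * pi g); last by rewrite g0 mulr0.
  rewrite piG mulr_sumr; apply: eq_bigr => i _.
  rewrite coef_map GE // exprMn.
  case: eqP => [->|/eqP ni] /=; first by rewrite rmorph1 mul1r mulrA -[psi g`_n]/(psi h) -exprSr prednK.
  have lt_in : (i < n)%N by rewrite ltn_neqAle ni -ltnS ltn_ord.
  rewrite rmorphM rmorphXn !mulrA; congr (_ * _); rewrite -mulrA -exprD subnK.
    by rewrite mulrC.
  by rewrite -ltnS prednK.
(* With d the degree of u, h^d u = sum of u_i h^(d-i) (h X)^i is a polynomial in the integral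
   element h X. *)
pose d := (size u).-1.
have int_u : integralOver psi (psi h ^+ d * pi u).
  rewrite -[u in pi u]coefK poly_def rmorph_sum mulr_sumr.
  elim/big_ind: _ => [||i _]; [exact: integral0 | exact: integral_add |].
  rewrite psiK rmorphXn mulrCA.
  apply: integral_mul; first exact: integral_id.
  have id : (i <= d)%N by rewrite -ltnS /d (leq_trans (ltn_ord i)) // leqSpred.
  rewrite -(subnK id) exprD -mulrA -exprMn.
  apply: integral_mul; first by rewrite -rmorphXn; apply: integral_id.
  elim: {id}(i : nat) => [|k IHk]; first exact: integral1.
  by rewrite exprS; apply: integral_mul.
have [P mP /rootP rP] := int_u.
have cu1 : psi c * pi u = 1.
  by apply/eqP; rewrite -subr_eq0 psiE -rmorphM -(rmorph1 pi) -rmorphB; apply/eqP/pi0.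
pose k := (size P).-1; have sP : size P = k.+1 by rewrite prednK // size_poly_gt0 monic_neq0.
(* Multiplying the monic equation of h^d u by c^k and using c u = 1 gives h^(d k) + c r = 0. *)
pose r := \sum_(i < k) P`_i * c ^+ (k - i.+1) * h ^+ (d * i).
exists (d * k)%N, (- r); rewrite mulrN opprK; apply/pi0.
rewrite -psiE rmorphD rmorphM rmorphXn.
have <- : psi c ^+ k * (map_poly psi P).[psi h ^+ d * pi u] = 0 by rewrite rP mulr0.
rewrite (@horner_coef_wide _ k.+1) -?sP ?size_poly // sP big_ord_recr mulrDr /= [RHS]addrC.
congr (_ + _).
  have Pk : P`_k = 1 by move/monicP: mP; rewrite lead_coefE.
  rewrite coef_map Pk /= rmorph1 mul1r exprMn mulrCA -exprMn cu1 expr1n mulr1.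
  by rewrite exprM.
rewrite mulr_sumr /r rmorph_sum mulr_sumr; apply: eq_bigr => i _.
rewrite coef_map /= !rmorphM !rmorphXn exprMn.
have -> : psi c ^+ k = psi c ^+ (k - i.+1) * psi c * psi c ^+ i.
  by rewrite -exprSr -exprD addSnnS subnK.
have : psi c ^+ i * pi u ^+ i = 1 by rewrite -exprMn cu1 expr1n.
rewrite exprM; set a := psi c ^+ i; set b := pi u ^+ i => ab.
transitivity (psi c * (psi P`_i * psi c ^+ (k - i.+1) * (psi h ^+ d) ^+ i) * (a * b)); last by ring.
by rewrite ab mulr1.
Qed.
End MaximalPoly.

Section MaximalPoly2.
Context (B : comNzRingType) (m : idealr {poly {poly B}}) (mm : maximal_ideal m).

(** Otherwise m would contract to q[X], so that (B / q)[X] would become a field after inverting one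
    element l, and every nonzero w would divide a power of l. As in Euclid's proof for primes, w = 1
    + X h with h congruent to l is coprime to l, hence a unit, although its degree is positive. *)
Lemma contraction_not_extended :
  exists2 f, contraction m f & ~ coefs_in [set b | contraction m b%:P] f.
Proof.
set q := [set b | contraction m b%:P].
have idm := contraction_is_ideal m.
have idq : is_ideal q.
  split=> [|a x y qx qy]; first by rewrite /q /= polyC0; case: idm.
  by rewrite /q /= polyCD polyCM; case: idm => _; apply.
have prq a b : q (a * b) -> q a \/ q b.
  by rewrite /q /= polyCM => /(contraction_prime mm).
have nq1 : ~ q 1 := @contraction1 _ m.
apply: contrapT => nex.
have H f : contraction m f -> coefs_in q f.
  by move=> fm; apply: contrapT => nf; apply: nex; exists f.
have qm f : coefs_in q f -> contraction m f.
  move=> qf; rewrite -[f]coefK poly_def; apply: is_ideal_sum => // i _.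
  by rewrite -mul_polyC mulrC; apply: is_idealM => //; apply: qf.
have trunc (f : {poly B}) : ~ contraction m f ->
    exists2 f', contraction m (f - f') & ~ q (lead_coef f').
  move=> nf; have [|f' [ff' lf' _]] := @coefs_in_truncate _ q idq f.
    by move=> /qm.
  by exists f' => //; apply: qm.
have [g gm ng] := maximal_not_extended mm.
have [g' [gg' lg' _]] := coefs_in_truncate idm ng.
have g'm : g' \in m by rewrite -[g'](subKr g) rpredB // coefs_in_contraction.
have [h lgh lh] := trunc _ lg'.
have h0 : h != 0 by apply/eqP => h0; apply: lh; rewrite h0 lead_coef0; case: idq.
pose w := 1 + 'X * h.
have sw : size w = (size h).+1.
  rewrite /w mulrC addrC size_polyDl ?size_mulX // size_poly1 ltnS size_poly_gt0 //.
have lw : lead_coef w = lead_coef h.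
  by rewrite /w mulrC addrC lead_coefDl ?lead_coefMX // size_mulX // size_poly1 ltnS size_poly_gt0.
have nw : ~ contraction m w by move=> /H/(_ (size w).-1); rewrite -lead_coefE lw.
have [j [r]] := contraction_localization mm g'm lg' nw.
set l := lead_coef g' in lgh * => lwr.
have [k wk] : exists k, (w - 1) ^+ j = w * k + (-1) ^+ j.
  elim: (j) => [|i [k IHk]]; first by exists 0; rewrite mulr0 add0r.
  by exists ((w - 1) * k + (-1) ^+ i); rewrite !exprS IHk; ring.
(* An inverse of w: (w - 1)^j equals X^j h^j, which is X^j w r modulo the contraction, and also
   (-1)^j plus a multiple of w. *)
pose e := (-1) ^+ j * ('X^j * r - k).
have we : contraction m (1 - w * e).
  have -> : 1 - w * e =
      (-1) ^+ j * 'X^j * ((l ^+ j - w * r) - (l ^+ j - h ^+ j)).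
    have sq : (-1) ^+ j * (-1) ^+ j = 1 :> {poly B} by rewrite -expr2 sqrr_sign.
    have wh : w * k + (-1) ^+ j = 'X^j * h ^+ j by rewrite -exprMn -wk addrC addKr.
    rewrite /e -{1}sq; transitivity
      ((-1) ^+ j * ((w * k + (-1) ^+ j) - w * 'X^j * r)); first by ring.
    by rewrite wh; ring.
  apply/(is_idealM _ idm)/(is_idealB idm lwr).
  by rewrite subrXX mulrC; apply: (is_idealM _ idm lgh).
have ne : ~ contraction m e.
  move=> em; apply: (@contraction1 _ m); rewrite -(subrK (w * e) 1).
  exact: is_idealD idm we (is_idealM w idm em).
have [e' ee' le'] := trunc e ne.
(* The leading coefficients of w and e' are outside the prime q, so w e' has in positive degree a
   coefficient outside q, while 1 - w e' has all its coefficients in q. *)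
have /H/(_ (size w + size e').-2) : contraction m (1 - w * e').
  have -> : 1 - w * e' = (1 - w * e) + w * (e - e') by ring.
  exact: is_idealD idm we (is_idealM w idm ee').
have e'0 : e' != 0 by apply/eqP => e0; apply: le'; rewrite e0 lead_coef0; case: idq.
have idx : (size w + size e').-2 != 0%N.
  rewrite sw addSn /= -lt0n -subn1 subn_gt0.
  by apply: (@leq_add 1 1); rewrite size_poly_gt0.
rewrite coefB coef1 (negPf idx) sub0r => /(is_idealN idq).
by rewrite opprK -mul_lead_coef lw => /prq[].
Qed.
End MaximalPoly2.

Section CohenMacaulayPoly.
Context (V : idomainType) (t : V) (unif_t : uniformizer t).

Lemma uniformizer_nonunit_dvd (v : V) :
  v \isn't a GRing.unit -> exists w, v = w * t.
Proof.
move=> nv; have [->|v0] := eqVneq v 0; first by exists 0; rewrite mul0r.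
have [_ _ /(_ v v0)[[|n] [u uu vE]]] := unif_t; first by rewrite vE mulr1 uu in nv.
by exists (u * t ^+ n); rewrite -mulrA -exprSr.
Qed.

Lemma dvr_prime_regular (P : set V) : is_ideal P -> ~ P 1 ->
    (forall a b, P (a * b) -> P a \/ P b) ->
  exists s : seq V, [/\ size s = `[< P t >], weakly_regular s &
    forall v, gen_by s v <-> P v].
Proof.
move=> idP nP1 prP; have [t0 _ val] := unif_t.
have Punit u : u \is a GRing.unit -> ~ P u.
  by move=> uu /(is_idealM u^-1 idP); rewrite mulVr.
have [tP|ntP] := pselect (P t).
  exists [:: t]; split; first by rewrite asboolT.
    case=> // _ x /= tx T idT _; suff -> : x = 0 by case: idT.
    have /eqP : [set 0] (t * x).
      by apply: tx => //; split=> // a b c -> ->; rewrite mulr0 addr0.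
    by rewrite mulf_eq0 (negPf t0) => /eqP.
  move=> v; split=> [|Pv]; first by apply=> // y; rewrite inE => /eqP->.
  have [|w ->] := @uniformizer_nonunit_dvd v; first by apply/negP => /Punit.
  apply: (is_idealM _ (gen_by_is_ideal _)).
  by apply: gen_by_mem; rewrite inE.
exists [::]; split=> //; first by rewrite asboolF.
move=> v; split; first by apply.
have [->|v0] := eqVneq v 0; first by case: (@gen_by_is_ideal V [::]).
have [n [u uu ->]] := val v v0.
move=> Pv; exfalso; case: (prP _ _ Pv) => [/Punit//|]; elim: n {Pv} => [|n IHn] //.
by rewrite exprS => /prP[].
Qed.

(** Such a prime is generated by its scalars q and one further f. If t is in q, Euclidean division
    by f works because its leading coefficient is a unit. If q = 0, pseudo-division by a primitive f
    works by Gauss's lemma. *)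
Lemma poly_prime_regular (P : set {poly V}) : is_ideal P -> ~ P 1 ->
    (forall a b, P (a * b) -> P a \/ P b) ->
    (exists2 f, P f & ~ coefs_in [set b | P b%:P] f) ->
  exists s : seq {poly V}, [/\ size s = `[< P t%:P >].+1, weakly_regular s &
    forall v, gen_by s v <-> P v].
Proof.
move=> idP nP1 prP [f0 Pf0 nf0].
set q := [set b | P b%:P] in nf0.
have idq : is_ideal q.
  split=> [|a x y qx qy]; first by rewrite /q /= polyC0; case: idP.
  by rewrite /q /= polyCD polyCM; case: idP => _; apply.
have prq a b : q (a * b) -> q a \/ q b by rewrite /q /= polyCM => /prP.
have [s [ss reg gs]] := dvr_prime_regular idq nP1 prq.
have qP f : coefs_in q f -> P f.
  move=> qf; rewrite -[f]coefK poly_def; apply: is_ideal_sum => // i _.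
  by rewrite -mul_polyC mulrC; apply: is_idealM => //; apply: qf.
have gsE p : gen_by [seq c%:P | c <- s] p <-> coefs_in q p.
  rewrite gen_by_polyC; split=> Sp i; apply/gs; exact: Sp.
suff [f [Pf nf genf]] : exists f, [/\ P f, ~ coefs_in q f &
    forall a, P a -> exists b, coefs_in q (a - b * f)].
  exists (rcons [seq c%:P | c <- s] f); split.
  - by rewrite size_rcons size_map ss.
  - apply/weakly_regular_rcons; split; first exact: weakly_regular_polyC.
    move=> x /gsE gx; apply/gsE.
    by case: (coefs_in_prime idq prq gx).
  - have sub x : gen_by [seq c%:P | c <- s] x ->
        gen_by (rcons [seq c%:P | c <- s] f) x.
      by move=> gx T idT sT; apply: gx => // y ys; apply: sT; rewrite mem_rcons inE ys orbT.
    move=> v; split=> [|Pv].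
      apply=> // y; rewrite mem_rcons inE => /orP[/eqP->//|/gen_by_mem/gsE/qP//].
    have [b /gsE/sub vb] := genf v Pv; rewrite -[v](subrK (b * f)).
    apply: (is_idealD (gen_by_is_ideal _)) => //.
    apply: (is_idealM _ (gen_by_is_ideal _)).
    by apply: gen_by_mem; rewrite mem_rcons inE eqxx.
(* An element of least degree outside q[X] generates P modulo q[X]. *)
have exn : exists n, (fun n => `[< exists f, [/\ P f, ~ coefs_in q f & size f = n] >]) n.
  by exists (size f0); apply/asboolP; exists f0.
case: (ex_minnP exn) => n /asboolP[f1 [Pf1 nf1 sf1]] minf1.
have [f [ff1 lf sf]] := coefs_in_truncate idq nf1.
have Pf : P f by rewrite -[f](subKr f1); apply: is_idealB => //; apply: qP.
have minf g : P g -> (size g < size f)%N -> coefs_in q g.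
  move=> Pg gf; apply: contrapT => ng.
  have /minf1 : `[< exists f, [/\ P f, ~ coefs_in q f & size f = size g] >].
    by apply/asboolP; exists g.
  by rewrite leqNgt -sf1 (leq_trans gf sf).
have f0' : f != 0 by apply/eqP => f_0; apply: lf; rewrite f_0 lead_coef0; case: idq.
have [tq|ntq] := pselect (q t).
  exists f; split=> // [/(_ (size f).-1)//|a Pa].
  have uf : lead_coef f \is a GRing.unit.
    apply: contraT => /uniformizer_nonunit_dvd[w lfE]; case: lf.
    by rewrite lfE; apply: is_idealM.
  have aE := Pdiv.IdomainUnit.divp_eq uf a; exists (a %/ f).
  have -> : a - a %/ f * f = a %% f by rewrite [in X in X - _]aE addrC addKr.
  apply: minf; last by rewrite ltn_modp.
  have -> : a %% f = a - a %/ f * f by rewrite [in X in X - _]aE addrC addKr.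
  by apply: is_idealB => //; apply: is_idealM.
have nq v : v != 0 -> ~ q v.
  have [_ _ val] := unif_t; move=> /val[k [u uu ->]] qv.
  case: (prq _ _ qv) => [/(is_idealM u^-1 idq)|]; first by rewrite mulVr.
  by elim: k {qv} => [|k IHk] //; rewrite exprS => /prq[].
have q0 g : coefs_in q g -> g = 0.
  move=> qg; apply/polyP => i; rewrite coef0; apply: contrapT => /eqP/nq; exact.
(* The content c of f is a nonzero scalar, hence outside P, so the primitive part h is again in
   P. *)
have [c [d [c0 dE] [i ilt di]]] : exists c, exists2 d : nat -> V,
    c != 0 /\ (forall j, j \in seq.iota 0 (size f) -> f`_j = c * d j) &
    exists2 j, j \in seq.iota 0 (size f) & d j = 1.
  apply: (uniformizer_factor unif_t); exists (size f).-1; last by rewrite -lead_coefE lead_coef_eq0.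
  by rewrite mem_iota /= add0n prednK ?size_poly_gt0.
pose h := \poly_(j < size f) d j.
have fh : f = c%:P * h.
  apply/polyP => j; rewrite coefCM coef_poly; case: ltnP => jf.
    by apply: dE; rewrite mem_iota.
  by rewrite mulr0 nth_default.
have Ph : P h by move: Pf; rewrite fh => /prP[/(nq _ c0)|].
have hi : h`_i = 1 by rewrite coef_poly; move: ilt; rewrite mem_iota /= add0n => ->.
have h0 : h != 0 by apply: contraNneq f0' => h0; rewrite fh h0 mulr0.
have sh : size h = size f by rewrite fh size_Cmul.
(* Gauss's lemma: tV is prime, so tV[X] is prime, and it does not contain h because h has a
   coefficient 1. Powers of t thus cancel in t^k a = b h. *)
have cancel_t k a b : t ^+ k *: a = b * h -> exists b', a = b' * h.
  elim: k b => [|k IHk] b; first by rewrite scale1r => ->; exists b.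
  rewrite exprS -scalerA => tab.
  have [t0 tnu _] := unif_t.
  pose T : set V := [set v | exists w, v = w * t].
  have idT : is_ideal T.
    split; first by exists 0; rewrite mul0r.
    by move=> x _ _ [y ->] [z ->]; exists (x * y + z); rewrite mulrDl mulrA.
  have prT x y : T (x * y) -> T x \/ T y.
    move=> [z xyz]; apply: contrapT => /not_orP[nx ny]; case/negP: tnu.
    have ux : x \is a GRing.unit by apply: contraT => /uniformizer_nonunit_dvd.
    have uy : y \is a GRing.unit by apply: contraT => /uniformizer_nonunit_dvd.
    have : x * y \is a GRing.unit by rewrite unitrM ux.
    by rewrite xyz unitrM => /andP[].
  have [j|Tb|/(_ i)] := coefs_in_prime idT prT (p := b) (q := h).
  - by rewrite -tab coefZ; exists (t ^+ k *: a)`_j; rewrite mulrC.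
  - have /choice[e eE] := Tb; pose b' := \poly_(j < size b) e j.
    have bE : b = t *: b'.
      apply/polyP => j; rewrite coefZ coef_poly; case: ltnP => jb.
        by rewrite eE mulrC.
      by rewrite mulr0 nth_default.
    apply: (IHk b'); apply: (@mulfI _ t%:P); first by rewrite polyC_eq0.
    by rewrite !mul_polyC tab bE -scalerAl.
  - rewrite hi => -[w w1]; case/negP: tnu.
    by apply/unitrP; exists w; rewrite [t * w]mulrC -w1.
exists h; split=> // [/q0/eqP|a Pa]; first by rewrite (negPf h0).
have := Pdiv.Idomain.divp_eq a h; set b := a %/ h; set r := a %% h => ar.
have r0 : r = 0.
  apply/q0/minf; last by rewrite -sh ltn_modp.
  rewrite -[r](addKr (b * h)) addrC -ar -mul_polyC.
  by apply: is_idealB => //; apply: is_idealM.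
have le0 : lead_coef h ^+ scalp a h != 0 by rewrite expf_neq0 // lead_coef_eq0.
have [_ _ /(_ _ le0)[k [u uu uE]]] := unif_t.
have [|b' ->] := cancel_t k a (u^-1 *: b); last first.
  by exists b'; rewrite subrr => j; rewrite coef0; case: idq.
by rewrite -scalerAl -[b * h]addr0 -r0 -ar uE scalerA mulKr.
Qed.

Theorem cohen_macaulay_of_growth (R : idomainType) (phi : {rmorphism V -> R}) N :
    injective phi -> noetherian R -> growth phi N ->
    (forall m : idealr R, maximal_ideal m -> exists s : seq R,
       [/\ size s = (N + (phi t \in m))%N, weakly_regular s & {subset s <= m}]) ->
  cohen_macaulay_ring R.
Proof.
move=> phi_inj noeR grN regN; split=> // m mm.
have [|x y /asboolP|Q QE] := @prime_idealr_of R [set` m] (idealr_is_ideal m).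
- by rewrite /= idealr1.
- by rewrite asboolb => /(maximal_ideal_prime mm)/orP.
have {}QE x : (x \in Q) = (x \in m) by rewrite QE asboolb.
have chQ n : prime_chain m n <-> prime_chain Q n.
  by split=> -[c [c1 c2 c3]]; exists c; split=> // x; rewrite c3 QE.
have bound n : prime_chain m n -> (n <= N + (phi t \in m))%N.
  by move/chQ/(prime_chain_bound unif_t phi_inj grN); rewrite QE.
have regular_bound (s : seq R) :
    {subset s <= m} -> weakly_regular s -> prime_chain m (size s).
  move=> sm reg; apply/chQ; apply: regular_prime_chain reg _ => x /sm.
  by rewrite QE.
have [s [ss reg sm]] := regN m mm.
exists (N + (phi t \in m))%N; split; split; last exact: bound.
- exists s; split=> //; apply/regular_seqP; split=> //.
  by move=> /(gen_by_idealr sm); rewrite idealr1.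
- by move=> s' sm' /regular_seqP[reg' _]; apply/bound/regular_bound.
- by rewrite -ss; apply: regular_bound.
Qed.

Lemma dvr_noetherian : noetherian V.
Proof.
apply/noetherianP => S idS; have [_ _ val] := unif_t.
have [[a Sa a0]|S0] := pselect (exists2 a, S a & a != 0); last first.
  exists [::]; split=> // x Sx T [T0 _] _.
  by suff -> : x = 0 by []; apply: contrapT => /eqP x0; apply: S0; exists x.
have exn : exists n, (fun n => `[< S (t ^+ n) >]) n.
  have [n [u uu aE]] := val a a0; exists n; apply/asboolP.
  by rewrite -[_ ^+ n](mulKr uu) -aE; apply: is_idealM.
case: (ex_minnP exn) => n /asboolP Stn minn; exists [:: t ^+ n].
split=> [y|x Sx T idT sT]; first by rewrite inE => /eqP->.
have [->|x0] := eqVneq x 0; first by case: idT.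
have [k [u uu xE]] := val x x0.
have /subnK kE : (n <= k)%N.
  apply: minn; apply/asboolP.
  by rewrite -[_ ^+ k](mulKr uu) -xE; apply: is_idealM.
by rewrite xE -kE exprD mulrA; apply: is_idealM => //; apply: sT; rewrite inE.
Qed.

Theorem cohen_macaulay_poly : cohen_macaulay_ring {poly V}.
Proof.
apply: (@cohen_macaulay_of_growth _ (polyC \o idfun) 1).
- by move=> x y /polyC_inj.
- exact/hilbert_basis/dvr_noetherian.
- exact/growth_poly/growth_id.
move=> m mm; have idm := contraction_is_ideal m.
have [s [ss reg gs]] := dvr_prime_regular idm (@contraction1 _ m) (@contraction_prime _ m mm).
have [s' [ss' reg' sm']] := weakly_regular_extend mm reg gs.
by exists s'; split=> //; rewrite ss' ss asboolb.
Qed.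

Theorem cohen_macaulay_poly2 : cohen_macaulay_ring {poly {poly V}}.
Proof.
apply: (@cohen_macaulay_of_growth _ (polyC \o (polyC \o idfun)) 2).
- by move=> x y /polyC_inj/polyC_inj.
- exact/hilbert_basis/hilbert_basis/dvr_noetherian.
- exact/growth_poly/growth_poly/growth_id.
move=> m mm; have idm := contraction_is_ideal m.
have [s [ss reg gs]] := poly_prime_regular idm (@contraction1 _ m)
  (@contraction_prime _ m mm) (contraction_not_extended mm).
have [s' [ss' reg' sm']] := weakly_regular_extend mm reg gs.
by exists s'; split=> //; rewrite ss' ss asboolb.
Qed.
End CohenMacaulayPoly.

(** * Transport of the Cohen-Macaulay property along ring isomorphisms *)

Section Transport.
Context (R S : comNzRingType) (f : {rmorphism R -> S}) (g : {rmorphism S -> R}).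
Hypotheses (fK : cancel f g) (gK : cancel g f).

Lemma gen_by_map (s : seq R) (x : R) : gen_by s x -> gen_by (map f s) (f x).
Proof.
move=> gx T idT sT; apply: (gx (fun z => T (f z))).
  split=> [|a y z Ty Tz]; first by rewrite rmorph0; case: idT.
  by rewrite rmorphD rmorphM; case: idT => _; apply.
by move=> y ys; apply/sT/map_f.
Qed.

Lemma ideal_preim (I : idealr R) : exists J : idealr S,
  forall y, (y \in J) = (g y \in I).
Proof.
have [||J JE] := @idealr_of S [set y | g y \in I].
- split=> [|a x y /= xI yI] /=; first by rewrite rmorph0 rpred0.
  by rewrite rmorphD rmorphM rpredD ?idealMr.
- by rewrite /= rmorph1 idealr1.
- by exists J => y; rewrite JE asboolb.
Qed.

Lemma prime_ideal_preim (I : prime_idealr R) : exists J : prime_idealr S,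
  forall y, (y \in J) = (g y \in I).
Proof.
have [|||J JE] := @prime_idealr_of S [set y | g y \in I].
- split=> [|a x y /= xI yI] /=; first by rewrite rmorph0 rpred0.
  by rewrite rmorphD rmorphM rpredD ?idealMr.
- by rewrite /= rmorph1 idealr1.
- by move=> x y /=; rewrite rmorphM prime_idealrM => /orP.
- by exists J => y; rewrite JE asboolb.
Qed.

Lemma prime_chain_preim (I : idealr R) (J : idealr S) n :
  (forall y, (y \in J) = (g y \in I)) -> prime_chain I n -> prime_chain J n.
Proof.
move=> JE [c [c1 c2 c3]].
have /choice[d dE] := fun i => prime_ideal_preim (c i).
exists d; split=> [i ni y|i ni|y].
- by rewrite !dE; apply: c1.
- by have [x xS xn] := c2 i ni; exists (f x); rewrite dE fK.
- by rewrite dE c3 JE.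
Qed.
End Transport.

Section TransportCM.
Context (R S : comNzRingType) (f : {rmorphism R -> S}) (g : {rmorphism S -> R}).
Hypotheses (fK : cancel f g) (gK : cancel g f).

Lemma gen_by_mapE (s : seq R) (x : R) : gen_by (map f s) (f x) <-> gen_by s x.
Proof.
split=> [/(@gen_by_map _ _ g)|]; last exact: gen_by_map.
by rewrite fK mapK.
Qed.

Lemma regular_seq_map (s : seq R) :
  regular_seq R^o s -> regular_seq S^o (map f s).
Proof.
move=> /regular_seqP[reg n1]; apply/regular_seqP; split; last first.
  by rewrite -(rmorph1 f) => /gen_by_mapE.
move=> i; rewrite size_map => si y; rewrite (nth_map 0) // -map_take.
by rewrite -[y]gK -rmorphM => /gen_by_mapE/(reg i si)/gen_by_mapE.
Qed.
End TransportCM.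

Lemma cohen_macaulay_iso (R S : comNzRingType) (f : {rmorphism R -> S}) :
  bijective f -> cohen_macaulay_ring R -> cohen_macaulay_ring S.
Proof.
move=> [g0 fK0 gK0] [noeR CMR].
have zg : zmod_morphism g0 := can2_zmod_morphism fK0 gK0.
have mg : monoid_morphism g0 := can2_monoid_morphism fK0 gK0.
pose g : {rmorphism S -> R} := HB.pack g0
  (GRing.isZmodMorphism.Build S R g0 zg) (GRing.isMonoidMorphism.Build S R g0 mg).
have fK : cancel f g := fK0; have gK : cancel g f := gK0.
split=> [|m mm].
  apply/noetherianP => T idT.
  have [|s [sT gT]] := (noetherianP R).1 noeR [set x | T (f x)].
  - split=> [|a x y /= Tx Ty] /=; first by rewrite rmorph0; case: idT.
    by rewrite rmorphD rmorphM; case: idT => _; apply.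
  - exists (map f s); split=> [_ /mapP[x /sT ? ->]//|y Ty].
    have Tfg : T (f (g y)) by rewrite gK.
    by rewrite -[y]gK; apply: gen_by_map; apply: gT.
have [n nE] := ideal_preim f m.
have mE y : (y \in m) = (g y \in n) by rewrite nE gK.
have mn : maximal_ideal n.
  apply: maximal_idealW => x; rewrite nE => /(maximal_ideal_inv mm)[y xy].
  by exists (g y); rewrite nE rmorphB rmorphM gK rmorph1.
have [d [[[s [sn regs ss]] dmax] [chn hmax]]] := CMR n mn.
exists d; split; split.
- exists (map f s); split; last by rewrite size_map.
    by move=> _ /mapP[x /sn xn ->]; rewrite mE fK.
  exact: regular_seq_map fK gK _ regs.
- move=> s' s'm reg; rewrite -(size_map g); apply: dmax.
    by move=> _ /mapP[x /s'm xm ->]; rewrite -mE.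
  exact: regular_seq_map gK fK _ reg.
- exact: prime_chain_preim fK _ _ _ mE chn.
- by move=> k chm; apply: hmax; apply: prime_chain_preim gK _ _ _ nE chm.
Qed.

(** * Invariants of the symmetric algebra *)

Lemma malgU_scale (K : choiceType) (R : nzRingType) (k : K) (c : R) :
  mkmalgU k c = c *: mkmalgU k 1.
Proof. by apply/malgP => l; rewrite mcoeffZ !mcoeffU mulr_natr. Qed.

Lemma malgUM (K : monomType) (R : nzRingType) (k l : K) :
  mkmalgU (mmul k l) 1 = mkmalgU k 1 * mkmalgU l 1 :> {malg R[K]}.
Proof. by rewrite malgM_def fgmulUU mulr1. Qed.

Lemma malg_ind (K : monomType) (R : nzRingType) (P : {malg R[K]} -> Prop) :
    (forall k, P (mkmalgU k 1)) -> (forall a p, P p -> P (a *: p)) ->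
    (forall p q, P p -> P q -> P (p + q)) -> forall p, P p.
Proof.
move=> P1 PZ PD p; rewrite [p]monalgE; apply: big_ind => [||k _].
- by rewrite -(scale0r (mkmalgU (@mone K) 1)); apply/PZ/P1.
- exact: PD.
- by rewrite malgU_scale; apply/PZ/P1.
Qed.

Lemma cmonom_ind (I : choiceType) (Q : cmonom I -> Prop) :
    Q (@mone (cmonom I)) -> (forall i k, Q k -> Q (mmul (ucm i) k)) ->
  forall k, Q k.
Proof.
move=> Q1 QM k; have [n] := ubnP (mdeg k); elim: n k => // n IHn k.
rewrite ltnS => kn; have [k1|k1] := eqVneq (mdeg k) 0%N.
  by rewrite (mdeg_eq0I k1).
have [i ik] : exists i, i \in finsupp k.
  apply: contrapT => nex; case/eqP: k1; rewrite mdegE big_seq big1 // => i ik.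
  by case: nex; exists i.
pose k' := divcm k (ucm i).
have kE : k = mmul (ucm i) k'.
  apply/eqP/cmP => w; rewrite cmM divcmE cmU; case: eqVneq => [<-|_]; last by rewrite subn0.
  by rewrite subnKC // lt0n cmE_neq0.
by rewrite kE; apply/QM/IHn; move: kn; rewrite {1}kE mdegM mdegU add1n.
Qed.

Section SymInd.
Context (R : comNzRingType) (V : lmodType R).

Lemma free_ind (P : {malg R[cmonom V]} -> Prop) :
    P 1 -> (forall a p, P p -> P (a *: p)) ->
    (forall p q, P p -> P q -> P (p + q)) ->
    (forall p q, P p -> P q -> P (p * q)) ->
    (forall v, P (sym_var v)) ->
  forall p, P p.
Proof.
move=> P1 PZ PD PM Pv; apply: (@malg_ind (cmonom V) R P _ PZ PD).
apply: (@cmonom_ind V (fun k => P (mkmalgU k 1)) P1) => v k Pk.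
rewrite (@malgUM (cmonom V) R); apply: PM Pk.
by have := Pv v; rewrite /sym_var unlock.
Qed.

Lemma sym_ind (P : sym_alg V -> Prop) :
    P 1 -> (forall a x, P x -> P (a *: x)) ->
    (forall x y, P x -> P y -> P (x + y)) ->
    (forall x y, P x -> P y -> P (x * y)) ->
    (forall v, P (sym_in v)) ->
  forall x, P x.
Proof.
move=> P1 PZ PD PM Pv x; have [p ->] := quot_projP x.
elim/free_ind: p => [|a p|p q|p q|v].
- by rewrite rmorph1.
- by rewrite linearZ; apply: PZ.
- by rewrite rmorphD; apply: PD.
- by rewrite rmorphM; apply: PM.
- exact: Pv.
Qed.
Lemma sym_in_algZ (a : R) (v : V) : (a%:A : sym_alg V) * sym_in v = sym_in (a *: v).
Proof. by rewrite mulr_algl linearZ. Qed.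
End SymInd.

Lemma poly_rmorph_ext (C T : nzRingType) (f g : {rmorphism {poly C} -> T}) :
  (forall a, f a%:P = g a%:P) -> f 'X = g 'X -> f =1 g.
Proof.
move=> fgC fgX p; elim/poly_ind: p => [|p c IHp]; first by rewrite !rmorph0.
by rewrite !rmorphD !rmorphM /= IHp fgX fgC.
Qed.

Section ReflectionInvariants.
Context (C : idomainType) (c : C).

Let N : {poly C} := 'X * (c%:P - 'X).

Let sizeN : size N = 3.
Proof.
have sX : size (c%:P - 'X) = 2 by rewrite -opprB size_polyN size_XsubC.
rewrite /N mulrC size_mulX ?sX //.
by rewrite -size_poly_gt0 sX.
Qed.

Lemma comp_reflection_inj : injective (comp_poly N).
Proof.
move=> p q /eqP; rewrite -subr_eq0 -linearB /= => /eqP pq.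
apply/eqP; rewrite -subr_eq0; apply: contraT => npq.
have := size_comp_poly (p - q) N; rewrite pq size_poly0 sizeN /= => /esym/eqP.
rewrite muln_eq0 orbF -subn1 subn_eq0 => /size1_polyC pqC.
by move: pq; rewrite pqC comp_polyC => /eqP; rewrite -pqC (negPf npq).
Qed.

Lemma comp_reflection_basis q :
  exists a b, q = (a \Po N) + (b \Po N) * 'X.
Proof.
elim/poly_ind: q => [|q d [a [b ->]]].
  by exists 0, 0; rewrite comp_poly0 mul0r addr0.
(* The reduction X^2 = c X - N, applied to (a(N) + b(N) X) X + d. *)
exists (d%:P - 'X * b), (a + c%:P * b).
rewrite linearB linearD /= !comp_polyM !comp_polyC comp_polyX /N; ring.
Qed.

Lemma comp_reflection_fixed q : (c != 0) || (2%:R != 0 :> C) ->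
  q \Po (c%:P - 'X) = q <-> exists p, q = p \Po N.
Proof.
move=> ndeg.
have NX : N \Po (c%:P - 'X) = N.
  by rewrite /N comp_polyM comp_polyB comp_polyC comp_polyX; ring.
have [a [b ->]] := comp_reflection_basis q; split=> [|[p ->]]; last first.
  by rewrite -comp_polyA NX.
rewrite comp_polyD comp_polyM -!comp_polyA NX comp_polyX => /addrI/eqP.
rewrite -subr_eq0 -mulrBr mulf_eq0 => /orP[/eqP->|].
  by exists a; rewrite mul0r addr0.
have -> : c%:P - 'X - 'X = c%:P - 2%:R%:P * 'X by rewrite polyC_natr; ring.
move=> /eqP e; move: ndeg.
have c0 : c = 0.
  by have := congr1 (coefp 0) e; rewrite /= coefB coefC coefCM coefX mulr0 subr0 coef0.
have t0 : 2%:R = 0 :> C.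
  have := congr1 (coefp 1) e; rewrite /= coefB coefC coefCM coefX mulr1 sub0r coef0.
  by move/eqP; rewrite oppr_eq0 => /eqP.
by rewrite c0 t0 eqxx.
Qed.
End ReflectionInvariants.

Section InvariantRings.
Context (V : idomainType) (gT : finGroupType) (M : lmodType (grp_ring V gT)).

Local Notation S := (sym_alg (base_mod M)).

Lemma cohen_macaulay_invariants (C : comNzRingType) (Phi : {rmorphism C -> S}) :
    injective Phi ->
    (forall s : S, s \in invariant_pred (M := M) <-> exists p, s = Phi p) ->
    cohen_macaulay_ring C ->
  cohen_macaulay_ring (invariant_ring M).
Proof.
move=> Phi_inj PhiE CM.
have Phi_inv p : Phi p \in invariant_pred (M := M) by apply/PhiE; exists p.
pose f0 p : invariant_ring M := InvariantRing (Phi_inv p).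
have zf : zmod_morphism f0.
  by move=> p q; apply: val_inj; rewrite rmorphB; apply: (rmorphB Phi).
have mf : monoid_morphism f0.
  split; first by apply: val_inj; rewrite rmorph1; apply: (rmorph1 Phi).
  by move=> p q; apply: val_inj; rewrite rmorphM; apply: (rmorphM Phi).
pose f : {rmorphism C -> invariant_ring M} := HB.pack f0
  (GRing.isZmodMorphism.Build _ _ f0 zf) (GRing.isMonoidMorphism.Build _ _ f0 mf).
apply: (@cohen_macaulay_iso _ _ f) CM.
have /choice[h hE] : forall s : invariant_ring M, exists p, val s = Phi p.
  by move=> s; apply/PhiE; apply: valP.
exists h => [p|s]; last by apply: val_inj; rewrite [RHS]hE.
by apply: Phi_inj; rewrite -hE.
Qed.

(* G reads Sym(M) as the polynomial ring C[y]. *)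
Lemma cohen_macaulay_reflection (C : idomainType) (eta : {rmorphism C -> S})
    (y : S) (G : {rmorphism S -> {poly C}}) (g : gT) (c : C) :
    (forall a, G (eta a) = a%:P) -> G y = 'X ->
    (forall a : V, exists b, a%:A = eta b) ->
    (forall v : base_mod M, exists a b, sym_in v = eta a + eta b * y) ->
    (forall a, sym_act g (eta a) = eta a) -> sym_act g y = eta c - y ->
    (c != 0) || (2%:R != 0 :> C) ->
    (forall s : S, (forall h, sym_act h s = s) <-> sym_act g s = s) ->
    cohen_macaulay_ring {poly C} ->
  cohen_macaulay_ring (invariant_ring M).
Proof.
move=> Geta GY etaV geny geta gy ndeg gen_g.
have [F [FC FX]] : exists F : {rmorphism {poly C} -> S},
    (forall a, F a%:P = eta a) /\ F 'X = y.
  exists (horner_eval y \o map_poly eta : {rmorphism {poly C} -> S}).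
  split=> [a|]; first by rewrite /= map_polyC /= /horner_eval hornerC.
  by rewrite /= map_polyX /horner_eval hornerX.
have FK : cancel F G.
  apply: (poly_rmorph_ext (f := G \o F) (g := idfun)) => [a|] /=.
    by rewrite FC Geta.
  by rewrite FX GY.
have gF p : sym_act g (F p) = F (p \Po (c%:P - 'X)).
  apply: (poly_rmorph_ext (f := (sym_act g : {rmorphism S -> S}) \o F)
    (g := F \o comp_poly (c%:P - 'X))) => [a|] /=.
    by rewrite FC geta comp_polyC FC.
  by rewrite comp_polyX rmorphB /= FC FX gy.
pose Phi : {rmorphism {poly C} -> S} := F \o comp_poly ('X * (c%:P - 'X)).
apply: (cohen_macaulay_invariants (Phi := Phi)).
  by move=> p q /(can_inj FK)/comp_reflection_inj.
have gen s : exists q, s = F q.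
  elim/sym_ind: s => [|a x [q ->]|x z [q ->] [r ->]|x z [q ->] [r ->]|v].
  - by exists 1; rewrite rmorph1.
  - have [b ab] := etaV a; exists (b%:P * q).
    by rewrite rmorphM FC -ab mulr_algl.
  - by exists (q + r); rewrite rmorphD.
  - by exists (q * r); rewrite rmorphM.
  - have [a [b ->]] := geny v; exists (a%:P + b%:P * 'X).
    by rewrite rmorphD rmorphM !FC FX.
move=> s; have [q ->] := gen s.
have -> : (F q \in invariant_pred (M := M)) <-> q \Po (c%:P - 'X) = q.
  split=> [/forallP/(_ g)/eqP|qE].
    by rewrite gF => /(can_inj FK).
  by apply/forallP => h; apply/eqP; move: h; apply/gen_g; rewrite gF qE.
rewrite (comp_reflection_fixed _ ndeg); split=> -[p] => [->|/(can_inj FK)->];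
  by exists p.
Qed.
End InvariantRings.

(* {poly C} as an algebra over the base ring of C instead of over C. *)
Definition base_poly (V : comNzRingType) (C : comAlgType V) : Type := {poly C}.

Section BasePoly.
Context (V : comNzRingType) (C : comAlgType V).

HB.instance Definition _ := GRing.ComNzRing.on (base_poly C).

Let sc (a : V) (p : base_poly C) : base_poly C := (a%:A)%:P * (p : {poly C}).

Fact base_poly_scA a b p : sc a (sc b p) = sc (a * b) p.
Proof. by rewrite /sc mulrA -polyCM mulr_algl scalerA. Qed.
Fact base_poly_sc1 : left_id 1 sc.
Proof. by move=> p; rewrite /sc scale1r mul1r. Qed.
Fact base_poly_scDr : right_distributive sc +%R.
Proof. by move=> a p q; rewrite /sc mulrDr. Qed.
Fact base_poly_scDl p : {morph sc^~ p : a b / a + b}.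
Proof. by move=> a b; rewrite /sc scalerDl polyCD mulrDl. Qed.
HB.instance Definition _ := GRing.Zmodule_isLmodule.Build V (base_poly C)
  base_poly_scA base_poly_sc1 base_poly_scDr base_poly_scDl.
Fact base_poly_scAl (a : V) (p q : base_poly C) : a *: (p * q) = (a *: p) * q.
Proof. exact: mulrA. Qed.
HB.instance Definition _ :=
  GRing.Lmodule_isLalgebra.Build V (base_poly C) base_poly_scAl.
HB.instance Definition _ := GRing.Lalgebra_isComAlgebra.Build V (base_poly C).
End BasePoly.

(** * Lattices of rank one and two and their invariants *)

Section Ranks.
Context (V : idomainType) (gT : finGroupType) (g : gT).
Implicit Type M : lmodType (grp_ring V gT).

Definition act M (h : gT) (v : base_mod M) : base_mod M := gr_elt V h *: (v : M).

Definition rank1_type M (eps : V) := exists e : base_mod M,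
  [/\ forall v, exists a, v = a *: e,
      forall a : V, a *: e = 0 -> a = 0 & act g e = eps *: e].

Definition rank2_type M (b : V) := exists x y : base_mod M,
  [/\ forall v, exists c d, v = c *: x + d *: y,
      forall c d : V, c *: x + d *: y = 0 -> c = 0 /\ d = 0,
      act g x = x & act g y = b *: x - y].

Lemma actZ M h (a : V) v : @act M h (a *: v) = a *: act h v.
Proof.
change (gr_elt V h *: (a%:A *: (v : M)) = a%:A *: (gr_elt V h *: (v : M))).
by rewrite !scalerA -scalerAr mulr1 -scalerAl mul1r.
Qed.

Lemma actD M h v w : @act M h (v + w) = act h v + act h w.
Proof. exact: (scalerDr (gr_elt V h) (v : M) (w : M)). Qed.

Lemma act1 M v : @act M 1%g v = v.
Proof. exact: (scale1r (v : M)). Qed.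

Lemma actM M h k v : @act M h (act k v) = act (h * k)%g v.
Proof.
change (gr_elt V h *: (gr_elt V k *: (v : M)) = gr_elt V (h * k)%g *: (v : M)).
by rewrite scalerA gr_eltM.
Qed.

Lemma sym_act_id M h (s : sym_alg (base_mod M)) :
  (forall v : base_mod M, act h v = v) -> sym_act h s = s.
Proof.
move=> hv; elim/sym_ind: s => [|a x IH|x y IHx IHy|x y IHx IHy|v].
- by rewrite rmorph1.
- by rewrite linearZ /= IH.
- by rewrite rmorphD /= IHx IHy.
- by rewrite rmorphM /= IHx IHy.
- by rewrite sym_act_in; congr sym_in; apply: hv.
Qed.

Section Coordinates.
Context (M : lmodType (grp_ring V gT)).

Lemma coordinate_linear (T : lmodType V) (c : base_mod M -> V) (x : T) :
    (forall a v w, c (a *: v + w) = a * c v + c w) ->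
  exists f : {linear base_mod M -> T}, forall v, f v = c v *: x.
Proof.
move=> cl; pose f0 v := c v *: x.
have lf : linear f0 by move=> a v w; rewrite /f0 cl scalerDl scalerA.
pose f : {linear base_mod M -> T} :=
  HB.pack f0 (GRing.isLinear.Build V (base_mod M) T *:%R f0 lf).
by exists f.
Qed.
End Coordinates.

Hypothesis gT_g : forall h : gT, h = 1%g \/ h = g.

Lemma invariants_generator M (s : sym_alg (base_mod M)) :
  (forall h, sym_act h s = s) <-> sym_act g s = s.
Proof.
split=> [//|gs h]; have [->|->//] := gT_g h.
by apply: sym_act_id => v; apply: act1.
Qed.

Context (t : V) (unif_t : uniformizer t).

(** For eps = 1 the whole of S(M) = V[e] is invariant. For eps = -1 the action is the reflection
    with c = 0, which is nontrivial because 2 is nonzero. *)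
Lemma cohen_macaulay_rank1 M eps : rank1_type M eps ->
  eps = 1 \/ (eps = -1 /\ 2%:R != 0 :> V) -> cohen_macaulay_ring (invariant_ring M).
Proof.
move=> [e [span free ge]] eps1.
have /choice[c cE] := span.
have cinj a b : a *: e = b *: e -> a = b.
  by move=> /eqP; rewrite -subr_eq0 -scalerBl => /eqP/free/eqP; rewrite subr_eq0 => /eqP.
have cl a v w : c (a *: v + w) = a * c v + c w.
  by apply: cinj; rewrite -cE scalerDl -scalerA -!cE.
have [f fE] := coordinate_linear ('X : {poly V}) cl.
have ce : c e = 1 by apply: cinj; rewrite -cE scale1r.
pose S := sym_alg (base_mod M).
have [G [GA Ge]] : exists G : {rmorphism S -> {poly V}},
    (forall a : V, G a%:A = a%:P) /\ G (sym_in e) = 'X.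
  exists (sym_lift f : {rmorphism S -> {poly V}}); split=> [a|].
    by rewrite /= linearZ rmorph1 /= alg_polyC.
  by rewrite /= sym_lift_in fE ce scale1r.
case: eps1 => [eps1|[epsN n2]].
  have [F [FC FX]] : exists F : {rmorphism {poly V} -> S},
      (forall a, F a%:P = a%:A) /\ F 'X = sym_in e.
    exists (horner_alg (sym_in e : S)); split=> [a|]; first exact: horner_algC.
    exact: horner_algX.
  have FK : cancel F G.
    by apply: (poly_rmorph_ext (f := G \o F) (g := idfun)) => [a|] /=;
      rewrite ?FC ?FX ?GA ?Ge.
  apply: (cohen_macaulay_invariants (Phi := F)) (cohen_macaulay_poly unif_t).
    exact: can_inj FK.
  move=> s; split=> _; last first.
    apply/forallP => h; apply/eqP; move: h; apply/invariants_generator/sym_act_id.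
    by move=> v; have [a ->] := span v; rewrite actZ ge eps1 scale1r.
  elim/sym_ind: s => [|a x [q ->]|x z [q ->] [r ->]|x z [q ->] [r ->]|v].
  - by exists 1; rewrite rmorph1.
  - by exists (a%:P * q); rewrite rmorphM FC mulr_algl.
  - by exists (q + r); rewrite rmorphD.
  - by exists (q * r); rewrite rmorphM.
  - exists (c v *: 'X); rewrite -mul_polyC rmorphM FC FX mulr_algl -linearZ.
    by rewrite /= -cE.
pose eta : {rmorphism V -> S} := in_alg S.
apply: (@cohen_macaulay_reflection V gT M V eta (sym_in e) G g 0) => //.
- by move=> a; exists a.
- move=> v; exists 0, (c v).
  by rewrite rmorph0 add0r mulr_algl -linearZ /= -cE.
- by move=> a; rewrite /= linearZ /= rmorph1.
- rewrite sym_act_in rmorph0 sub0r -linearN; congr sym_in.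
  by apply: etrans ge _; rewrite epsN scaleN1r.
- by rewrite eqxx.
- exact: invariants_generator.
- exact: cohen_macaulay_poly unif_t.
Qed.

(** The reflection takes place over C = V[x] with c = b x, which is nonzero in every
    characteristic. *)
Lemma cohen_macaulay_rank2 M b : rank2_type M b -> b != 0 ->
  cohen_macaulay_ring (invariant_ring M).
Proof.
move=> [x [y [span free gx gy]]] b0.
have /choice[c /choice[d cdE]] := span.
have cdinj a1 a2 b1 b2 :
    a1 *: x + a2 *: y = b1 *: x + b2 *: y -> a1 = b1 /\ a2 = b2.
  move=> /eqP; rewrite -subr_eq0 opprD addrACA -!scalerBl => /eqP/free[].
  by move=> /eqP; rewrite subr_eq0 => /eqP-> /eqP; rewrite subr_eq0 => /eqP->.
have cdl a v w : c (a *: v + w) = a * c v + c w /\ d (a *: v + w) = a * d v + d w.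
  apply: cdinj; rewrite -cdE !scalerDl -!scalerA addrACA -scalerDr.
  by rewrite -!cdE.
have cdx : c x = 1 /\ d x = 0 by apply: cdinj; rewrite -cdE scale1r scale0r addr0.
have cdy : c y = 0 /\ d y = 1 by apply: cdinj; rewrite -cdE scale1r scale0r add0r.
pose S := sym_alg (base_mod M).
pose B := base_poly {poly V}.
have [f1 f1E] := coordinate_linear ('X%:P : B) (fun a v w => (cdl a v w).1).
have [f2 f2E] := coordinate_linear ('X : B) (fun a v w => (cdl a v w).2).
pose f0 v := f1 v + f2 v.
have lf : linear f0.
  by move=> a v w; rewrite /f0 !linearP /= scalerDr addrACA.
pose f : {linear base_mod M -> B} :=
  HB.pack f0 (GRing.isLinear.Build V (base_mod M) B *:%R f0 lf).
have [G [GA Gx Gy]] : exists G : {rmorphism S -> {poly {poly V}}},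
    [/\ forall a : V, G a%:A = a%:P%:P, G (sym_in x) = 'X%:P & G (sym_in y) = 'X].
  exists (sym_lift f : {rmorphism S -> B}); split=> [a||].
  - rewrite /= linearZ rmorph1 /=.
    by rewrite -[LHS]/((a%:A)%:P * 1 : {poly {poly V}}) mulr1 alg_polyC.
  - rewrite /= sym_lift_in -[f x]/(f1 x + f2 x) f1E f2E cdx.1 cdx.2.
    by rewrite scale1r scale0r addr0.
  - rewrite /= sym_lift_in -[f y]/(f1 y + f2 y) f1E f2E cdy.1 cdy.2.
    by rewrite scale1r scale0r add0r.
have [eta [etaC etaX]] : exists F : {rmorphism {poly V} -> S},
    (forall a, F a%:P = a%:A) /\ F 'X = sym_in x.
  exists (horner_alg (sym_in x : S)); split=> [a|]; first exact: horner_algC.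
  exact: horner_algX.
apply: (@cohen_macaulay_reflection V gT M {poly V} eta (sym_in y) G g (b *: 'X)) => //.
- apply: (poly_rmorph_ext (f := G \o eta) (g := polyC)) => [a|] /=.
    by rewrite etaC GA.
  by rewrite etaX Gx.
- by move=> a; exists a%:P; rewrite etaC.
- move=> v; exists ((c v)%:P * 'X), (d v)%:P.
  rewrite rmorphM !etaC etaX.
  have X1 := sym_in_algZ (c v) x; have X2 := sym_in_algZ (d v) y.
  rewrite {1}X1 {1}X2 {1}(cdE v).
  exact: (raddfD (@sym_in V (base_mod M))).
- apply: (poly_rmorph_ext (f := (sym_act g : {rmorphism S -> S}) \o eta)
    (g := eta)) => [a|] /=.
    by rewrite etaC linearZ /= rmorph1.
  by rewrite etaX sym_act_in; congr sym_in; apply: gx.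
- rewrite sym_act_in -mul_polyC rmorphM etaC etaX.
  have X1 := sym_in_algZ b x; rewrite {1}X1.
  apply: etrans (raddfB (@sym_in V (base_mod M)) _ _).
  by congr sym_in; apply: gy.
- by rewrite -mul_polyC mulf_eq0 polyC_eq0 negb_or b0 polyX_eq0.
- exact: invariants_generator.
- exact: cohen_macaulay_poly2 unif_t.
Qed.
End Ranks.

(** * Lattices over the group ring *)

Section FreeModules.
Context (V : idomainType) (t : V) (unif_t : uniformizer t) (N : lmodType V).

Lemma submoduleD (U : set N) x y : submodule U -> U x -> U y -> U (x + y).
Proof. by move=> [U0 UL] Ux Uy; rewrite -[x]scale1r; apply: UL. Qed.

Lemma submoduleZ (U : set N) a x : submodule U -> U x -> U (a *: x).
Proof. by move=> [U0 UL] Ux; rewrite -[_ *: _]addr0; apply: UL. Qed.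

Lemma submodule_sum (U : set N) (J : Type) (r : seq J) (P : pred J) (F : J -> N) :
  submodule U -> (forall i, P i -> U (F i)) -> U (\sum_(i <- r | P i) F i).
Proof.
by move=> sU UF; elim/big_ind: _ => //; [case: sU | move=> *; apply: submoduleD].
Qed.

Definition spanned_by (s : seq N) :=
  forall U, submodule U -> (forall y, y \in s -> U y) -> forall x, U x.

Lemma in_span_submodule (s : seq N) : submodule (in_span s).
Proof.
split; first by exists (fun=> 0); rewrite big1 // => i _; rewrite scale0r.
move=> a _ _ [c ->] [d ->]; exists (fun i => a * c i + d i).
rewrite scaler_sumr -big_split; apply: eq_bigr => i _ /=.
by rewrite scalerDl scalerA.
Qed.

Lemma in_span_mem (s : seq N) y : y \in s -> in_span s y.
Proof.
move=> ys; exists (fun i => (i == index y s)%:R).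
have yi : (index y s < size s)%N by rewrite index_mem.
rewrite (bigD1 (Ordinal yi)) //= eqxx scale1r nth_index // big1 ?addr0 //.
move=> i /eqP ni; case: eqP => [e|_]; last exact: scale0r.
by case: ni; apply: val_inj.
Qed.

Hypothesis tf_t : forall x : N, t *: x = 0 -> x = 0.

Lemma torsion_free (a : V) (x : N) : a != 0 -> a *: x = 0 -> x = 0.
Proof.
have [_ _ val] := unif_t; move=> /val[n [u uu ->]].
rewrite -scalerA => ux; have : u^-1 *: (u *: (t ^+ n *: x)) = 0.
  by rewrite ux scaler0.
rewrite (scalerA u^-1) mulVr // scale1r; clear ux.
by elim: n => [|n IHn]; rewrite ?scale1r // exprS -scalerA => /tf_t.
Qed.

Lemma torsion_free_basis (s : seq N) : spanned_by s ->
  exists n (e : 'I_n -> N) (c : N -> 'I_n -> V),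
    (forall x, x = \sum_i c x i *: e i) /\
    (forall (d : 'I_n -> V), \sum_i d i *: e i = 0 -> d =1 (fun=> 0)).
Proof.
have [n] := ubnP (size s); elim: n s => // n IHn s; rewrite ltnS => sn span.
have [[d [i di] dE]|indep] := pselect (exists2 d : 'I_(size s) -> V,
    exists i, d i != 0 & \sum_i d i *: s`_i = 0); last first.
  exists (size s), (fun i => s`_i).
  have /choice[c cE] : forall x, in_span s x.
    by apply: span; [exact: in_span_submodule | exact: in_span_mem].
  exists (fun x i => c x i); split=> [//|d dE i].
  by apply: contrapT => /eqP di; apply: indep; exists d => //; exists i.
have [|a [f [a0 df] [j _ fj]]] := @uniformizer_factor V t unif_t _ (enum 'I_(size s)) d.
  by exists i; rewrite ?mem_enum.
have fE : \sum_i f i *: s`_i = 0.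
  apply: (torsion_free a0); rewrite scaler_sumr -[RHS]dE; apply: eq_bigr => k _.
  by rewrite df ?mem_enum // scalerA.
pose s' := [seq s`_(k : 'I_(size s)) | k <- enum 'I_(size s) & k != j].
apply: (IHn s'); last first.
  move=> U sU Us'; apply: span => // y ys.
  have Uk k : k != j -> U s`_k.
    by move=> kj; apply: Us'; apply/mapP; exists k; rewrite // mem_filter kj mem_enum.
  have yi : (index y s < size s)%N by rewrite index_mem.
  rewrite -(nth_index 0 ys) -[index y s]/(val (Ordinal yi)).
  have [->|/Uk//] := eqVneq (Ordinal yi) j.
  move: fE; rewrite (bigD1 j) //= fj scale1r => /eqP; rewrite addr_eq0 => /eqP->.
  rewrite -scaleN1r; apply: submoduleZ => //; apply: submodule_sum => // k kj.
  by apply: submoduleZ => //; apply: Uk.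
rewrite size_map size_filter; apply: leq_trans sn.
have := count_predC (fun k => k != j) (enum 'I_(size s)).
rewrite size_enum_ord; set k := count _ _ => cs.
apply: (@leq_trans (k + count (predC (fun k => k != j)) (enum 'I_(size s)))%N).
  rewrite -addn1 leq_add2l -has_count.
  by apply/hasP; exists j; rewrite ?mem_enum //= eqxx.
by rewrite cs.
Qed.
End FreeModules.

(** * The group ring of a group of order two and the classification *)

Section GroupOfOrderTwo.
Context (V : idomainType) (t : V) (unif_t : uniformizer t).
Context (gT : finGroupType) (g : gT).
Hypotheses (gT_g : forall h : gT, h = 1%g \/ h = g) (g_neq1 : g != 1%g).
Local Notation R := (grp_ring V gT).

Lemma sum_order2 (T : nmodType) (F : gT -> T) : \sum_h F h = F 1%g + F g.
Proof.
rewrite (bigD1 1%g) //= (bigD1 g) //= big1 ?addr0 // => h /andP[h1 hg].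
by have [e|e] := gT_g h; rewrite e eqxx in h1 hg.
Qed.

Lemma mulgg : (g * g = 1)%g.
Proof.
have [//|e] := gT_g (g * g)%g.
by move: g_neq1; rewrite -(inj_eq (mulgI g)) mulg1 e eqxx.
Qed.

Lemma invg_order2 : (g^-1 = g)%g.
Proof. by apply/eqP; rewrite eq_invg_mul mulgg. Qed.

Lemma gr_mulE (r s : R) :
  (r * s) 1%g = r 1%g * s 1%g + r g * s g /\
  (r * s) g = r 1%g * s g + r g * s 1%g.
Proof.
rewrite -[r * s]/(gr_mul r s) !ffunE !sum_order2 invg1 !mul1g mulg1 invg_order2.
by rewrite mulgg.
Qed.

Lemma gr_ext (r s : R) : r 1%g = s 1%g -> r g = s g -> r = s.
Proof. by move=> r1 rg; apply/ffunP => h; have [->|->] := gT_g h. Qed.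

Lemma gr_scaleE (a : V) (r : R) h : (a *: r) h = a * r h.
Proof. by rewrite ffunE. Qed.

Lemma gr_one1 : (1 : R) 1%g = 1 /\ (1 : R) g = 0.
Proof. by rewrite -[1]/(gr_elt V (1%g : gT)) !ffunE eqxx (negPf g_neq1). Qed.

Lemma gr_gen1 : gr_elt V g 1%g = 0 /\ gr_elt V g g = 1.
Proof. by rewrite !ffunE eqxx eq_sym (negPf g_neq1). Qed.

Lemma gr_decomp (r : R) : r = (r 1%g)%:A + (r g)%:A * gr_elt V g.
Proof.
rewrite mulr_algl; apply: gr_ext; rewrite !ffunE /= !eqxx.
  by rewrite eq_sym (negPf g_neq1) [_ *: 0]mulr0 addr0 [_ *: 1]mulr1.
by rewrite (negPf g_neq1) [_ *: 0]mulr0 add0r [_ *: 1]mulr1.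
Qed.

(** The augmentation V[G] -> V, sending g to 1. Prime ideals of V[G], among them the maximal ideal,
    are produced as preimages under it. *)
Definition aug (r : R) : V := r 1%g + r g.

Lemma aug_zmod : zmod_morphism aug.
Proof. by move=> r s; rewrite /aug !ffunE addrACA opprD. Qed.
Lemma aug_monoid : monoid_morphism aug.
Proof.
split; first by rewrite /aug gr_one1.1 gr_one1.2 addr0.
by move=> r s; rewrite /aug (gr_mulE r s).1 (gr_mulE r s).2; ring.
Qed.
HB.instance Definition _ := GRing.isZmodMorphism.Build R V aug aug_zmod.
HB.instance Definition _ := GRing.isMonoidMorphism.Build R V aug aug_monoid.

Lemma aug_alg a : aug a%:A = a.
Proof. by rewrite /aug !gr_scaleE gr_one1.1 gr_one1.2 mulr1 mulr0 addr0. Qed.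

Lemma aug_preim_ideal (S : set V) : is_ideal S -> ~ S 1 ->
    (forall a b, S (a * b) -> S a \/ S b) ->
  exists I : prime_idealr R, forall r, (r \in I) = `[< S (aug r) >].
Proof.
move=> idS S1 prS; apply: (@prime_idealr_of R [set r | S (aug r)]).
- split=> [|a r s /= Sr Ss] /=; first by rewrite rmorph0; case: idS.
  by rewrite rmorphD rmorphM; case: idS => _; apply.
- by rewrite /= rmorph1.
- by move=> r s /=; rewrite rmorphM => /prS.
Qed.

Lemma nonunit_ideal : is_ideal [set a : V | a \isn't a GRing.unit].
Proof.
split=> [|a x y /= nx ny] /=; first by rewrite unitr0.
have [a' ->] := uniformizer_nonunit_dvd unif_t nx.
have [b' ->] := uniformizer_nonunit_dvd unif_t ny.
rewrite mulrA -mulrDl; have [_ nt _] := unif_t.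
by apply: contra nt; rewrite unitrM => /andP[].
Qed.

Lemma nonunit_prime (a b : V) :
  a * b \isn't a GRing.unit -> a \isn't a GRing.unit \/ b \isn't a GRing.unit.
Proof. by rewrite unitrM negb_and => /orP[]; [left|right]. Qed.

Lemma aug_maximal (m : idealr R) :
    (forall r, (r \in m) = (aug r \isn't a GRing.unit)) -> maximal_ideal m.
Proof.
move=> mE J mJ x; apply/idP/idP => [xJ|/mJ//]; rewrite mE; apply/negP => ux.
have e1 : x - (aug x)%:A \in J.
  by apply: mJ; rewrite mE rmorphB /= aug_alg subrr unitr0.
have := rpredB xJ e1; rewrite opprB addrC subrK => axJ.
suff : 1 \in J by rewrite idealr1.
have -> : 1 = (aug x)^-1%:A * (aug x)%:A :> R by rewrite mulr_algl scalerA mulVr // scale1r.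
by apply: idealMr.
Qed.

Hypothesis two_nonunit : (2%:R : V) \isn't a GRing.unit.
Implicit Type M : lmodType R.

(* An element of the maximal ideal has its square in tR, so it cannot be
   regular on a module with t-torsion. *)
Lemma mcm_torsion_free M : mcm_module M -> forall x : base_mod M, t *: x = 0 -> x = 0.
Proof.
move=> [fgM cm]; have [t0 tnu _] := unif_t.
have [|||K KE] := @aug_preim_ideal (fun a => a = 0).
- by split=> // a b c -> ->; rewrite mulr0 addr0.
- by move/eqP; rewrite oner_eq0.
- by move=> a b /eqP; rewrite mulf_eq0 => /orP[/eqP|/eqP]; [left|right].
have [|m mE] := aug_preim_ideal nonunit_ideal _ nonunit_prime.
  by rewrite /= unitr1.
have {}mE r : (r \in m) = (aug r \isn't a GRing.unit) by rewrite mE asboolb.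
have mm : maximal_ideal m by apply: aug_maximal.
have [d [[[s [sm [reg _] sd]] _] [_ hmax]]] := cm m mm.
(* The kernel of the augmentation lies strictly below m, so the height is at least 1 and the regular
   sequence has a first term. *)
have chain1 : prime_chain m 1.
  exists (fun i => if i is 0%N then K else m); split=> [[|i]|[|i]|] // _.
    by move=> r; rewrite KE mE => /asboolP->; rewrite unitr0.
  exists t%:A; first by rewrite mE aug_alg.
  by rewrite KE; apply/asboolP; rewrite aug_alg; apply/eqP.
have d1 : (0 < size s)%N by rewrite sd; apply: hmax.
have s0m : s`_0 \in m by apply: sm; rewrite mem_nth.
set r := s`_0 in s0m; move=> x tx.
have reg0 (y : M) : r *: y = 0 -> y = 0.
  move=> ry; have := reg 0%N d1 y; rewrite take0 -/r => /(_ _)[|z ->].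
    by exists (fun=> 0); rewrite ry big_ord0.
  by rewrite big_ord0.
have [k twok] := uniformizer_nonunit_dvd unif_t two_nonunit.
have [a augr] : exists a, aug r = a * t.
  by apply: (uniformizer_nonunit_dvd unif_t); rewrite -mE.
have [w rr] : exists w, r * r = w * t%:A.
  (* For r = r_1 + r_g g, r^2 = (aug r)^2 - 2 r_1 r_g + 2 r_1 r_g g; here aug r = a t and 2 = k t,
     so each term is divisible by t. *)
  pose w : R := [ffun h => if h == g then k * r 1%g * r g
                           else a ^+ 2 * t - k * r 1%g * r g].
  exists w; rewrite -scalerAr mulr1.
  have rgE : r g = a * t - r 1%g by rewrite -augr /aug addrC addKr.
  have w1 : w 1%g = a ^+ 2 * t - k * r 1%g * r g.
    by rewrite ffunE eq_sym (negPf g_neq1).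
  have wg : w g = k * r 1%g * r g by rewrite ffunE eqxx.
  apply: gr_ext; rewrite [RHS]gr_scaleE ?w1 ?wg.
    rewrite (gr_mulE r r).1 rgE; transitivity ((a * t) ^+ 2 - 2%:R * (r 1%g * (a * t - r 1%g))).
      by ring.
    by rewrite twok; ring.
  rewrite (gr_mulE r r).2; transitivity (2%:R * (r 1%g * r g)); first by ring.
  by rewrite twok; ring.
apply/reg0/reg0; rewrite scalerA rr -scalerA.
have -> : t%:A *: (x : M) = 0 by exact: tx.
by rewrite scaler0.
Qed.

Lemma gr_scale_decomp M (r : R) (x : base_mod M) :
  r *: (x : M) = (r 1%g *: x + r g *: act g x : base_mod M).
Proof.
rewrite {1}[r]gr_decomp.
have -> : ((r 1%g)%:A + (r g)%:A * gr_elt V g) *: (x : M) =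
          (r 1%g)%:A *: (x : M) + (r g)%:A *: (gr_elt V g *: (x : M)).
  by rewrite scalerDl scalerA.
by [].
Qed.

Lemma actK M (x : base_mod M) : act g (act g x) = x.
Proof. by rewrite actM mulgg act1. Qed.

Lemma submodule_base M (U : set (base_mod M)) :
  submodule U -> (forall x, U x -> U (act g x)) -> @submodule R M U.
Proof.
move=> sU gU; split=> [|r x y Ux Uy]; first by case: sU.
rewrite gr_scale_decomp; apply: (submoduleD sU) => //.
apply: (submoduleD sU); apply: (submoduleZ _ sU) => //.
exact: gU.
Qed.

Lemma fin_gen_base M : finitely_generated M ->
  exists s : seq (base_mod M), spanned_by s.
Proof.
move=> [s span]; pose sb : seq (base_mod M) := s.
exists (sb ++ map (@act _ _ M g) sb) => U sU Us x.
have [c ->] := span x; apply: (submodule_sum (U := U)) => // i _.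
have si : sb`_i \in sb by rewrite mem_nth.
rewrite gr_scale_decomp; apply: (submoduleD sU); apply: (submoduleZ _ sU).
  by apply: Us; rewrite mem_cat si.
by apply: Us; rewrite mem_cat map_f ?orbT.
Qed.

(** A summand is split off by means of functionals: one functional when the fixed vector x splits
    off alone, two when the plane spanned by x and y does. Indecomposability then makes this summand
    all of M. *)
Lemma mcm_indecomposable_type M : mcm_module M -> indecomposable M ->
  [\/ rank1_type g M 1, rank1_type g M (-1) |
      exists j, (exists c, 2%:R = c * t ^+ j.+1) /\ rank2_type g M (t ^+ j)].
Proof.
move=> mcm [[z z0] indec]; have [fgM _] := mcm.
have tf := mcm_torsion_free mcm.
have [s span] := fin_gen_base fgM.
have [n [e [co [coE free]]]] := torsion_free_basis unif_t tf span.
have inj a x y : a != 0 -> a *: x = a *: y -> x = y :> base_mod M.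
  move=> a0 /eqP; rewrite -subr_eq0 -scalerBr => /eqP/(torsion_free unif_t tf a0)/eqP.
  by rewrite subr_eq0 => /eqP.
have co_uniq (d d' : 'I_n -> V) :
    \sum_i d i *: e i = \sum_i d' i *: e i -> d =1 d'.
  move=> /eqP; rewrite -subr_eq0 -sumrB => /eqP dd i.
  apply/eqP; rewrite -subr_eq0; apply/eqP.
  apply: (free (fun i => d i - d' i)); rewrite -[RHS]dd.
  by apply: eq_bigr => k _; rewrite scalerBl.
have coP a x y i : co (a *: x + y) i = a * co x i + co y i.
  apply: (co_uniq (co (a *: x + y)) (fun i => a * co x i + co y i)).
  rewrite -coE {1}[x]coE {1}[y]coE scaler_sumr -big_split; apply: eq_bigr => k _.
  by rewrite scalerDl scalerA.
have coZ a x i : co (a *: x) i = a * co x i.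
  have co0 : co 0 i = 0.
    apply: (co_uniq (co 0) (fun=> 0)); rewrite -coE big1 // => k _.
    by rewrite scale0r.
  by rewrite -[a *: x]addr0 coP co0 addr0.
(* Decompositions into V-submodules stable under g are decompositions over V[G], so a summand
   containing a nonzero vector is everything. *)
have split_off (U W : set (base_mod M)) (x : base_mod M) :
    x != 0 -> U x -> submodule U -> submodule W ->
    (forall v, U v -> U (act g v)) -> (forall v, W v -> W (act g v)) ->
    (forall v, U v -> W v -> v = 0) ->
    (forall v, exists u w, [/\ U u, W w & v = u + w]) -> forall v, U v.
  move=> x0 Ux sU sW gU gW UW0 UW v.
  have [U0|W0] := indec U W (submodule_base sU gU) (submodule_base sW gW) UW0 UW.
    by move: x0; rewrite (U0 x Ux) eqxx.
  by have [u [w [Uu /W0 -> ->]]] := UW v; rewrite addr0.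
have line x : submodule [set v : base_mod M | exists a, v = a *: x].
  split=> [|a _ _ [b ->] [c ->]]; first by exists 0; rewrite scale0r.
  by exists (a * b + c); rewrite scalerDl scalerA.
pose tau (v : base_mod M) := v + act g v.
have tauP a v w : tau (a *: v + w) = a *: tau v + tau w.
  by rewrite /tau actD actZ scalerDr addrACA.
have co_e i l : co (e i) l = (l == i)%:R.
  apply: (co_uniq (co (e i)) (fun l => (l == i)%:R)); rewrite -coE.
  rewrite (bigD1 i) //= eqxx scale1r big1 ?addr0 // => k /negPf->.
  by rewrite scale0r.
have e_neq0 i : e i != 0.
  apply/eqP => ei0; have := co_e i i; rewrite eqxx ei0 -(scale0r (0 : base_mod M)).
  by rewrite coZ mul0r => /esym/eqP; rewrite oner_eq0.
have from_basis (U : set (base_mod M)) : submodule U -> (forall i, U (e i)) -> forall v, U v.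
  by move=> sU Ue v; rewrite [v]coE; apply: submodule_sum => // i _; apply: submoduleZ.
have tau_basis (W : set (base_mod M)) : submodule W -> submodule [set v | W (tau v)].
  move=> sW; split=> [|r v w Wv Ww] /=.
    by rewrite -(scale0r (0 : base_mod M)) -[X in tau X]addr0 tauP scale0r add0r
      /tau -(scale0r (0 : base_mod M)) actZ !scale0r addr0; case: sW.
  by rewrite tauP; apply: (submoduleD sW) => //; apply: (submoduleZ _ sW).
pose prs := enum {: 'I_n * 'I_n}.
have [nz|tau0] := pselect (exists2 p, p \in prs & co (tau (e p.1)) p.2 != 0); last first.
  have taue v : tau v = 0.
    apply: (from_basis [set v | tau v = 0]).
      apply: (tau_basis [set 0]); split=> // r _ _ -> ->.
      by rewrite scaler0 addr0.
    move=> i /=; rewrite [tau _]coE big1 // => l _.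
    suff -> : co (tau (e i)) l = 0 by rewrite scale0r.
    by apply: contrapT => /eqP nz; apply: tau0; exists (i, l); rewrite ?mem_enum.
  have gN (v : base_mod M) : act g v = - v by apply/eqP; rewrite -addr_eq0 addrC; apply/eqP; exact: (taue v).
  have [i _] : exists i, co z i != 0.
    apply: contrapT => nz; case/eqP: z0; rewrite [LHS](coE z) big1 // => i _.
    suff -> : co z i = 0 by rewrite scale0r.
    by apply: contrapT => /eqP zi; apply: nz; exists i.
  apply: Or32; exists (e i); split; last by rewrite gN scaleN1r.
    apply: (split_off [set v | exists a, v = a *: e i] [set v | co v i = 0] (e i)) => //.
    - by exists 1; rewrite scale1r.
    - split=> [|r v w /= vi wi] /=; first by rewrite -(scale0r (e i)) coZ mul0r.
      by rewrite coP vi wi mulr0 addr0.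
    - by move=> v [r ->]; exists (- r); rewrite gN scaleNr.
    - by move=> v /= vi; rewrite gN -scaleN1r coZ vi mulr0.
    - by move=> _ [r ->] /=; rewrite coZ co_e eqxx mulr1 => ->; rewrite scale0r.
    - move=> v; exists (co v i *: e i), (- co v i *: e i + v); split.
      + by exists (co v i).
      + by rewrite /= coP co_e eqxx mulr1 addNr.
      + by rewrite scaleNr addNKr.
  by move=> r re; apply: contrapT => /eqP/(torsion_free unif_t tf)/(_ re)/eqP; apply/negP.
(* Among all coefficients of [tau] on the basis, that of e_l in tau(e_i) has least valuation j.
   Hence t^j divides [tau], and [sg] is the quotient. *)
have [a [d [a0 dE] [[i l] _ dil]]] := uniformizer_factor unif_t nz.
have [t0 tnu val] := unif_t; have [j [u uu aE]] := val a a0.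
have tj0 : t ^+ j != 0 by rewrite expf_neq0.
have u0 : u != 0 by apply: contraTneq uu => ->; rewrite unitr0.
have /choice[sg sgE] : forall v, exists w, tau v = t ^+ j *: w.
  apply: (from_basis [set v | exists w, tau v = t ^+ j *: w]).
    apply: (tau_basis [set v | exists w, v = t ^+ j *: w]).
    split=> [|r _ _ [v ->] [w ->]]; first by exists 0; rewrite scaler0.
    by exists (r *: v + w); rewrite scalerDr !scalerA [r * _]mulrC.
  move=> k /=; exists (\sum_m (u * d (k, m)) *: e m); rewrite [LHS]coE scaler_sumr.
  apply: eq_bigr => m _; rewrite scalerA; congr (_ *: _).
  by rewrite (dE (k, m)) ?mem_enum // aE mulrA [u * _]mulrC.
have sgP r v w : sg (r *: v + w) = r *: sg v + sg w.
  by apply: (inj _ _ _ tj0); rewrite -sgE tauP !sgE scalerDr !scalerA [r * _]mulrC.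
have g_tau (v : base_mod M) : act g (tau v) = tau v by rewrite /tau actD actK addrC.
have tau_g (v : base_mod M) : tau (act g v) = tau v by rewrite /tau actK addrC.
have g_sg (v : base_mod M) : act g (sg v) = sg v.
  by apply: (inj _ _ _ tj0); rewrite -actZ -sgE g_tau.
have sg_g (v : base_mod M) : sg (act g v) = sg v by apply: (inj _ _ _ tj0); rewrite -!sgE tau_g.
(* [th] is normalised by th(x) = 1; [mu] is invariant under g, since [sg] is, and mu(y) = 1. *)
pose th v := u^-1 * co v l; pose mu v := th (sg v).
have thP r v w : th (r *: v + w) = r * th v + th w by rewrite /th coP; ring.
have muP r v w : mu (r *: v + w) = r * mu v + mu w by rewrite /mu sgP thP.
pose y := e i; pose x := sg y.
have thx : th x = 1.
  have : t ^+ j * co x l = u * t ^+ j by rewrite -coZ -sgE (dE (i, l)) ?mem_enum // dil mulr1.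
  by rewrite mulrC => /(mulIf tj0) cx; rewrite /th cx mulVr.
have muy : mu y = 1 := thx.
have x0 : x != 0.
  apply/eqP => x0; move: thx; rewrite x0 -(scale0r x) /th coZ mul0r mulr0 => /esym/eqP.
  by rewrite oner_eq0.
have gx : act g x = x by apply: g_sg.
have gy : act g y = t ^+ j *: x - y by rewrite -sgE /tau addrC addKr.
have th0 : th 0 = 0 by rewrite -(scale0r x) /th coZ mul0r mulr0.
have mu0 : mu 0 = 0.
  by have := muP 1 0 0; rewrite scale1r addr0 mul1r => /esym/eqP; rewrite -subr_eq0 addrK => /eqP.
have thZ r v : th (r *: v) = r * th v by rewrite -[r *: v]addr0 thP th0 addr0.
have muZ r v : mu (r *: v) = r * mu v by rewrite -[r *: v]addr0 muP mu0 addr0.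
pose m := mu x.
(* Since x is fixed, t^j sg(x) = tau(x) = 2 x; now apply [th]. Whether m is a unit decides between
   rank one and rank two. *)
have two_m : 2%:R = t ^+ j * m.
  rewrite -thZ -[t ^+ j *: _]sgE /tau gx -[X in X + _](scale1r x) thP thx mulr1.
  by rewrite mulr2n.
have [um|num] := boolP (m \is a GRing.unit).
  apply: Or31; exists x; split; last by rewrite scale1r.
    apply: (split_off [set v | exists a, v = a *: x] [set v | mu v = 0] x) => //.
    - by exists 1; rewrite scale1r.
    - by split=> // r v w /= vi wi; rewrite muP vi wi mulr0 addr0.
    - by move=> v [r ->]; exists r; rewrite actZ gx.
    - by move=> v /= vi; rewrite /mu sg_g.
    - move=> _ [r ->] /=; rewrite muZ => /eqP; rewrite mulf_eq0 => /orP[/eqP->|m0].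
        by rewrite scale0r.
      by move: um; rewrite /m (eqP m0) unitr0.
    - move=> v; exists ((mu v / m) *: x), (- (mu v / m) *: x + v); split.
      + by exists (mu v / m).
      + by rewrite /= muP -/m mulNr divrK // addNr.
      + by rewrite scaleNr addNKr.
  by move=> r rx; apply: contrapT => /eqP/(torsion_free unif_t tf)/(_ rx)/eqP; apply/negP.
have [m' mE] := uniformizer_nonunit_dvd unif_t num.
(* The determinant of [th] and [mu] on x and y, that is of (1, th y; m, 1). It is a unit because m
   is not, so x and y span a complement of the common kernel. *)
pose D := 1 - m * th y.
have uD : D \is a GRing.unit.
  apply: contraT => nD; have [D' DE] := uniformizer_nonunit_dvd unif_t nD.
  case/negP: tnu; apply/unitrP; exists (D' + m' * th y).
  suff e1 : (D' + m' * th y) * t = 1 by rewrite [t * _]mulrC e1.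
  by rewrite mulrDl -DE mulrAC -mE /D subrK.
have free2 c b : c *: x + b *: y = 0 -> c = 0 /\ b = 0.
  move=> cb.
  have e1 : c + b * th y = 0 by rewrite -th0 -cb thP thZ thx mulr1.
  have e2 : c * m + b = 0 by rewrite -mu0 -cb muP muZ muy mulr1.
  have e3 : b * D = 0.
    transitivity ((c * m + b) - m * (c + b * th y)); first by rewrite /D; ring.
    by rewrite e1 e2 mulr0 subrr.
  have b0 : b = 0 by apply: (mulIr uD); rewrite e3 mul0r.
  by split=> //; move: e1; rewrite b0 mul0r addr0.
apply: Or33; exists j; split; first by exists m'; rewrite two_m mE exprS; ring.
exists x, y; split=> //.
apply: (split_off [set v | exists c d, v = c *: x + d *: y]
  [set v | th v = 0 /\ mu v = 0] x) => //.
- by exists 1, 0; rewrite scale1r scale0r addr0.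
- split=> [|r _ _ [c [b ->]] [c' [b' ->]]].
    by exists 0, 0; rewrite !scale0r addr0.
  exists (r * c + c'), (r * b + b').
  by rewrite !scalerDl scalerDr !scalerA addrACA.
- split=> [|r v w /= [thv muv] [thw muw]]; first by [].
  by rewrite thP muP thv thw muv muw mulr0 addr0.
- move=> v [c [b ->]]; exists (c + b * t ^+ j), (- b).
  rewrite actD !actZ gx gy scalerDr scalerN scalerA scalerDl scaleNr addrA.
  by [].
- move=> v /= [thv muv]; split; last by rewrite /mu sg_g.
  (* From g = t^j sg - 1 follows th(g v) = t^j mu(v) - th(v), so the common kernel of [th] and [mu]
     is stable under g. *)
  have -> : act g v = (-1) *: v + t ^+ j *: sg v.
    by rewrite -sgE /tau scaleN1r addKr.
  by rewrite thP thv thZ -/(mu v) muv !mulr0 addr0.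
- move=> v [c [b ->]] /= []; rewrite thP muP thZ muZ thx muy -/m mulr1 mulr1 => e1 e2.
  have e3 : b * D = 0.
    transitivity ((c * m + b) - m * (c + b * th y)); first by rewrite /D; ring.
    by rewrite e1 e2 mulr0 subrr.
  have b0 : b = 0 by apply: (mulIr uD); rewrite e3 mul0r.
  move: e1; rewrite b0 mul0r addr0 => ->.
  by rewrite !scale0r addr0.
- move=> v; pose b := (mu v - m * th v) / D; pose c := th v - b * th y.
  have bD : b * D = mu v - m * th v by rewrite /b divrK.
  exists (c *: x + b *: y), (- c *: x + (- b *: y + v)); split.
  + by exists c, b.
  + rewrite /= !thP !muP thx -/m muy !mulr1; split; first by rewrite /c; ring.
    apply/eqP; rewrite addrA addrC; apply/eqP.
    transitivity (mu v - m * th v - b * D); first by rewrite /c /D; ring.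
    by rewrite bD subrr.
  + by rewrite !scaleNr addrACA subrr add0r addNKr.
Qed.
End GroupOfOrderTwo.

(** * Representation type *)

Section RepresentationType.
Context (V : idomainType) (t : V) (unif_t : uniformizer t).
Context (gT : finGroupType) (g : gT).
Hypotheses (gT_g : forall h : gT, h = 1%g \/ h = g) (g_neq1 : g != 1%g).
Local Notation R := (grp_ring V gT).
Implicit Types M : lmodType R.

Lemma base_iso M M' (f : base_mod M -> base_mod M') :
    (forall a x y, f (a *: x + y) = a *: f x + f y) ->
    (forall x, f (act g x) = act g (f x)) -> bijective f ->
  isomorphic_modules M M'.
Proof.
move=> flin fg bf; pose f0 : M -> M' := f.
have lf : linear f0.
  move=> r x y; rewrite (gr_scale_decomp gT_g g_neq1) (gr_scale_decomp gT_g g_neq1).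
  rewrite -[f0 _]/(f (r 1%g *: (x : base_mod M) + r g *: act g (x : base_mod M) + y)).
  rewrite -addrA !flin fg addrA.
  by [].
pose F : {linear M -> M'} := HB.pack f0 (GRing.isLinear.Build R M M' *:%R f0 lf).
by exists F.
Qed.

Lemma rank1_iso M M' eps : rank1_type g M eps -> rank1_type g M' eps ->
  isomorphic_modules M M'.
Proof.
move=> [e [span free ge]] [e' [span' free' ge']].
have /choice[c cE] := span; have /choice[c' cE'] := span'.
have inj a b : a *: e = b *: e -> a = b.
  by move=> /eqP; rewrite -subr_eq0 -scalerBl => /eqP/free/eqP; rewrite subr_eq0 => /eqP.
have inj' a b : a *: e' = b *: e' -> a = b.
  by move=> /eqP; rewrite -subr_eq0 -scalerBl => /eqP/free'/eqP; rewrite subr_eq0 => /eqP.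
apply: (@base_iso M M' (fun v => c v *: e')).
- move=> a x y; rewrite scalerA -scalerDl; congr (_ *: _); apply: inj.
  by rewrite -cE scalerDl -scalerA -!cE.
- move=> x; rewrite actZ ge' scalerA; congr (_ *: _); apply: inj.
  by rewrite -cE {1}(cE x) actZ ge scalerA.
exists (fun v => c' v *: e) => v.
  by rewrite [RHS]cE; congr (_ *: _); apply: inj'; rewrite -cE'.
by rewrite [RHS]cE'; congr (_ *: _); apply: inj; rewrite -cE.
Qed.

Lemma rank2_iso M M' b : rank2_type g M b -> rank2_type g M' b ->
  isomorphic_modules M M'.
Proof.
move=> [x [y [span free gx gy]]] [x' [y' [span' free' gx' gy']]].
have /choice[c /choice[d E]] := span; have /choice[c' /choice[d' E']] := span'.
have inj a1 a2 b1 b2 :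
    a1 *: x + a2 *: y = b1 *: x + b2 *: y -> a1 = b1 /\ a2 = b2.
  move=> /eqP; rewrite -subr_eq0 opprD addrACA -!scalerBl => /eqP/free[].
  by move=> /eqP; rewrite subr_eq0 => /eqP-> /eqP; rewrite subr_eq0 => /eqP->.
have inj' a1 a2 b1 b2 :
    a1 *: x' + a2 *: y' = b1 *: x' + b2 *: y' -> a1 = b1 /\ a2 = b2.
  move=> /eqP; rewrite -subr_eq0 opprD addrACA -!scalerBl => /eqP/free'[].
  by move=> /eqP; rewrite subr_eq0 => /eqP-> /eqP; rewrite subr_eq0 => /eqP->.
have lin a v w : c (a *: v + w) = a * c v + c w /\ d (a *: v + w) = a * d v + d w.
  apply: inj; rewrite -E !scalerDl -!scalerA addrACA -scalerDr.
  by rewrite -!E.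
have actE (N : lmodType R) (X Y : base_mod N) a a' : act g X = X ->
    act g Y = b *: X - Y -> act g (a *: X + a' *: Y) = (a + a' * b) *: X + - a' *: Y.
  move=> gX gY; rewrite actD !actZ gX gY scalerDr scalerN scalerA scalerDl scaleNr addrA.
  by [].
have cg v : c (act g v) = c v + d v * b /\ d (act g v) = - d v.
  by apply: inj; rewrite -E {1}(E v) actE.
apply: (@base_iso M M' (fun v => c v *: x' + d v *: y')).
- move=> a v w; have [-> ->] := lin a v w.
  by rewrite !scalerDl scalerDr !scalerA addrACA.
- by move=> v; rewrite (actE _ _ _ _ _ gx' gy'); have [-> ->] := cg v.
exists (fun v => c' v *: x + d' v *: y) => v.
  by rewrite [RHS]E; have [-> ->] := inj' _ _ _ _ (esym (E' (c v *: x' + d v *: y'))).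
by rewrite [RHS]E'; have [-> ->] := inj _ _ _ _ (esym (E (c' v *: x + d' v *: y))).
Qed.

(** If 2 = u t^e, then t^(j+1) divides 2 only for j < e. This leaves e + 2 types, each with at most
    one isomorphism class. *)
Lemma finite_type_order2 : (2%:R : V) \isn't a GRing.unit -> 2%:R != 0 :> V ->
  finite_representation_type R.
Proof.
move=> n2 two0; have [t0 tnu /(_ _ two0)[e [u uu twoE]]] := unif_t.
pose T (i : nat) M := match i with
  | 0%N => rank1_type g M 1 | 1%N => rank1_type g M (-1)
  | j.+2 => rank2_type g M (t ^+ j) end.
(* A type without modules receives the arbitrary value [R^o], to which no M is ever compared. *)
have /choice[L LT] : forall i : 'I_(e.+2), exists L : lmodType R,
    forall M, T i M -> T i L.
  move=> i; have [[M TM]|nM] := pselect (exists M, T i M); first by exists M.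
  by exists R^o => M TM; case: nM; exists M.
exists e.+2, L => M mcm indec.
have [r1|r1|[j [[c twoc] r2]]] := mcm_indecomposable_type unif_t gT_g g_neq1 n2 mcm indec.
- by exists ord0; exact: rank1_iso r1 (LT ord0 M r1).
- have i1 : (1 < e.+2)%N by [].
  by exists (Ordinal i1); exact: rank1_iso r1 (LT (Ordinal i1) M r1).
- have je : (j.+2 < e.+2)%N.
    rewrite !ltnS ltnNge; apply/negP => ej; move: twoE; rewrite twoc.
    rewrite -(subnK (leqW ej)) exprD mulrA => /(mulIf (expf_neq0 _ t0)) ue.
    case/negP: tnu; move: uu; rewrite -ue subSn // exprS mulrCA unitrM.
    by case/andP.
  by exists (Ordinal je); exact: rank2_iso r2 (LT (Ordinal je) M r2).
Qed.

(** Evaluation at g is well defined modulo h and carries the basis 1, X of the quotient to the basis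
    1, g of V[G]. *)
Lemma grp_ring_quotient_order2 (h : {poly V}) : h \is monic -> size h = 3 ->
    horner_alg (gr_elt V g) h = 0 -> grp_ring_quotient h g.
Proof.
move=> mh sh h0; pose ev : {poly V} -> R := horner_alg (gr_elt V g).
(* The quotient is formed modulo [mk_monic h], which is h itself only because h is monic of positive
   degree. *)
have mk : mk_monic h = h by rewrite /mk_monic sh mh.
have modh (P : {poly V}) : Pdiv.CommonRing.rmodp P (mk_monic h) = Pdiv.CommonRing.rmodp P h.
  by rewrite mk.
pose f0 (q : {poly %/ h}) : R := ev q.
have zf : zmod_morphism f0 by move=> p q; rewrite /f0 /ev -rmorphB.
have mf : monoid_morphism f0.
  split; first by rewrite /f0 /ev -[1 : {poly %/ h}]/(qpolyC h 1) qpolyCE rmorph1.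
  move=> p q.
  have pq : ((p * q : {poly %/ h}) : {poly V}) =
      Pdiv.CommonRing.rmodp ((p : {poly V}) * q) h by rewrite poly_of_qpolyM modh.
  rewrite /f0 /ev pq -rmorphM [in RHS](Pdiv.RingMonic.rdivp_eq mh ((p : {poly V}) * (q : {poly V}))).
  by rewrite rmorphD rmorphM /= h0 mulr0 add0r.
pose f : {rmorphism {poly %/ h} -> R} := HB.pack f0
  (GRing.isZmodMorphism.Build _ _ f0 zf) (GRing.isMonoidMorphism.Build _ _ f0 mf).
have evE a b : ev (a%:P + b%:P * 'X) = a%:A + b%:A * gr_elt V g.
  by rewrite /ev rmorphD rmorphM /= !horner_algC horner_algX.
have small (p : {poly V}) : (size p <= 2)%N -> p = (p`_0)%:P + (p`_1)%:P * 'X.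
  move=> sp; apply/polyP => i; rewrite coefD coefC coefCM coefX.
  case: i => [|[|i]] /=; rewrite ?mulr0 ?mulr1 ?addr0 ?add0r //.
  by rewrite nth_default // (leq_trans sp).
have size2 a b : (size (a%:P + b%:P * 'X : {poly V})%R < size (mk_monic h))%N.
  rewrite mk sh ltnS; apply: leq_trans (size_polyD _ _) _; rewrite geq_max.
  rewrite (leq_trans (size_polyC_leq1 _)) //= mul_polyC.
  by apply: leq_trans (size_scale_leq _ _) _; rewrite size_polyX.
exists f; split=> [|a|].
- exists (fun r : R => in_qpoly h ((r 1%g)%:P + (r g)%:P * 'X)) => [q|r].
    have sq : (size (q : {poly V}) < 3)%N.
      by apply: (leq_trans (size_mk_monic q)); rewrite mk sh.
    pose a := (q : {poly V})`_0; pose b := (q : {poly V})`_1.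
    have qE : (q : {poly V}) = a%:P + b%:P * 'X := small _ sq.
    have fq : f q = a%:A + b%:A * gr_elt V g by rewrite -evE -qE.
    have fq1 : f q 1%g = a.
      rewrite fq mulr_algl !ffunE /= !eqxx eq_sym (negPf g_neq1).
      by rewrite [_ *: 0]mulr0 addr0 [_ *: 1]mulr1.
    have fqg : f q g = b.
      rewrite fq mulr_algl !ffunE /= !eqxx (negPf g_neq1).
      by rewrite [_ *: 0]mulr0 add0r [_ *: 1]mulr1.
    by apply: val_inj; rewrite [LHS]in_qpoly_small // fq1 fqg [RHS]qE.
  by rewrite /= /f0 in_qpoly_small // evE -(gr_decomp gT_g g_neq1).
- by rewrite /= /f0 /ev qpolyCE horner_algC.
- by rewrite /= /f0 /ev qpolyXE ?sh // horner_algX.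
Qed.
End RepresentationType.

(** * Infinitely many indecomposables when 2 = 0 *)

Definition pair_mod (V : nmodType) : Type := (V * V)%type.
HB.instance Definition _ (V : zmodType) := GRing.Zmodule.copy (pair_mod V) (V * V)%type.

Section InfiniteType.
Context (V : idomainType) (t : V) (unif_t : uniformizer t).
Context (gT : finGroupType) (g : gT).
Hypotheses (gT_g : forall h : gT, h = 1%g \/ h = g) (g_neq1 : g != 1%g).
Hypothesis two0 : 2%:R = 0 :> V.
Local Notation R := (grp_ring V gT).
Local Notation augm := (aug g).

Let augM (r s : R) : augm (r * s) = augm r * augm s.
Proof. exact: (@aug_monoid V gT g gT_g g_neq1).2. Qed.

Let aug1 : augm (1 : R) = 1.
Proof. exact: (@aug_monoid V gT g gT_g g_neq1).1. Qed.

Let augD (r s : R) : augm (r + s) = augm r + augm s.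
Proof. by rewrite /aug !ffunE addrACA. Qed.

(** As 2 = 0, eps^2 = 2 - 2 g vanishes and V[G] is the ring of dual numbers over V. *)
Let eps : R := gr_elt V g - 1.

Let gr_mulC (r s : R) : r * s = s * r.
Proof.
have [e1 eg] := gr_mulE gT_g g_neq1 r s; have [f1 fg] := gr_mulE gT_g g_neq1 s r.
by apply: (gr_ext gT_g); rewrite ?e1 ?f1 ?eg ?fg; ring.
Qed.

Let eps1 : eps 1%g = -1 /\ eps g = 1.
Proof.
rewrite /eps; split; rewrite ffunE [X in _ + X]ffunE.
  by rewrite (gr_gen1 V g_neq1).1 (gr_one1 V g_neq1).1 add0r.
by rewrite (gr_gen1 V g_neq1).2 (gr_one1 V g_neq1).2 subr0.
Qed.

Let eps_sq : eps * eps = 0.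
Proof.
have [e1 eg] := gr_mulE gT_g g_neq1 eps eps.
apply: (gr_ext gT_g); rewrite ?e1 ?eg eps1.1 eps1.2 ffunE.
  by rewrite mulr1 mulrN1 opprK -mulr2n two0.
by rewrite mulr1 mul1r -opprD -mulr2n two0 oppr0.
Qed.

Let decomp (r : R) : r = (augm r)%:A + (r g)%:A * eps.
Proof.
apply: (gr_ext gT_g); rewrite mulr_algl ffunE !gr_scaleE.
  by rewrite (gr_one1 V g_neq1).1 eps1.1 mulr1 mulrN1 addrK.
by rewrite (gr_one1 V g_neq1).2 eps1.2 mulr1 mulr0 add0r.
Qed.

Let sq (r : R) : r * r = (augm r ^+ 2)%:A.
Proof.
have expand (A B : R) : B * B = 0 -> (A + B) * (A + B) = A * A + (A * B + A * B).
  by move=> BB; rewrite mulrDl !mulrDr BB addr0 [B * A]gr_mulC addrA.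
rewrite {1 2}[r]decomp expand; last first.
  set c := (r g)%:A.
  have -> : c * eps * (c * eps) = c * (c * (eps * eps)).
    by rewrite -mulrA [eps * (c * eps)]mulrA [eps * c]gr_mulC !mulrA.
  by rewrite eps_sq !mulr0.
by rewrite -mulr2n -scaler_nat two0 scale0r addr0 mulr_algl scalerA expr2.
Qed.

(* V^2 with [eps = g - 1] acting by [(a, b) |-> (t^j b, 0)]. *)
Definition twist (j : nat) : Type := pair_mod V.
HB.instance Definition _ j := GRing.Zmodule.on (twist j).

Section TwistedModule.
Variable j : nat.

Definition twist_scale (r : R) (x : twist j) : twist j :=
  (augm r * x.1 + r g * t ^+ j * x.2, augm r * x.2).

Fact twist_scA a b x : twist_scale a (twist_scale b x) = twist_scale (a * b) x.
Proof.
rewrite /twist_scale /= augM (gr_mulE gT_g g_neq1 a b).2 mulrA; congr (_, _).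
transitivity (augm a * augm b * x.1 + (augm a * b g + a g * augm b) * t ^+ j * x.2).
  by move: (augm a) (augm b) => aa ab; ring.
congr (_ + _ * _ * _); rewrite /aug.
transitivity (a 1%g * b g + a g * b 1%g + 2%:R * (a g * b g)); first by ring.
by rewrite two0 mul0r addr0.
Qed.

Fact twist_sc1 : left_id 1 twist_scale.
Proof.
by move=> [x y]; rewrite /twist_scale /= aug1 (gr_one1 V g_neq1).2 !mul1r !mul0r addr0.
Qed.

Fact twist_scDr : right_distributive twist_scale +%R.
Proof. by move=> a [x y] [z w]; rewrite /twist_scale; move: (augm a) => aa; congr (_, _) => /=; ring. Qed.

Fact twist_scDl x : {morph twist_scale^~ x : a b / a + b}.
Proof.
move=> a b; rewrite /twist_scale augD.
move: (augm a) (augm b) => aa ab; congr (_, _) => /=; last by ring.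
by rewrite [(a + b) g]ffunE; ring.
Qed.

HB.instance Definition _ := GRing.Zmodule_isLmodule.Build R (twist j)
  twist_scA twist_sc1 twist_scDr twist_scDl.
End TwistedModule.

Lemma twist_alg j (a x y : V) : a%:A *: ((x, y) : twist j) = ((a * x, a * y) : twist j).
Proof.
rewrite -[LHS]/(twist_scale _ _) /twist_scale /= aug_alg // gr_scaleE.
by rewrite (gr_one1 V g_neq1).2 mulr0 !mul0r addr0.
Qed.

Lemma twist_eps j (x y : V) : eps *: ((x, y) : twist j) = ((t ^+ j * y, 0) : twist j).
Proof.
have aug_eps : augm eps = 0 by rewrite /aug eps1.1 eps1.2 addNr.
rewrite -[LHS]/(twist_scale _ _) /twist_scale /= aug_eps eps1.2.
by rewrite !mul0r add0r mul1r.
Qed.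

Let t_neq0 : t != 0. Proof. by case: unif_t. Qed.
Let t_nonunit a : a * t != 1.
Proof.
have [_ tnu _] := unif_t; apply: contraNneq tnu => at1.
by apply/unitrP; exists a; rewrite [t * a]mulrC.
Qed.

Lemma twist_line j (U : set (twist j)) : submodule U ->
  (exists2 u, U u & u != 0) -> exists2 a, a != 0 & U (a, 0).
Proof.
move=> [U0 UL] [[x y] Uu u0]; have [y0|y0] := eqVneq y 0.
  by exists x; [apply: contra_neq u0 => ->; rewrite y0 | rewrite -y0].
exists (t ^+ j * y); first by rewrite mulf_neq0 // expf_neq0.
by have := UL eps _ _ Uu U0; rewrite addr0 twist_eps.
Qed.

(** Multiplication by eps brings any nonzero submodule into the first coordinate axis, so two
    nonzero submodules meet there. *)
Lemma twist_indecomposable j : indecomposable (twist j).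
Proof.
split=> [|U W sU sW UW0 _].
  by exists (1, 0); apply/eqP => -[] /eqP; rewrite oner_eq0.
apply: contrapT => /not_orP[nU nW].
have nz (U' : set (twist j)) : ~ (forall x, U' x -> x = 0) -> exists2 u, U' u & u != 0.
  move=> nU'; apply: contrapT => nex; apply: nU' => x U'x.
  by apply: contrapT => /eqP x0; apply: nex; exists x.
have [a a0 Ua] := twist_line sU (nz U nU).
have [b b0 Wb] := twist_line sW (nz W nW).
have ab : ((a * b, 0) : twist j) = 0.
  apply: UW0.
    case: sU => U0 UL; have := UL b%:A _ _ Ua U0.
    by rewrite addr0 twist_alg mulr0 mulrC.
  case: sW => W0 WL; have := WL a%:A _ _ Wb W0.
  by rewrite addr0 twist_alg mulr0.
by case: ab => /eqP; rewrite mulf_eq0 (negPf a0) (negPf b0).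
Qed.

Lemma in_seqM_nil (M : lmodType R) (x : M) : in_seqM [::] x <-> x = 0.
Proof. by split=> [[y ->]|->]; [|exists (fun=> 0)]; rewrite big_ord0. Qed.

Lemma in_seqM_head (M : lmodType R) (r : R) s (x : M) : in_seqM (r :: s) (r *: x).
Proof.
exists (fun i => if i is 0%N then x else 0); rewrite big_ord_recl big1 ?addr0 //.
by move=> i _; rewrite scaler0.
Qed.

Lemma in_seqM1 (M : lmodType R) (r : R) (x : M) :
  in_seqM [:: r] x -> exists y, x = r *: y.
Proof. by move=> [y ->]; exists (y 0%N); rewrite big_ord1. Qed.

(** Nilpotent elements lie in every maximal ideal: 1 = x + y eps with x in m gives eps = eps x after
    multiplication by eps. *)
Lemma maximal_eps (m : idealr R) : maximal_ideal m -> eps \in m.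
Proof.
move=> mm; apply: contrapT => /negP em.
pose J : set R := [set z | exists x y, x \in m /\ z = x + y * eps].
have idJ : is_ideal J.
  split=> [|a _ _ [x [y [xm ->]]] [x' [y' [xm' ->]]]].
    by exists 0, 0; rewrite rpred0 mul0r addr0.
  exists (a * x + x'), (a * y + y'); rewrite rpredD ?idealMr //; split=> //.
  by rewrite mulrDr mulrDl addrACA mulrA.
have [[x [y [xm e1]]]|J1] := pselect (J 1).
  suff : eps * x \in m.
    have -> : eps * x = eps.
      by rewrite -[RHS]mulr1 e1 mulrDr [y * eps]gr_mulC mulrA eps_sq mul0r addr0.
    by rewrite (negPf em).
  exact: idealMr.
have [I IE] := idealr_of idJ J1.
have /mm/(_ eps) : {subset m <= I}.
  by move=> z zm; rewrite IE; apply/asboolP; exists z, 0; rewrite mul0r addr0.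
rewrite (negPf em) IE => /asboolP; case.
by exists 0, 1; rewrite rpred0 add0r mul1r.
Qed.

Lemma mem_aug (m : idealr R) r : eps \in m -> (r \in m) = ((augm r)%:A \in m).
Proof. by move=> em; rewrite {1}[r]decomp rpredDr // idealMr. Qed.

Lemma aug_unit (m : idealr R) r : eps \in m -> r \in m -> augm r \isn't a GRing.unit.
Proof.
move=> em; rewrite (mem_aug _ em) => am; apply/negP => ua.
have := idealMr (augm r)^-1%:A am.
by rewrite mulr_algl scalerA mulVr // scale1r idealr1.
Qed.

Lemma maximal_aug (m : idealr R) r :
  maximal_ideal m -> (r \in m) = (augm r \isn't a GRing.unit).
Proof.
move=> mm; have em := maximal_eps mm.
have [|m0 m0E] := aug_preim_ideal gT_g g_neq1 (nonunit_ideal unif_t) _ (@nonunit_prime V).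
  by rewrite /= unitr1.
have /mm/(_ r) <- : {subset m <= m0}.
  by move=> s sm; rewrite m0E asboolb; apply: aug_unit sm.
by rewrite m0E asboolb.
Qed.

(** Depth and height are both 1. The element t is regular, and no regular pair r, s exists because
    squares are scalars, so that a power of s lies in (r). For the height, every prime contains the
    nilpotent eps and is determined by its scalars. *)
Lemma twist_mcm j : mcm_module (twist j).
Proof.
split.
  exists [:: ((1, 0) : twist j); ((0, 1) : twist j)] => -[x y].
  exists (fun i => if i is 0%N then x%:A else y%:A).
  rewrite big_ord_recl big_ord1 /= !twist_alg !mulr1 !mulr0.
  by congr (_, _) => /=; rewrite ?addr0 ?add0r.
move=> m mm; have mE r := maximal_aug r mm.
have tm : t%:A \in m by rewrite mE aug_alg //; case: unif_t.
exists 1%N; split; split.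
- exists [:: t%:A]; split=> //; first by move=> r; rewrite inE => /eqP->.
  split=> [[|//] _ [x y] /= /in_seqM_nil|].
    rewrite twist_alg => -[/eqP + /eqP]; rewrite !mulf_eq0 (negPf t_neq0) /=.
    by move=> /eqP-> /eqP->; apply/in_seqM_nil.
  exists (1, 0) => /in_seqM1[[x y]]; rewrite twist_alg => -[/eqP].
  by rewrite eq_sym mulrC (negPf (t_nonunit x)).
- move=> [|r [|s l]] // rsm [reg [x nx]]; exfalso.
  have rm : r \in m by apply: rsm; rewrite inE eqxx.
  have sm : s \in m by apply: rsm; rewrite !inE eqxx orbT.
  have reg0 y : r *: y = 0 -> y = 0 :> twist j.
    by move=> ry; apply/in_seqM_nil/(reg 0%N isT); apply/in_seqM_nil.
  have reg1 y : (exists z, s *: y = r *: z) -> exists z, y = r *: z :> twist j.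
    move=> [z e]; apply: in_seqM1; apply: (reg 1%N isT) => /=.
    by rewrite e; apply: in_seqM_head.
  have ar0 : augm r ^+ 2 != 0.
    apply/eqP => a0; have : ((1, 0) : twist j) = 0.
      by apply/reg0/reg0; rewrite scalerA sq a0 scale0r scale0r.
    by case=> /eqP; rewrite oner_eq0.
  have [_ _ /(_ _ ar0)[n [u uu rE]]] := unif_t.
  have [b bE] : exists b, augm s ^+ 2 = b * t.
    apply: (uniformizer_nonunit_dvd unif_t); rewrite expr2 unitrM.
    by move: sm; rewrite mE => /negPf->.
  apply: nx; suff [z ->] : exists z, x = r *: z by apply: in_seqM_head.
  have down k y : (exists z, (s ^+ k) *: y = r *: z) -> exists z, y = r *: z :> twist j.
    elim: k => [|k IHk]; first by rewrite expr0 scale1r.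
    by rewrite exprS -scalerA => /reg1/IHk.
  (* From r^2 = u t^n and s^2 = b t follows s^(2 n) = b^n u^-1 r^2; the factors s then cancel modulo
     r by regularity. *)
  apply: (down (n * 2)%N); rewrite mulnC exprM expr2 sq.
  exists (r *: ((b ^+ n * u^-1)%:A *: x)).
  rewrite !scalerA sq mulr_algl scalerA.
  rewrite -(rmorphXn (in_alg R)) /= bE exprMn rE.
  congr (_%:A *: _); rewrite [u * _]mulrC mulrACA divrr //.
  by rewrite mulr1 mulrC.
- have [|||K KE] := @aug_preim_ideal V gT g gT_g g_neq1 (fun a => a = 0).
  + by split=> // a b c -> ->; rewrite mulr0 addr0.
  + by move/eqP; rewrite oner_eq0.
  + by move=> a b /eqP; rewrite mulf_eq0 => /orP[/eqP|/eqP]; [left|right].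
  have [|m0 m0E] := aug_preim_ideal gT_g g_neq1 (nonunit_ideal unif_t) _ (@nonunit_prime V).
    by rewrite /= unitr1.
  exists (fun i => if i is 0%N then K else m0); split=> [[|i]|[|i]|] // => [_ r|_|r].
  + by rewrite KE m0E => /asboolP->; rewrite asboolb unitr0.
  + exists t%:A; first by rewrite m0E asboolb -mE.
    by rewrite KE; apply/asboolP; rewrite aug_alg //; apply/eqP.
  + by rewrite m0E asboolb mE.
- move=> [|[|n]] // [c [c1 c2 _]]; exfalso.
  have prime (Q : prime_idealr R) r s : r * s \in Q -> (r \in Q) || (s \in Q).
    exact: prime_idealr_closed_subproof.
  have epsQ (Q : prime_idealr R) : eps \in Q.
    have : eps * eps \in Q by rewrite eps_sq rpred0.
    by case/prime/orP.
  have [x x1 x0] := c2 0%N isT; have [y y2 y1] := c2 1%N isT.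
  have ax0 : augm x != 0.
    by apply: contraNneq x0 => ax; rewrite (mem_aug _ (epsQ _)) ax scale0r rpred0.
  have [_ _ /(_ _ ax0)[k [u uu xE]]] := unif_t.
  have algM (a b : V) : (a * b)%:A = a%:A * b%:A :> R by rewrite mulr_algl scalerA.
  (* The second prime contains a nonzero scalar, hence t, hence every nonunit scalar; nothing is
     left for a third prime. *)
  have tk : (t ^+ k)%:A \in c 1%N.
    move: x1; rewrite (mem_aug _ (epsQ _)) xE => /(idealMr u^-1%:A).
    by rewrite -algM mulrA mulVr // mul1r.
  have tc : t%:A \in c 1%N.
    elim: (k) tk => [|i IHi]; first by rewrite scale1r idealr1.
    by rewrite exprS algM => /prime/orP[].
  case/negP: y1; rewrite (mem_aug _ (epsQ _)).
  have [b ->] := uniformizer_nonunit_dvd unif_t (aug_unit (epsQ (c 2%N)) y2).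
  by rewrite algM idealMr.
Qed.

(** The isomorphism invariant that separates the twists: eps M lies in t^k M exactly for k at most
    j. *)
Definition eps_divisible k (M : lmodType R) :=
  forall x : M, exists y : M, eps *: x = (t ^+ k)%:A *: y.

Lemma eps_divisible_iso k (M N : lmodType R) :
  isomorphic_modules M N -> eps_divisible k M <-> eps_divisible k N.
Proof.
move=> [f [h fK hK]]; split=> dvd x.
  have [y e] := dvd (h x); exists (f y).
  by rewrite -{1}[x]hK -!linearZ e.
have [y e] := dvd (f x); exists (h y); apply: (can_inj fK).
by rewrite !linearZ /= e hK.
Qed.

Lemma twist_eps_divisible k j : eps_divisible k (twist j) <-> (k <= j)%N.
Proof.
split=> [dvd|kj [x y]]; last first.
  exists (t ^+ (j - k) * y, 0); rewrite twist_eps twist_alg mulr0 mulrA -exprD.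
  by rewrite subnKC.
rewrite leqNgt; apply/negP => jk.
have [[x y]] := dvd (0, 1); rewrite twist_eps twist_alg mulr1 => -[e _].
have tj0 : t ^+ j != 0 by rewrite expf_neq0.
move: e; rewrite -(subnKC jk) addSnnS exprD -[LHS]mulr1 -mulrA => /(mulfI tj0)/esym.
rewrite exprS -mulrA mulrC => /eqP; exact/negP/t_nonunit.
Qed.

Lemma infinite_type_order2 : infinite_representation_type R.
Proof.
move=> [n [L iso]].
have /choice[f fE] : forall j : 'I_n.+1, exists i, isomorphic_modules (twist j) (L i).
  by move=> j; apply: iso; [apply: twist_mcm | apply: twist_indecomposable].
suff /leq_card : injective f by rewrite !card_ord ltnn.
move=> j j' ff; have isoj := fE j; have isoj' := fE j'; rewrite ff in isoj.
have le k : (k <= j)%N <-> (k <= j')%N.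
  by rewrite -!twist_eps_divisible (eps_divisible_iso _ isoj) (eps_divisible_iso _ isoj').
by apply: val_inj; apply/eqP; rewrite eqn_leq; apply/andP; split; apply/le.
Qed.
End InfiniteType.

(** * The completion *)

Section CompletionDVR.
Context (R : comNzRingType) (I : idealr R) (pi : R).
Hypotheses (domR : forall x y : R, x * y = 0 -> x = 0 \/ y = 0) (pi0 : pi != 0).
Hypothesis IE : forall x, x \in I <-> exists y, x = y * pi.
Hypothesis unitR : forall x, x \notin I -> exists y, y * x = 1.
Local Notation Ipow n := (ideal_exp [set` I] n).
Local Notation C := (completion I).

Lemma ideal_expP n x : Ipow n x <-> exists y, x = y * pi ^+ n.
Proof.
elim: n x => [|n IHn] x; first by split=> // _; exists x; rewrite mulr1.
split=> [[s sI ->]|[y ->]]; last first.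
  exists [:: (pi, y * pi ^+ n)]; last by rewrite big_seq1 exprS mulrCA.
  move=> u; rewrite inE => /eqP->; split=> /=; last by apply/IHn; exists y.
  by apply/IE; exists 1; rewrite mul1r.
rewrite big_seq; elim/big_ind: _ => [|a b [y ->] [z ->]|u /sI[/IE[y ->] /IHn[z ->]]].
- by exists 0; rewrite mul0r.
- by exists (y + z); rewrite mulrDl.
- by exists (y * z); rewrite exprS; ring.
Qed.

Lemma domR_cancel (x y z : R) : x != 0 -> y * x = z * x -> y = z.
Proof.
move=> /eqP x0 /eqP; rewrite -subr_eq0 -mulrBl => /eqP/domR[/eqP|//].
by rewrite subr_eq0 => /eqP.
Qed.

Lemma pi_exp_neq0 n : pi ^+ n != 0.
Proof.
elim: n => [|n IHn]; first by rewrite oner_eq0.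
by apply/eqP; rewrite exprS => /domR[/eqP|/eqP]; apply/negP.
Qed.

Lemma ideal_exp_le n m x : (n <= m)%N -> Ipow m x -> Ipow n x.
Proof.
move=> /subnK<- /ideal_expP[y ->]; apply/ideal_expP.
by exists (y * pi ^+ (m - n)); rewrite exprD mulrA.
Qed.

Lemma ideal_expN n x : Ipow n x -> Ipow n (- x).
Proof. by move=> xn; rewrite -mulN1r; apply: ideal_expM. Qed.

Lemma coherent_diff (a : nat -> R) m n : (forall n, Ipow n (a n.+1 - a n)) ->
  (n <= m)%N -> Ipow n (a m - a n).
Proof.
move=> ca; elim: m => [|m IHm]; first by rewrite leqn0 => /eqP->; rewrite subrr; apply: ideal_exp0.
rewrite leq_eqVlt ltnS => /orP[/eqP->|nm]; first by rewrite subrr; apply: ideal_exp0.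
rewrite -(subrK (a m) (a m.+1)) -addrA; apply: ideal_expD; last exact: IHm.
exact: ideal_exp_le (ca m).
Qed.

Lemma completion_limit (a : nat -> R) : (forall n, Ipow n (a n.+1 - a n)) ->
  exists s : coherent_seq I, coh_val s = a.
Proof. by move=> ca; have cb : a \in coherent I by [apply/asboolP]; exists (CoherentSeq cb). Qed.

Definition completion_proj : {rmorphism coherent_seq I -> completion I} :=
  \pi_({ideal_quot (null_ideal I)})%qT.
Local Notation proj := completion_proj.

Lemma completion_projP (x : completion I) : exists s, x = proj s.
Proof.
by exists (generic_quotient.repr x); rewrite /completion_proj /= generic_quotient.reprK.
Qed.

Lemma completion_proj_eq (s r : coherent_seq I) :
  proj s = proj r <-> forall n, Ipow n (s n - r n).
Proof.
have -> : proj s = proj r <-> s - r \in null_ideal I.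
  by rewrite Quotient.idealrBE; split=> [->|/eqP].
by split=> [/asboolP|] ?; [|apply/asboolP].
Qed.

Lemma coherentP (s : coherent_seq I) n : Ipow n (s n.+1 - s n).
Proof. by have /asboolP := valP s. Qed.

Lemma completion_unit (s : coherent_seq I) : (forall n, s n.+1 \notin I) ->
  exists w, w * proj s = 1.
Proof.
move=> sI; have /choice[b bE] : forall n, exists y, y * s n.+1 = 1.
  by move=> n; apply: unitR.
(* Since I^0 = R, the term s_0 is unconstrained and may fail to be invertible; only s_1, s_2, .. are
   inverted, whence the shift. *)
have [|r rE] := @completion_limit (fun n => b n.-1).
  case=> [//|n]; rewrite [_.+2.-1]/= [_.+1.-1]/=.
  have -> : b n.+1 - b n = - (b n.+1 * b n) * (s n.+2 - s n.+1).
    transitivity (b n.+1 * (b n * s n.+1) - b n * (b n.+1 * s n.+2)); last by ring.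
    by rewrite !bE !mulr1.
  exact: ideal_expM (coherentP s n.+1).
exists (proj r); rewrite -rmorphM -(rmorph1 proj); apply/completion_proj_eq.
case=> [//|n]; have -> : (r * s) n.+1 - (1 : coherent_seq I) n.+1 = r n.+1 * s n.+1 - 1 by [].
have -> : r n.+1 = b n by rewrite rE.
by rewrite bE subrr; apply: ideal_exp0.
Qed.

Fact const_coherent (x : R) : (fun=> x) \in coherent I.
Proof. by apply/asboolP => n; rewrite subrr; apply: ideal_exp0. Qed.

Definition const_seq (x : R) : coherent_seq I := CoherentSeq (const_coherent x).

Let T : completion I := proj (const_seq pi).

Let const_seqX n m : (const_seq pi ^+ n) m = pi ^+ n.
Proof. by elim: n => [//|n IHn]; rewrite !exprS -IHn. Qed.

Lemma completion_T_nonunit w : w * T != 1.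
Proof.
have [s ->] := completion_projP w; apply/eqP.
rewrite -rmorphM -(rmorph1 proj) => /completion_proj_eq/(_ 1%N)/ideal_exp1.
have -> : (s * const_seq pi) 1%N - (1 : coherent_seq I) 1%N = s 1%N * pi - 1 by [].
move=> e; have piI : s 1%N * pi \in I by apply/IE; exists (s 1%N).
by have := rpredB piI e; rewrite opprB addrC subrK idealr1.
Qed.

Lemma completion_T_exp n : T ^+ n != 0.
Proof.
apply/eqP; rewrite -rmorphXn -(rmorph0 proj) => /completion_proj_eq/(_ n.+1)/ideal_expP.
have -> : (const_seq pi ^+ n) n.+1 - (0 : coherent_seq I) n.+1 = pi ^+ n.
  by rewrite const_seqX; apply: subr0.
move=> [y]; rewrite exprS mulrA -{1}[pi ^+ n]mul1r => /(domR_cancel (pi_exp_neq0 n)) e.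
by have : 1 \in I by [apply/IE; exists y]; rewrite idealr1.
Qed.

Lemma completion_factor (a : completion I) : a != 0 ->
  exists n u w, w * u = 1 /\ a = u * T ^+ n.
Proof.
have [s ->] := completion_projP a => s0.
have exn : exists n, ~~ `[< Ipow n (s n) >].
  apply: contrapT => nex; case/eqP: s0; rewrite -(rmorph0 proj).
  apply/completion_proj_eq => n.
  have -> : s n - (0 : coherent_seq I) n = s n by apply: subr0.
  by apply: contrapT => ns; apply: nex; exists n; apply/asboolP.
(* The valuation is N, where N + 1 is the first index n with s_n outside I^n; index 0 is excluded
   because I^0 = R. *)
case: (ex_minnP exn) => -[|N] /asboolP nN minN; first by case: nN.
have sN : Ipow N (s N).
  by apply: contrapT => ns; have := minN N (introN (asboolP _) ns); rewrite ltnn.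
have /choice[b bE] : forall m, exists y, (N <= m)%N -> s m = y * pi ^+ N.
  move=> m; have [Nm|] := leqP N m; last by exists 0.
  have /ideal_expP[y e] : Ipow N (s m).
    rewrite -[s m](subrK (s N)); apply: ideal_expD sN.
    by apply: coherent_diff => // n; apply: coherentP.
  by exists y.
have bI m : (N < m)%N -> b m \notin I.
  move=> Nm; apply/negP => /IE[y bm]; apply: nN.
  have -> : s N.+1 = s m - (s m - s N.+1) by rewrite subKr.
  apply: ideal_expD; last first.
    by apply: ideal_expN; apply: coherent_diff => // n; apply: coherentP.
  by apply/ideal_expP; exists y; rewrite bE ?(ltnW Nm) // bm exprS mulrA.
(* Cancelling pi^N costs N levels of coherence, and b_m is known to be a unit only for m > N; the
   shift by N + 1 settles both. *)
have [n|r rE] := @completion_limit (fun m => b (m + N.+1)%N).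
  have le : (N <= n + N.+1)%N by rewrite addnS leqW // leq_addl.
  have /ideal_expP[y e] := coherentP s (n + N.+1).
  apply/ideal_expP; exists (y * pi).
  apply: (domR_cancel (pi_exp_neq0 N)).
  rewrite mulrBl addSn -!bE ?leqW // e addnS -addSn exprD exprS; ring.
have [|w wr] := @completion_unit r.
  by move=> n; rewrite rE bI // addSn addnS ltnS leqW // leq_addl.
exists N, (proj r), w; split=> //.
rewrite -rmorphXn -rmorphM; apply/completion_proj_eq => n.
have -> : s n - (r * const_seq pi ^+ N) n = - (s (n + N.+1)%N - s n).
  rewrite opprB; congr (_ - _).
  rewrite [LHS](_ : _ = r n * (const_seq pi ^+ N) n) // const_seqX rE -bE //.
  by rewrite addnS leqW // leq_addl.
by apply: ideal_expN; apply: coherent_diff; [apply: coherentP | apply: leq_addr].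
Qed.
End CompletionDVR.

(** Equality of the underlying commutative rings, rather than an isomorphism, lets a statement about
    R be rewritten into one about the domain V. *)
Lemma dvr_idomain (R : comNzRingType) (T : R) :
    (forall w, w * T != 1) -> (forall n, T ^+ n != 0) ->
    (forall a, a != 0 -> exists n u w, w * u = 1 /\ a = u * T ^+ n) ->
  exists (V : idomainType) (t : V), uniformizer t /\ (V : comNzRingType) = R.
Proof.
(* The structure of R is opened into its components so that the commutative ring underlying the
   rebuilt domain is R by computation. *)
case: R T => S c; case: c => c1 c2 c3 c4 c5 c6 c7 c8 c9 c10 c11 c12.
set R := GRing.ComNzRing.Pack _ => T Tnu Tn0 val.
have [inv [invP invN]] : exists inv : R -> R,
    (forall x, (exists y, y * x = 1) -> inv x * x = 1) /\
    (forall x, ~ (exists y, y * x = 1) -> inv x = x).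
  have /choice[inv E] : forall x : R, exists y,
      ((exists y, y * x = 1) -> y * x = 1) /\ (~ (exists y, y * x = 1) -> y = x).
    move=> x; have [[y yx]|n] := pselect (exists y, y * x = 1); last by exists x.
    by exists y; split=> // n; case: n; exists y.
  by exists inv; split=> x; case: (E x).
pose un (x : R) := `[< exists y, y * x = 1 >].
have mulVx : {in un, left_inverse 1 inv *%R} by move=> x /asboolP/invP.
have unitPl (x y : R) : y * x = 1 -> un x by move=> yx; apply/asboolP; exists y.
have invx_out : {in [predC un], inv =1 id}.
  by move=> x /asboolPn/invN.
have dom (x y : R) : x * y = 0 -> (x == 0) || (y == 0).
  move=> xy; apply: contraT; rewrite negb_or => /andP[/val[n [u [w [wu xE]]]] ].
  move=> /val[m [u' [w' [wu' yE]]]]; have /eqP := Tn0 (n + m)%N; case.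
  transitivity (w * u * (w' * u') * T ^+ (n + m)); first by rewrite wu wu' !mul1r.
  transitivity (w * w' * (x * y)); last by rewrite xy mulr0.
  by rewrite xE yE exprD; ring.
pose U : comUnitRingType :=
  HB.pack (GRing.ComNzRing.sort R) (GRing.ComNzRing_hasMulInverse.Build R mulVx unitPl invx_out).
pose V : idomainType := HB.pack (GRing.ComUnitRing.sort U) (GRing.ComUnitRing_isIntegral.Build U dom).
exists V, T; split; last first.
  by [].
have uE (x : V) : (x \is a GRing.unit) = un x by [].
split.
- exact: (Tn0 1%N).
- by rewrite uE; apply/asboolP => -[y yT]; have := Tnu y; rewrite yT eqxx.
- move=> a /val[n [u [w [wu aE]]]]; exists n, u => //.
  by rewrite uE; apply/asboolP; exists w.
Qed.

(** * Localizations of rings of integers *)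

Section LocalizationFacts.
Context (A : idomainType) (P : prime_idealr A).
Local Notation L := (localization P).

Lemma localization_domain (x y : L) : x * y = 0 -> x = 0 \/ y = 0.
Proof.
move=> /(congr1 val); rewrite rmorphM rmorph0 => /eqP; rewrite mulf_eq0.
by case/orP => /eqP e; [left|right]; apply: val_inj; rewrite rmorph0.
Qed.

Let notinP_neq0 (s : A) : s \notin P -> @tofrac A s != 0.
Proof. by apply: contraNneq => /eqP; rewrite tofrac_eq0 => /eqP->; apply: rpred0. Qed.

Lemma localization_unit (x : L) : x \notin locI P -> exists y : L, y * x = 1.
Proof.
move=> xI; have /asboolP[a [s [sP xE]]] := valP x.
have aP : a \notin P.
  by apply: contra xI => aP; apply/asboolP; exists a, s.
have yL : @tofrac A s / @tofrac A a \in loc_pred P by apply/asboolP; exists s, a.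
exists (Localization yL); apply: val_inj.
rewrite rmorphM rmorph1 /= [val x]xE mulrC mulf_div [X in _ / X]mulrC.
by rewrite divff // mulf_neq0 ?notinP_neq0.
Qed.

Lemma locI_eq0 : (forall x : L, x \in locI P -> x = 0) -> forall a, a \in P -> a = 0.
Proof.
move=> I0 a aP.
have aL : @tofrac A a / @tofrac A 1 \in loc_pred P.
  by apply/asboolP; exists a, 1; rewrite idealr1.
have /(congr1 val) : Localization aL = 0.
  by apply: I0; apply/asboolP; exists a, 1; rewrite idealr1.
by rewrite rmorph0 /= rmorph1 divr1 => /eqP; rewrite tofrac_eq0 => /eqP.
Qed.
End LocalizationFacts.

(* If 1/t were integral, clearing denominators in its equation would give a
   polynomial identity whose constant term is 1 = 0. *)
Lemma inv_polyX_not_integral (F : fieldType) (K : fieldType)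
    (phi : {rmorphism {poly F} -> K}) (z : K) :
  injective phi -> phi 'X * z = 1 -> ~ integralOver phi z.
Proof.
move=> phi_inj Xz [p mp /rootP pz].
pose n := (size p).-1; have sp : size p = n.+1.
  by rewrite prednK // size_poly_gt0 monic_neq0.
(* The reversed polynomial X^n p(1/X): its constant term is the leading coefficient 1 of p. *)
pose q := \sum_(i < n.+1) p`_i * 'X ^+ (n - i).
have q0 : q = 0.
  apply: phi_inj; rewrite rmorph0 /q rmorph_sum /=.
  transitivity (phi 'X ^+ n * (map_poly phi p).[z]); last by rewrite pz mulr0.
  rewrite (@horner_coef_wide _ n.+1) -?sp ?size_poly // sp mulr_sumr.
  apply: eq_bigr => i _; rewrite coef_map /= rmorphM rmorphXn.
  have le : (i <= n)%N by rewrite -ltnS.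
  have -> : phi 'X ^+ n = phi 'X ^+ (n - i) * phi 'X ^+ i by rewrite -exprD subnK.
  transitivity (phi p`_i * phi 'X ^+ (n - i) * (phi 'X * z) ^+ i); last first.
    by rewrite exprMn; ring.
  by rewrite Xz expr1n mulr1.
have := congr1 (horner^~ 0) q0; rewrite /q horner0 horner_sum big_ord_recr /=.
rewrite big1 ?add0r => [|i _].
  rewrite subnn mulr1; move/monicP: mp; rewrite lead_coefE -/n => ->.
  by rewrite -polyC1 hornerC => /eqP; rewrite oner_eq0.
by rewrite hornerM hornerXn expr0n subn_eq0 leqNgt ltn_ord mulr0.
Qed.

(** If P A_P were zero, P would be zero, the ring of integers would be a field, and 2 = 0 in it. The
    last excludes number fields; over F(X) the inverse of X would be integral. *)
Lemma locI_neq0 (k : global_field) (P : prime_idealr (ring_of_integers k)) :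
  maximal_ideal P -> 2%:R \in locI P -> ~ (forall x, x \in locI P -> x = 0).
Proof.
move=> mP two I0; have P0 := locI_eq0 I0.
have two0 : 2%:R = 0 :> ring_of_integers k.
  have /(congr1 val) := I0 _ two; rewrite rmorph_nat rmorph0 => /eqP.
  by rewrite -(rmorph_nat (@tofrac _)) tofrac_eq0 => /eqP.
have inv (x : ring_of_integers k) : x != 0 -> exists y, x * y = 1.
  move=> x0; have xP : x \notin P by apply: contraNN x0 => /P0->.
  have [y /P0/eqP] := maximal_ideal_inv mP xP; rewrite subr_eq0 => /eqP xy.
  by exists y.
case: k P mP two I0 P0 two0 inv => [K|F K] P _ _ _ _ two0 inv.
  have /eqP := congr1 val two0; rewrite rmorph_nat rmorph0.
  by rewrite -(rmorph_nat (in_alg K)) fmorph_eq0.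
pose phi : {rmorphism {poly F} -> K} := in_alg K \o @tofrac {poly F}.
have phi_inj : injective phi by move=> p q /fmorph_inj/eqP; rewrite tofrac_eq => /eqP.
have Xint : phi 'X \in integral_pred phi by apply/asboolP/integral_id.
have [|y] := inv (IntClosure Xint).
  apply/eqP => /(congr1 val); rewrite rmorph0 -(rmorph0 phi) => /phi_inj/eqP.
  by rewrite polyX_eq0.
move=> /(congr1 val); rewrite rmorphM rmorph1 => /(inv_polyX_not_integral phi_inj); apply.
by have /asboolP := valP y.
Qed.

(** * The two cases of the theorem *)

Section OrderTwo.
Context (V : idomainType) (t : V) (unif_t : uniformizer t).
Context (gT : finGroupType) (card2 : #|[set: gT]%SET| = 2).
Hypothesis two_nonunit : (2%:R : V) \isn't a GRing.unit.

Lemma order2_elements (g : gT) : g != 1%g -> forall h : gT, h = 1%g \/ h = g.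
Proof.
move=> g1 h; have [->|h1] := eqVneq h 1%g; first by left.
have [->|hg] := eqVneq h g; first by right.
have /card_uniqP e : uniq [:: 1%g; g; h] by rewrite /= !inE negb_or ![1%g == _]eq_sym g1 h1 eq_sym hg.
have : (#|[:: 1%g; g; h]| <= #|[set: gT]%SET|)%N by apply: subset_leq_card; apply/fintype.subsetP => x _; rewrite inE.
by rewrite e card2.
Qed.

Lemma order2_generator : exists g : gT, g != 1%g.
Proof.
apply: contrapT => nex; have := card2; suff -> : [set: gT]%SET = [set 1%g]%SET by rewrite cards1.
apply/setP => h; rewrite !inE; apply/esym/eqP; apply: contrapT => /eqP h1.
by apply: nex; exists h.
Qed.

Lemma generator_neq1 (g : gT) : generator [set: gT]%SET g -> g != 1%g.
Proof.
move=> gen; apply/eqP => g1; have := card2.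
by rewrite (eqP gen) g1 cycle1 cards1.
Qed.

Lemma cohen_macaulay_order2 (M : lmodType (grp_ring V gT)) :
  mcm_module M -> indecomposable M -> cohen_macaulay_ring (invariant_ring M).
Proof.
have [g g1] := order2_generator; have gT_g := order2_elements g1.
move=> mcm indec; have [t0 _ _] := unif_t.
case: (mcm_indecomposable_type unif_t gT_g g1 two_nonunit mcm indec) => [r1|r1|[j [_ r2]]].
- by apply: (cohen_macaulay_rank1 gT_g unif_t r1); left.
(* In characteristic 2 the eigenvalue -1 is 1 and the action is trivial; only otherwise is it a
   reflection. *)
- have [two0|two0] := eqVneq (2%:R : V) 0.
    apply: (cohen_macaulay_rank1 gT_g unif_t r1); left; apply/eqP.
    by rewrite eq_sym -subr_eq0 opprK -mulr2n two0.
  by apply: (cohen_macaulay_rank1 gT_g unif_t r1); right.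
- by apply: (cohen_macaulay_rank2 gT_g unif_t r2); rewrite expf_neq0.
Qed.

Lemma proposition_mixed : 2%:R != 0 :> V ->
  [/\ forall g : gT, generator [set: gT]%SET g ->
        grp_ring_quotient ('X^2 - 1 : {poly V}) g,
      finite_representation_type (grp_ring V gT)
    & forall M : lmodType (grp_ring V gT),
        mcm_module M -> indecomposable M -> cohen_macaulay_ring (invariant_ring M)].
Proof.
have [g g1] := order2_generator; have gT_g := order2_elements g1.
move=> two0; split; [|by apply: (finite_type_order2 unif_t gT_g g1)|].
  move=> {g1 gT_g}g /generator_neq1 g1; have gT_g := order2_elements g1.
  apply: (grp_ring_quotient_order2 gT_g g1).
  - by rewrite -polyC1 monicXnsubC.
  - by rewrite -polyC1 size_XnsubC.
  - rewrite rmorphB rmorphXn rmorph1 /= horner_algX expr2 gr_eltM (mulgg gT_g g1).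
    exact: subrr.
exact: cohen_macaulay_order2.
Qed.

Lemma proposition_equichar : 2%:R = 0 :> V ->
  [/\ forall g : gT, generator [set: gT]%SET g ->
        grp_ring_quotient (('X - 1) ^+ 2 : {poly V}) g,
      infinite_representation_type (grp_ring V gT)
    & forall M : lmodType (grp_ring V gT),
        mcm_module M -> indecomposable M -> cohen_macaulay_ring (invariant_ring M)].
Proof.
have [g g1] := order2_generator; have gT_g := order2_elements g1.
move=> two0; split; [|by apply: (infinite_type_order2 unif_t gT_g g1)|].
  move=> {g1 gT_g}g /generator_neq1 g1; have gT_g := order2_elements g1.
  apply: (grp_ring_quotient_order2 gT_g g1).
  - by rewrite -polyC1 monic_exp // monicXsubC.
  - by rewrite -polyC1 size_exp_XsubC.
  - have two0R : 2%:R = 0 :> grp_ring V gT.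
      by rewrite -(rmorph_nat (in_alg (grp_ring V gT))) two0 rmorph0.
    rewrite rmorphXn rmorphB rmorph1 /= horner_algX.
    rewrite expr2 mulrBr mulr1 mulrBl mul1r gr_eltM (mulgg gT_g g1).
    rewrite -[gr_elt V 1%g]/(1 : grp_ring V gT).
    by rewrite opprB -mulr2n -mulr_natl two0R mul0r.
exact: cohen_macaulay_order2.
Qed.
End OrderTwo.

Lemma ring_char_two (R : nzRingType) (p : nat) :
  ring_char R p -> 2%:R = 0 :> R -> p = 2%N.
Proof.
move=> ch two0; have p2 : (p %| 2)%N by apply/ch.
have p1 : p != 1%N.
  apply/eqP => p1; have /ch/eqP : (p %| 1)%N by rewrite p1.
  by rewrite oner_eq0.
by move: p2 p1; rewrite dvdn_divisors // !inE => /orP[/eqP->|/eqP->].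
Qed.

Lemma ideal_quot_natr (R : comNzRingType) (I : idealr R) n :
  n%:R = 0 :> {ideal_quot I} <-> n%:R \in I.
Proof.
pose f : {rmorphism R -> {ideal_quot I}} := \pi_({ideal_quot I})%qT.
have -> : (n%:R \in I) = (n%:R - 0 \in I) by rewrite subr0.
rewrite Quotient.idealrBE -(rmorph_nat f) -(rmorph0 f).
by split=> [e|/eqP//]; apply/eqP.
Qed.

(** Mixed characteristic includes characteristic 0, so 2 is nonzero. In the other case 2 vanishes in
    the residue field because it is not a unit, so the common characteristic is 2 and 2 = 0 in V. *)
Lemma proposition_dvr (V : idomainType) (t : V) (gT : finGroupType) :
    uniformizer t -> (2%:R : V) \isn't a GRing.unit -> #|[set: gT]%SET| = 2 ->
  (mixed_characteristic V ->
     [/\ forall g : gT, generator [set: gT]%SET g ->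
           grp_ring_quotient ('X^2 - 1 : {poly V}) g,
         finite_representation_type (grp_ring V gT)
       & forall M : lmodType (grp_ring V gT),
           mcm_module M -> indecomposable M ->
           cohen_macaulay_ring (invariant_ring M)]) /\
  (equicharacteristic V ->
     [/\ forall g : gT, generator [set: gT]%SET g ->
           grp_ring_quotient (('X - 1) ^+ 2 : {poly V}) g,
         infinite_representation_type (grp_ring V gT)
       & forall M : lmodType (grp_ring V gT),
           mcm_module M -> indecomposable M ->
           cohen_macaulay_ring (invariant_ring M)]).
Proof.
move=> unif_t two_nu card2; split=> [[ch _]|[p [ch chres]]].
  apply: (proposition_mixed unif_t card2 two_nu).
  by apply/eqP => /ch; rewrite dvd0n.
apply: (proposition_equichar unif_t card2 two_nu).
have [|m mE] := idealr_of (nonunit_ideal unif_t); first by rewrite /= unitr1.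
have mm : maximal_ideal m.
  apply: maximal_idealW => x; rewrite mE asboolb negbK => ux.
  by exists x^-1; rewrite divrr // subrr rpred0.
have p2 : p = 2%N.
  apply: ring_char_two (chres m mm) _; apply/ideal_quot_natr.
  by rewrite mE asboolb.
by apply/ch; rewrite p2.
Qed.

Local Close Scope classical_set_scope.
Theorem proposition1p10
  (k : global_field) (n : nat) (gT : finGroupType)
  (rG : mx_representation (ring_of_integers k) [set: gT] n)
  (P : prime_idealr (ring_of_integers k)) (pi : localization P) (p : nat)
  (rG_faithful : mx_faithful rG)
  (P_maximal : maximal_ideal P)
  (pi_gen : forall x : localization P,
     x \in locI P <-> exists y : localization P, x = y * pi)
  (p_char : ring_char {ideal_quot (locI P)} p)
  (p_dvd : (p %| #|[set: gT]|)%N)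
  (G_Z2 : [set: gT] \isog Zp 2) :
  let Ohat := completion (locI P) in
  (mixed_characteristic Ohat ->
     [/\ forall g : gT, generator [set: gT] g ->
           grp_ring_quotient ('X^2 - 1 : {poly Ohat}) g,
         finite_representation_type (grp_ring Ohat gT)
       & forall M : lmodType (grp_ring Ohat gT),
           mcm_module M -> indecomposable M ->
           cohen_macaulay_ring (invariant_ring M)]) /\
  (equicharacteristic Ohat ->
     [/\ forall g : gT, generator [set: gT] g ->
           grp_ring_quotient (('X - 1) ^+ 2 : {poly Ohat}) g,
         infinite_representation_type (grp_ring Ohat gT)
       & forall M : lmodType (grp_ring Ohat gT),
           mcm_module M -> indecomposable M ->
           cohen_macaulay_ring (invariant_ring M)]).
Proof.
Proof.
have card2 : #|[set: gT]| = 2 by rewrite (card_isog G_Z2) card_Zp.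
have two_I : 2%:R \in locI P.
  by apply/ideal_quot_natr/p_char; move: p_dvd; rewrite card2.
have pi0 : pi != 0.
  apply/eqP => pi0; apply: (locI_neq0 P_maximal two_I) => x /pi_gen[y ->].
  by rewrite pi0 mulr0.
have domL := @localization_domain _ P; have unitL := @localization_unit _ P.
(* A factorization 2 = c pi in the localization persists in the completion through constant
   sequences, where pi has no inverse. *)
have two_nu : forall y : completion (locI P), y * 2%:R != 1.
  have /pi_gen[c two_c] := two_I; move=> y.
  have -> : 2%:R = completion_proj (locI P) (const_seq _ c) *
      completion_proj _ (const_seq _ pi).
    rewrite -rmorphM -(rmorph_nat (completion_proj (locI P))).
    apply/completion_proj_eq => i.
    have -> : (2%:R : coherent_seq (locI P)) i - (const_seq (locI P) c * const_seq _ pi) i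
        = 2%:R - c * pi by [].
    by rewrite two_c subrr; apply: ideal_exp0.
  by rewrite mulrA; apply: completion_T_nonunit.
have [V [t [unif_t VE]]] := dvr_idomain (completion_T_nonunit pi_gen)
  (completion_T_exp domL pi0 pi_gen) (completion_factor domL pi0 pi_gen unitL).
(* Replaces the completion by V throughout the goal, group rings and invariant rings included. *)
move=> Ohat; rewrite /Ohat; move: two_nu; rewrite -VE => two_nu.
apply: (proposition_dvr unif_t) => //.
by apply/unitrP => -[y [y2 _]]; have := two_nu y; rewrite y2 eqxx.
Qed.
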